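(* Let $K$ be a field of characteristic zero. Let $H\in K[x,y,z]^3$ satisfy $H(0)=0$, and suppose that $H$ has nilpotent Jacobian matrix $JH$ and components linearly independent over $K$. If two linearly independent constant linear combinations of the components of $H$ are algebraically dependent over $K$ (that is, there are linearly independent $\ell_1,\ell_2\in(K^3)^*$ with $\ell_1(H),\ell_2(H)$ algebraically dependent over $K$), then $H$ is linearly conjugate over $K$ to $\mathcal N_P$ for some $P\in K[t]\setminus K$ with $P(0)=0$; that is, there is $T\in\mathrm{GL}_3(K)$ with $T\circ H\circ T^{-1}=\mathcal N_P$.
   Context: For $H=(H_1,H_2,H_3)$, $JH$ is the matrix of partial derivatives with respect to $x,y,z$; for $\ell=(a,b,c)\in(K^3)^*$, $\ell(H)=aH_1+bH_2+cH_3$. The components are linearly independent over $K$ if no nonzero constant linear form annihilates $H$. A matrix $T$ is identified with the linear map it defines, so $(T\circ H\circ T^{-1})(v)=T\,H(T^{-1}v)$. For $P\in K[t]$, $$\mathcal N_P(x,y,z)=\bigl(P(y+x^2),\ z-2xP(y+x^2),\ P(y+x^2)^2\bigr).$$ *)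

(* Defs.v *)
From mathcomp Require Import all_boot all_order all_algebra.
From mathcomp Require Export mpoly.

Set Implicit Arguments.
Unset Strict Implicit.
Unset Printing Implicit Defensive.

Import GRing.Theory.

Local Open Scope ring_scope.

(* Polynomial maps K^n -> K^m are column vectors of polynomials. *)
Notation polymap K n m := 'cV[{mpoly K[n]}]_m.

Section PolynomialMaps.
Variable K : fieldType.

Definition polymap_at n m (H : polymap K n m) (v : 'cV[K]_n) : 'cV[K]_m :=
  \col_i (H i 0).@[fun j => v j 0].

Definition jacobian n m (H : polymap K n m) : 'M[{mpoly K[n]}]_(m, n) :=
  \matrix_(i, j) (H i 0)^`M(j).

Definition nilpotent_mx (R : pzRingType) n (A : 'M[R]_n) : Prop :=
  exists k : nat, A ^+ k = 0.

(* l is a constant linear form on K^m, given by its coefficients. *)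
Definition linform n m (l : 'rV[K]_m) (H : polymap K n m) : {mpoly K[n]} :=
  \sum_j l 0 j *: H j 0.

Definition components_lin_indep n m (H : polymap K n m) : Prop :=
  forall l : 'rV[K]_m, linform l H = 0 -> l = 0.

Definition alg_dependent n (f g : {mpoly K[n]}) : Prop :=
  exists2 Q : {mpoly K[2]}, Q != 0 & Q \mPo [tuple f; g] = 0.

(* The substitution v := A v, where the variables are the coordinates of v. *)
Definition lin_subst n (A : 'M[K]_n) (p : {mpoly K[n]}) : {mpoly K[n]} :=
  p \mPo [tuple \sum_j A i j *: 'X_j | i < n].

(* v |-> T H(T^-1 v); meaningful for T \in unitmx. *)
Definition lin_conj n (T : 'M[K]_n) (H : polymap K n n) : polymap K n n :=
  map_mx (@mpolyC n K) T *m map_mx (lin_subst (invmx T)) H.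

Definition poly_at n (P : {poly K}) (u : {mpoly K[n]}) : {mpoly K[n]} :=
  (map_poly (@mpolyC n K) P).[u].

Definition N_map (P : {poly K}) : polymap K 3 3 :=
  let x : {mpoly K[3]} := 'X_(inord 0) in
  let y : {mpoly K[3]} := 'X_(inord 1) in
  let z : {mpoly K[3]} := 'X_(inord 2) in
  let Pu := poly_at P (y + x ^+ 2) in
  \col_(i < 3) [:: Pu; z - 2%:R * x * Pu; Pu ^+ 2]`_i.

End PolynomialMaps.

(* Main.v *)
Require Import Defs.
From HB Require Import structures.
From mathcomp Require Import all_boot all_order all_algebra.
From mathcomp Require Import ring.
From Stdlib Require Classical_Prop.

Set Implicit Arguments.
Unset Strict Implicit.
Unset Printing Implicit Defensive.

Import GRing.Theory.
Local Open Scope ring_scope.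

(** A linear change of coordinates ([extend_free_pair], [lin_conjM]) makes the
    two dependent combinations the first and third components of H = (f, g, h).
    Nilpotency gives tr JH = 0 and tr (JH)^2 = 0 ([lin_conj_traces]). By
    algebraic dependence the 2 x 2 minors of (f, h) vanish ([dependent_minors]),
    so that the gradient of h is rho times that of f, for a rational function
    rho that is not constant since f, h and 1 are linearly independent
    ([slope_not_scalar]).

    If moreover f_x + h_z = 0 then f_x = f_z = 0 ([planar_nilpotent]): f is
    constant along the integral curves of d/dx + rho d/dz, which are straight
    lines, and its leading form on them is an algebraic equation for rho over
    K(y). In particular f_y <> 0 ([f_depends_on_y]).

    In general, use x, f, z as coordinates of the field E of rational functions.
    Let d1 and d3 be the derivatives in x and z at constant f, and D = d1 + rho
    d3. Thus D kills f and h. The traces say that D kills g ([kernel_der_g]) and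
    that D y is the derivative of g in f, at constant x and z ([kernel_der_y]);
    hence D (D y) is a constant of D, and the integral curves of D are
    parabolas. The polynomial f is constant along them; its leading form for the
    weights 1, 2, 1 of x, y, z relates rho and the curvature over K, and so the
    curvature, like rho, is a constant of d1 and d3 ([curvature_const]). It
    follows that D y = e0 + e1 x + e2 z with e0, e1, e2 in the field of
    constants of d1 and d3 ([kernel_affine]).

    The coefficients e0, e1, e2 and rho are still functions of f. Read x, y, z
    as new variables X, Y, Z over E, keeping these coefficients; D becomes a
    vector field nabla that lowers the weighted degree. A nonconstant divisor v
    over K of some f - k, of least weighted degree, is killed by nabla
    ([invariant_divisor]): otherwise nabla v and f(X, Y, Z) - f have a common
    divisor, which specialises to a divisor of some f - k' of smaller weighted
    degree. Since rho is not in K, the equation nabla v = 0 splits into two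
    equations over K, so that v_x and v_z are affine multiples of v_y. These
    affine forms are the partial derivatives of a quadratic polynomial a(x, z)
    over K ([affine_slopes]), and D (y + a) = 0 ([kernel_slopes]). The shear y
    -> y - a therefore reduces to the planar case: f = p(u) and h = q(u) with u
    = y + a ([level_coordinate]).

    The trace conditions now determine the third component: g = b1 x + b2 z -
    p(u) a_x - q(u) a_z, with b1 p + b2 q equal to the quadratic part of a
    evaluated at (p, q) ([third_component]). So (p, q) parametrises a conic;
    having a polynomial parametrisation, it is a parabola ([polynomial_conic]).
    In linear coordinates adapted to this parabola, H is the required map
    ([straight_conj]). *)

(** * Characteristic zero *)

Definition char_zero (R : pzRingType) := forall n : nat, n.+1%:R != 0 :> R.

Lemma char_zero_field (K : fieldType) : [pchar K] =i pred0 -> char_zero K.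
Proof. by move=> /pcharf0P charK n; rewrite charK. Qed.

Lemma char_zero_inj (R S : pzRingType) (f : {rmorphism R -> S}) :
  injective f -> char_zero R -> char_zero S.
Proof.
move=> fI charR n; rewrite -(rmorph_nat f) -(rmorph0 f).
by apply: contra (charR n) => /eqP/fI ->.
Qed.

(** * Polynomials in several variables *)

Lemma mpoly_ring_ind n (R : nzRingType) (P : {mpoly R[n]} -> Prop) :
  (forall c, P c%:MP) -> (forall i, P 'X_i) ->
  (forall p q, P p -> P q -> P (p + q)) ->
  (forall p q, P p -> P q -> P (p * q)) -> forall p, P p.
Proof.
move=> PC PX PD PM p.
rewrite [p]mpolyE; apply: (big_ind P) => [|//|m _]; first exact: (PC 0).
rewrite -mul_mpolyC; apply: (PM); first exact: PC.
rewrite mpolyXE_id; apply: (big_ind P) => [|//|i _]; first exact: (PC 1).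
by elim: (m i) => [|k IH]; [exact: (PC 1) | rewrite exprS; apply: PM].
Qed.

Lemma mpoly_rmorph_ext n (R : nzRingType) (S : nzRingType)
    (f g : {rmorphism {mpoly R[n]} -> S}) :
  (forall c, f c%:MP = g c%:MP) -> (forall i, f 'X_i = g 'X_i) -> f =1 g.
Proof.
move=> fgC fgX; apply: mpoly_ring_ind => // p q.
  by rewrite !rmorphD => -> ->.
by rewrite !rmorphM => -> ->.
Qed.

Lemma mderivXU n (R : nzRingType) (i j : 'I_n) :
  ('X_i : {mpoly R[n]})^`M(j) = (i == j)%:R.
Proof.
rewrite mderivX mnm1E; case: eqP => [->|_]; last by rewrite scale0r.
have -> : (U_(j) - U_(j) = 0 :> 'X_{1..n})%MM.
  by apply/mnmP => k; rewrite mnmBE mnm0E subnn.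
by rewrite mpolyX0 scale1r.
Qed.

Lemma mderiv_eq0_coeff n (R : idomainType) (p : {mpoly R[n]}) i (m : 'X_{1..n}) :
  char_zero R -> p^`M(i) = 0 -> m i != 0%N -> p@_m = 0.
Proof.
move=> charR dp0 mi; have Uim : (U_(i) <= m)%MM by rewrite lep1mP.
have /eqP := congr1 (mcoeff (m - U_(i))%MM) dp0.
rewrite mcoeff_mderiv submK // mcoeff0 -mulr_natr mulf_eq0.
by rewrite (negbTE (charR _)) orbF => /eqP.
Qed.

Lemma mderivs_eq0 n (R : idomainType) (p : {mpoly R[n]}) :
  char_zero R -> (forall i, p^`M(i) = 0) -> p = (p@_0)%:MP.
Proof.
move=> charR dp; apply/mpolyP => m; rewrite mcoeffC.
have [->|] := eqVneq m 0%MM; first by rewrite mulr1.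
rewrite mulr0 => m0; have /existsP[i mi] : [exists i, m i != 0%N].
  apply: contraT; rewrite negb_exists => /forallP m_eq0.
  by case/eqP: m0; apply/mnmP => i; rewrite mnm0E; apply/eqP/negPn.
exact: mderiv_eq0_coeff mi.
Qed.

Lemma msize_mderiv_lt n (R : nzRingType) (p : {mpoly R[n]}) i :
  p != 0 -> (msize p^`M(i) < msize p)%N.
Proof.
rewrite -msize_poly_eq0 -lt0n => p_gt0; rewrite -(prednK p_gt0) ltnS.
rewrite msizeE; apply/bigmax_leqP_seq => m mdp _.
have mp : (m + U_(i))%MM \in msupp p.
  move: mdp; rewrite !mcoeff_msupp mcoeff_mderiv.
  by apply: contra => /eqP ->; rewrite mul0rn.
by have := msize_mdeg_lt mp; rewrite mdegD mdeg1 addn1; case: (msize p).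
Qed.

Lemma poly_nonroot (K : fieldType) (p : {poly K}) :
  char_zero K -> p != 0 -> exists t, p.[t] != 0.
Proof.
move=> charK p0; pose s : seq K := [seq k%:R | k <- iota 0 (size p)].
have us : uniq s.
  rewrite map_inj_in_uniq ?iota_uniq // => a b _ _ /eqP.
  wlog ab : a b / (a <= b)%N.
    by move=> W; case: (leqP a b) => [/W //|/ltnW/W H]; rewrite eq_sym => /H.
  rewrite -subr_eq0 -opprB oppr_eq0 -natrB //.
  case Eba: (b - a)%N => [|k]; last by rewrite (negbTE (charK k)).
  by move=> _; apply/eqP; rewrite eqn_leq ab -subn_eq0 Eba.
have /allPn[t _ tp] : ~~ all (root p) s.
  apply/negP => ap; have := max_poly_roots p0 ap us.
  by rewrite size_map size_iota ltnn.
by exists t.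
Qed.

(** A polynomial has a nonzero partial derivative unless it is constant; at a
    point where that derivative does not vanish, the restriction to the
    corresponding axis-parallel line is a nonzero univariate polynomial. *)
Lemma mpoly_nonroot n (K : fieldType) (p : {mpoly K[n]}) :
  char_zero K -> p != 0 -> exists v, p.@[v] != 0.
Proof.
move=> charK; have [d] := ubnP (msize p); elim: d p => // d IH p le_pd p0.
have [/existsP[i dp0]|] := boolP [exists i, p^`M(i) != 0]; last first.
  rewrite negb_exists => /forallP dp.
  have pC := mderivs_eq0 charK (fun i => eqP (negbNE (dp i))).
  by exists (fun=> 0); rewrite pC mevalC -(@mpolyC_eq0 n) -pC.
have size_dp : (msize p^`M(i) < d)%N.
  by rewrite -ltnS; apply: leq_trans le_pd; rewrite ltnS msize_mderiv_lt.
have [v dpv] := IH _ size_dp dp0.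
pose line := mmap (@polyC K) (fun j => (v j)%:P + (i == j)%:R * 'X).
have line_val q t : (line q).[t] = q.@[fun j => v j + (i == j)%:R * t].
  move: q; rewrite /line; apply: mpoly_ring_ind => [c|j|q r Hq Hr|q r Hq Hr].
  - by rewrite mmapC mevalC hornerC.
  - by rewrite mevalXU mmapX mmap1U !hornerE -polyC_natr hornerC.
  - by rewrite mmapD mevalD hornerD Hq Hr.
  - by rewrite rmorphM mevalM hornerM Hq Hr.
have line_deriv q : (line q)^`() = line q^`M(i).
  move: q; rewrite /line; apply: mpoly_ring_ind => [c|j|q r Hq Hr|q r Hq Hr].
  - by rewrite mmapC mderivC mmap0 derivC.
  - rewrite mmapX mmap1U mderivXU eq_sym derivD derivC add0r -polyC_natr.
    by rewrite derivM derivC mul0r add0r derivX mulr1 polyC_natr rmorph_nat.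
  - by rewrite mmapD mderivD mmapD derivD Hq Hr.
  - by rewrite rmorphM mderivM mmapD !rmorphM derivM Hq Hr.
have [|t pt] := @poly_nonroot K (line p) charK.
  apply: contraNneq dpv => line0.
  have := line_val p^`M(i) 0; rewrite -line_deriv line0 deriv0 horner0 => E.
  by apply/eqP; rewrite [RHS]E; apply: meval_eq => j; rewrite mulr0 addr0.
by exists (fun j => v j + (i == j)%:R * t); rewrite -line_val.
Qed.

(** * Derivations *)

Record derivation (R : comNzRingType) := Derivation {
  der_fun :> R -> R;
  derD : {morph der_fun : a b / a + b};
  derM : forall a b, der_fun (a * b) = der_fun a * b + a * der_fun b }.

Section DerivationTheory.
Variables (R : comNzRingType) (d : derivation R).

Lemma der0 : d 0 = 0.
Proof. by apply: (addrI (d 0)); rewrite -derD !addr0. Qed.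

Lemma der1 : d 1 = 0.
Proof. by apply: (addrI (d 1)); rewrite addr0 -{3}[1]mulr1 derM mulr1 mul1r. Qed.

Lemma derN a : d (- a) = - d a.
Proof. by apply: (addrI (d a)); rewrite -derD !subrr der0. Qed.

Lemma derB a b : d (a - b) = d a - d b.
Proof. by rewrite derD derN. Qed.

Lemma der_nat n : d n%:R = 0.
Proof. by elim: n => [|n IH]; rewrite ?der0 // -addn1 natrD derD IH der1 addr0. Qed.

Lemma der_sum I (r : seq I) (P : pred I) F :
  d (\sum_(i <- r | P i) F i) = \sum_(i <- r | P i) d (F i).
Proof. exact: (big_morph d (derD d) der0). Qed.

Lemma derX a n : d a = 0 -> d (a ^+ n) = 0.
Proof.
move=> da; elim: n => [|n IH]; first by rewrite expr0 der1.
by rewrite exprS derM da IH mul0r mulr0 addr0.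
Qed.

End DerivationTheory.

Lemma derV (E : fieldType) (d : derivation E) a : d a^-1 = - (d a / a ^+ 2).
Proof.
have [->|a0] := eqVneq a 0; first by rewrite invr0 der0 mul0r oppr0.
apply: (mulfI a0); apply: (addrI (d a / a)).
have -> : d a / a + a * d a^-1 = 0 by rewrite -derM divff // der1.
by field.
Qed.

Lemma der_div (E : fieldType) (d : derivation E) a b :
  b != 0 -> d (a / b) = (d a * b - a * d b) / b ^+ 2.
Proof. by move=> b0; rewrite derM derV; field. Qed.

Section Combination.
Variables (R : comNzRingType) (d1 : derivation R) (a : R) (d2 : derivation R).

Fact der_comb_add : {morph (fun e => d1 e + a * d2 e) : u v / u + v}.
Proof. by move=> u v; rewrite /= !derD; ring. Qed.

Fact der_comb_mul u v :
  d1 (u * v) + a * d2 (u * v) =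
  (d1 u + a * d2 u) * v + u * (d1 v + a * d2 v).
Proof. by rewrite !derM; ring. Qed.

Definition der_comb := Derivation der_comb_add der_comb_mul.

Lemma der_combE e : der_comb e = d1 e + a * d2 e. Proof. by []. Qed.

Fact der_scale_add : {morph (fun e => a * d2 e) : u v / u + v}.
Proof. by move=> u v; rewrite /= !derD; ring. Qed.

Fact der_scale_mul u v : a * d2 (u * v) = a * d2 u * v + u * (a * d2 v).
Proof. by rewrite !derM; ring. Qed.

Definition der_scale := Derivation der_scale_add der_scale_mul.

Lemma der_scaleE e : der_scale e = a * d2 e. Proof. by []. Qed.

End Combination.

Lemma mpoly_der_ext n (K : comNzRingType) (S : comNzRingType)
    (j : {rmorphism {mpoly K[n]} -> S}) (D1 D2 : {mpoly K[n]} -> S) :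
  (forall p q, D1 (p + q) = D1 p + D1 q) ->
  (forall p q, D2 (p + q) = D2 p + D2 q) ->
  (forall p q, D1 (p * q) = D1 p * j q + j p * D1 q) ->
  (forall p q, D2 (p * q) = D2 p * j q + j p * D2 q) ->
  (forall c, D1 c%:MP = D2 c%:MP) -> (forall i, D1 'X_i = D2 'X_i) ->
  D1 =1 D2.
Proof.
move=> D1D D2D D1M D2M DC DX; apply: mpoly_ring_ind => // p q Hp Hq.
  by rewrite D1D D2D Hp Hq.
by rewrite D1M D2M Hp Hq.
Qed.

Section ConstantCoefficients.
Variables (E : fieldType) (d : derivation E).
Hypothesis charE : char_zero E.

Definition const_coefs (p : {poly E}) := forall i, d p`_i = 0.

Lemma const_coefsC a : d a = 0 -> const_coefs a%:P.
Proof. by move=> da i; rewrite coefC; case: eqP => // _; rewrite der0. Qed.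

Lemma const_coefsX : const_coefs 'X.
Proof. by move=> i; rewrite coefX der_nat. Qed.

Lemma const_coefsD p q : const_coefs p -> const_coefs q -> const_coefs (p + q).
Proof. by move=> cp cq i; rewrite coefD derD cp cq addr0. Qed.

Lemma const_coefsN p : const_coefs p -> const_coefs (- p).
Proof. by move=> cp i; rewrite coefN derN cp oppr0. Qed.

Lemma const_coefsM p q : const_coefs p -> const_coefs q -> const_coefs (p * q).
Proof.
move=> cp cq i; rewrite coefM der_sum big1 // => j _.
by rewrite derM cp cq mul0r mulr0 addr0.
Qed.

Lemma const_coefs_deriv p : const_coefs p -> const_coefs p^`().
Proof.
move=> cp i; rewrite coef_deriv -mulr_natr derM cp der_nat.
by rewrite mul0r mulr0 addr0.
Qed.

Lemma der_horner p e : const_coefs p -> d p.[e] = p^`().[e] * d e.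
Proof.
elim/poly_ind: p => [|p c IH] cp; first by rewrite deriv0 !horner0 der0 mul0r.
have cp' : const_coefs p.
  by move=> i; have := cp i.+1; rewrite coefD coefMX coefC addr0.
have dc : d c = 0 by have := cp 0%N; rewrite coefD coefMX coefC add0r.
rewrite derivD derivC addr0 derivM derivX mulr1 !hornerE derD dc addr0.
by rewrite derM IH //; ring.
Qed.

Lemma deriv_eq0_const (p : {poly E}) : p^`() = 0 -> p = (p`_0)%:P.
Proof.
move=> dp; apply/polyP => -[|i]; rewrite coefC //=.
have /eqP := congr1 (fun q : {poly E} => q`_i) dp.
by rewrite coef_deriv coef0 -mulr_natr mulf_eq0 (negbTE (charE _)) orbF => /eqP.
Qed.

(** Differentiate the relation of least degree: its derivative does not vanish
    at [e]. *)
Lemma algebraic_const p e : const_coefs p -> p != 0 -> p.[e] = 0 -> d e = 0.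
Proof.
have [m] := ubnP (size p); elim: m p => // m IH p size_p cp p0 pe.
have [dp0|dp_neq0] := eqVneq p^`() 0.
  by case/eqP: p0; rewrite (deriv_eq0_const dp0) hornerC in pe *; rewrite pe.
have [dpe|dpe] := eqVneq p^`().[e] 0.
  apply: (IH p^`()) => //; last exact: const_coefs_deriv.
  exact: leq_trans (lt_size_deriv p0) size_p.
have /eqP := der_horner e cp.
by rewrite pe der0 eq_sym mulf_eq0 (negbTE dpe) => /eqP.
Qed.

(** Since [d x = 1], the element [x] is transcendental over the constants. *)
Lemma const_coefs_root x p : d x = 1 -> const_coefs p -> p.[x] = 0 -> p = 0.
Proof.
move=> dx cp px; apply/eqP/negPn/negP => p0.
by have /eqP := algebraic_const cp p0 px; rewrite dx oner_eq0.
Qed.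

End ConstantCoefficients.

(** * Extending derivations to the field of fractions *)

(** The property is boolean so that a numerator and a denominator can be
    chosen. *)
Definition fractions_of (R : idomainType) (E : fieldType) (c : R -> E) :=
  forall e, exists nm : R * R, (nm.2 != 0) && (e == c nm.1 / c nm.2).

Local Notation tofrac := (@FracField.tofrac _).

Lemma tofrac_fractions (R : idomainType) :
  @fractions_of R {fraction R} (@FracField.tofrac R).
Proof.
elim/quotW => -[[n m] /= m0]; exists (n, m); rewrite m0 /=; apply/eqP.
have m0F : tofrac m != 0 by rewrite tofrac_eq0.
apply: (mulIf m0F); rewrite mulfVK //.
unlock FracField.tofrac; rewrite -[LHS]FracField.pi_mul; apply/eqmodP.
rewrite /= FracField.equivfE /FracField.mulf /=.
by rewrite !numden_Ratio ?mulf_neq0 ?oner_neq0 // mulr1 mulr1 mulrC.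
Qed.

Section FractionDerivation.
Variables (R : idomainType) (E : fieldType) (c : {rmorphism R -> E}).
Hypotheses (cI : injective c) (cF : fractions_of c).

Lemma fraction_neq0 m : (c m != 0) = (m != 0).
Proof. by rewrite -(rmorph0 c) (inj_eq cI). Qed.

Lemma fractionP e : exists n m, m != 0 /\ e = c n / c m.
Proof. by have [[n m] /andP[/= m0 /eqP eq_e]] := cF e; exists n, m. Qed.

Lemma der_eq0_fractions (d : derivation E) :
  (forall a, d (c a) = 0) -> forall e, d e = 0.
Proof.
move=> dc e; have [n [m [m0 ->]]] := fractionP e.
by rewrite der_div ?fraction_neq0 // !dc !(mul0r, mulr0) subrr mul0r.
Qed.

Variable d : derivation R.

Definition frac_der_fun e : E :=
  let nm := xchoose (cF e) in
  (c (d nm.1) * c nm.2 - c nm.1 * c (d nm.2)) / c nm.2 ^+ 2.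

Lemma frac_der_quotient n m : m != 0 ->
  frac_der_fun (c n / c m) = (c (d n) * c m - c n * c (d m)) / c m ^+ 2.
Proof.
move=> m0; rewrite /frac_der_fun.
case: (xchoose _) (xchooseP (cF (c n / c m))) => n' m' /= /andP[m'0 /eqP E1].
have cm0 : c m != 0 by rewrite fraction_neq0.
have cm'0 : c m' != 0 by rewrite fraction_neq0.
have nm : n * m' = n' * m.
  apply: cI; rewrite !rmorphM; apply: (mulIf (invr_neq0 cm0)).
  by rewrite mulrAC E1; field; rewrite cm0 cm'0.
have nm' : c n * c m' = c n' * c m by rewrite -!rmorphM nm.
have := congr1 c (congr1 d nm); rewrite !derM !rmorphD !rmorphM => dnm.
have {}nm : c n' = c n * c m' / c m by rewrite nm' mulfK.
have {}dnm : c (d n') = (c (d n) * c m' + c n * c (d m') - c n' * c (d m)) / c m.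
  by rewrite dnm addrK mulfK.
by rewrite dnm nm; field; rewrite cm0 cm'0.
Qed.

Fact frac_der_add : {morph frac_der_fun : a b / a + b}.
Proof.
move=> a b; have [n [m [m0 ->]]] := fractionP a.
have [n' [m' [m'0 ->]]] := fractionP b.
have [cm0 cm'0] : c m != 0 /\ c m' != 0 by rewrite !fraction_neq0.
have -> : c n / c m + c n' / c m' = c (n * m' + n' * m) / c (m * m').
  by rewrite rmorphD !rmorphM; field; rewrite cm0 cm'0.
rewrite !frac_der_quotient ?mulf_neq0 // !derD !derM !rmorphD !rmorphM.
by rewrite ?rmorphD ?rmorphM; field; rewrite cm0 cm'0.
Qed.

Fact frac_der_mul a b :
  frac_der_fun (a * b) = frac_der_fun a * b + a * frac_der_fun b.
Proof.
have [n [m [m0 ->]]] := fractionP a.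
have [n' [m' [m'0 ->]]] := fractionP b.
have [cm0 cm'0] : c m != 0 /\ c m' != 0 by rewrite !fraction_neq0.
have -> : c n / c m * (c n' / c m') = c (n * n') / c (m * m').
  by rewrite !rmorphM; field; rewrite cm0 cm'0.
rewrite !frac_der_quotient ?mulf_neq0 // !derM !rmorphD !rmorphM.
by field; rewrite cm0 cm'0.
Qed.

Lemma frac_der : {D : derivation E | forall a, D (c a) = c (d a)}.
Proof.
exists (Derivation frac_der_add frac_der_mul) => a /=.
rewrite -[c a]divr1 -(rmorph1 c) frac_der_quotient ?oner_neq0 //.
by rewrite der1 rmorph0 rmorph1 !mulr1 mulr0 subr0 expr1n divr1.
Qed.

End FractionDerivation.

Section Bracket.
Variables (R : comNzRingType) (d1 d2 : derivation R).

Fact der_bracket_add : {morph (fun e => d1 (d2 e) - d2 (d1 e)) : u v / u + v}.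
Proof. by move=> u v; rewrite /= !derD; ring. Qed.

Fact der_bracket_mul u v :
  d1 (d2 (u * v)) - d2 (d1 (u * v)) =
  (d1 (d2 u) - d2 (d1 u)) * v + u * (d1 (d2 v) - d2 (d1 v)).
Proof. by rewrite !derM !derD !derM; ring. Qed.

Definition der_bracket := Derivation der_bracket_add der_bracket_mul.

Lemma der_bracketE e : der_bracket e = d1 (d2 e) - d2 (d1 e). Proof. by []. Qed.

End Bracket.

(** If a quotient [a / b] has zero partial derivatives then it is also the
    quotient of partial derivatives of [a] and [b], whence an induction on
    the size of [b]. *)
Lemma mpoly_quotient_const n (K : idomainType) (a b : {mpoly K[n]}) :
  char_zero K -> b != 0 -> (forall i, a^`M(i) * b = a * b^`M(i)) ->
  exists k1 k2 : K, k2 != 0 /\ k2 *: a = k1 *: b.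
Proof.
move=> charK; have [s] := ubnP (msize b); elim: s a b => // s IH a b size_b b0 ab.
have [/existsP[i bi0]|] := boolP [exists i, b^`M(i) != 0]; last first.
  rewrite negb_exists => /forallP db0.
  have bC := mderivs_eq0 charK (fun i => eqP (negbNE (db0 i))).
  have aC : a = (a@_0)%:MP.
    apply: mderivs_eq0 => // i; apply/eqP; have /eqP := ab i.
    by rewrite (eqP (negbNE (db0 i))) mulr0 mulf_eq0 (negbTE b0) orbF.
  exists a@_0, b@_0; split; first by rewrite -(@mpolyC_eq0 n) -bC.
  by rewrite aC bC -!mul_mpolyC !mcoeffC eqxx !mulr1 mulrC.
have cross j k : a^`M(j) * b^`M(k) = a^`M(k) * b^`M(j).
  by apply: (mulIf b0); rewrite mulrAC ab [RHS]mulrAC ab; ring.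
have ab2 j : a^`M(i)^`M(j) * b = a * b^`M(i)^`M(j).
  have := congr1 (mderiv j) (ab i); rewrite !mderivM (cross i j) addrC.
  by move/addrI.
have [|j|k1 [k2 [k20 E1]]] := IH a^`M(i) b^`M(i) _ bi0.
- by rewrite -ltnS; apply: leq_trans size_b; rewrite ltnS msize_mderiv_lt.
- apply: (mulIf b0); rewrite mulrAC ab2 mulrAC -ab; ring.
exists k1, k2; split=> //; apply: (mulIf bi0).
by rewrite -scalerAl -ab scalerAl E1 -!scalerAl mulrC.
Qed.

(** * Algebraic dependence and leading forms *)

Section Dependence.
Variables (K E : fieldType) (k : {rmorphism K -> E}).
Hypothesis charE : char_zero E.

Lemma nonconst_transcendental (d : derivation E) a (q : {poly K}) :
  (forall c, d (k c) = 0) -> d a != 0 -> q != 0 -> (map_poly k q).[a] != 0.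
Proof.
move=> dk da q0; apply: contraNneq da => qa; apply/eqP.
apply: (algebraic_const charE _ _ qa); last by rewrite map_poly_eq0.
by move=> i; rewrite coef_map /= dk.
Qed.

(** A polynomial relation with coefficients in [K] between [a] and [b], with [a]
    constant and transcendental over [K], shows that [b] is algebraic over
    the constants. *)
Lemma relation_const (d : derivation E) (a b : E) (T : eqType) (s : seq T)
    (F : T -> K) (u v : T -> nat) (t0 : T) :
  (forall c, d (k c) = 0) -> d a = 0 ->
  (forall q : {poly K}, q != 0 -> (map_poly k q).[a] != 0) ->
  uniq s -> {in s &, injective (fun t => (u t, v t))} ->
  t0 \in s -> F t0 != 0 ->
  \sum_(t <- s) k (F t) * a ^+ u t * b ^+ v t = 0 -> d b = 0.
Proof.
move=> dk da a_trans us uv_inj t0s Ft0 rel.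
pose p := \sum_(t <- s) (k (F t) * a ^+ u t) *: 'X^(v t).
apply: (@algebraic_const _ d charE p).
- move=> i; rewrite coef_sum der_sum big1 // => t _.
  by rewrite coefZ coefXn derM derM dk derX // der_nat !(mul0r, mulr0, addr0).
- apply: contraTneq isT => p0.
  pose q : {poly K} := \sum_(t <- s | v t == v t0) F t *: 'X^(u t).
  have q0 : q != 0.
    apply: contra_neq Ft0 => q0; have := congr1 (fun r : {poly K} => r`_(u t0)) q0.
    rewrite coef0 coef_sum big_mkcond (bigD1_seq t0) //= eqxx => <-.
    rewrite coefZ coefXn eqxx mulr1 big_seq_cond big1 ?addr0 // => t.
    case/andP=> ts tt0; case: eqP => // vt.
    rewrite coefZ coefXn; case: eqP => [ut|_]; last by rewrite mulr0.
    by case/eqP: tt0; apply: uv_inj; rewrite //= -ut vt.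
  case/eqP: (a_trans _ q0).
  have := congr1 (fun r : {poly E} => r`_(v t0)) p0.
  rewrite coef0 coef_sum => <-; rewrite rmorph_sum /= horner_sum big_mkcond /=.
  apply: eq_bigr => t _; rewrite coefZ coefXn eq_sym.
  case: eqP => _; last by rewrite mulr0.
  by rewrite /= map_polyZ map_polyXn !hornerE.
- rewrite /p horner_sum -[RHS]rel; apply: eq_bigr => t _.
  by rewrite !hornerE.
Qed.

End Dependence.

Section LeadingForm.
Variables (n : nat) (K : nzRingType) (E : idomainType) (k : {rmorphism K -> E}).
Variables (w : 'I_n -> nat).

Definition weight (m : 'X_{1..n}) := (\sum_(i < n) m i * w i)%N.

Definition wdeg (p : {mpoly K[n]}) := (\max_(m <- msupp p) weight m)%N.

Lemma weight_le_wdeg p m : m \in msupp p -> (weight m <= wdeg p)%N.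
Proof. by move=> mp; apply: leq_bigmax_seq. Qed.

Lemma wdeg_attained p : p != 0 -> exists2 m, m \in msupp p & weight m = wdeg p.
Proof.
rewrite -msupp_eq0 /wdeg; elim: (msupp p) => // m s IH _; rewrite big_cons.
have [_|lt_m] := leqP (\max_(j <- s) weight j) (weight m).
  by exists m; rewrite ?mem_head.
have [|m' m's <-] := IH; last by exists m'; rewrite // inE m's orbT.
by apply: contraTneq lt_m => ->; rewrite big_nil.
Qed.

Lemma weightD m1 m2 : weight (m1 + m2)%MM = (weight m1 + weight m2)%N.
Proof.
by rewrite /weight -big_split; apply: eq_bigr => i _; rewrite mnmDE mulnDl.
Qed.

Lemma weight1 i : weight U_(i) = w i.
Proof.
rewrite /weight (bigD1 i) //= mnm1E eqxx mul1n big1 ?addn0 // => j ji.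
by rewrite mnm1E eq_sym (negbTE ji).
Qed.

Lemma wdeg_mderiv p i m : p^`M(i)@_m != 0 -> (weight m + w i <= wdeg p)%N.
Proof.
rewrite mcoeff_mderiv -(weight1 i) -weightD => pm.
apply: weight_le_wdeg; rewrite mcoeff_msupp.
by apply: contra pm => /eqP ->; rewrite mul0rn.
Qed.

Lemma wdeg_gt0 p i : (0 < w i)%N -> p^`M(i) != 0 -> (0 < wdeg p)%N.
Proof.
move=> wi dp0; have [m mdp _] := wdeg_attained dp0.
rewrite mcoeff_msupp in mdp; apply: leq_trans (wdeg_mderiv mdp).
exact: leq_trans wi (leq_addl _ _).
Qed.

Variables (h : 'I_n -> {poly E}).
Hypothesis size_h : forall i, (size (h i) <= (w i).+1)%N.

Lemma top_coefM (p q : {poly E}) i j : (size p <= i.+1)%N -> (size q <= j.+1)%N ->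
  (size (p * q)%R <= (i + j).+1)%N /\ (p * q)`_(i + j) = p`_i * q`_j.
Proof.
move=> sp sq; split.
  apply: leq_trans (size_polyMleq _ _) _.
  by have := leq_add sp sq; rewrite addSn addnS; case: (_ + _)%N.
have i_lt : (i < (i + j).+1)%N by rewrite ltnS leq_addr.
rewrite coefM (bigD1 (Ordinal i_lt)) //= addKn big1 ?addr0 // => l.
rewrite -val_eqE /= neq_ltn => /orP[l_lt|l_gt].
  rewrite [q`_ _]nth_default ?mulr0 //; apply: leq_trans sq _.
  by rewrite ltn_subRL ltn_add2r.
by rewrite [p`_ _]nth_default ?mul0r //; apply: leq_trans sp _.
Qed.

Lemma top_coef_monomial m :
  (size (mmap1 h m) <= (weight m).+1)%N /\
  (mmap1 h m)`_(weight m) = \prod_i (h i)`_(w i) ^+ m i.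
Proof.
rewrite /mmap1 /weight.
apply: (big_rec3 (fun (p : {poly E}) (e : nat) (a : E) =>
          (size p <= e.+1)%N /\ p`_e = a)).
  by rewrite size_poly1 coef1.
move=> i p e a _ [sp pe].
have [sx xe] : (size (h i ^+ m i) <= (m i * w i).+1)%N /\
    (h i ^+ m i)`_(m i * w i) = (h i)`_(w i) ^+ m i.
  elim: (m i) => [|r [IHs IHe]]; first by rewrite !expr0 size_poly1 coef1.
  rewrite !exprS mulSn -IHe; apply: top_coefM => //.
by rewrite -pe -xe; apply: top_coefM.
Qed.

(** The degree of the substituted polynomials is bounded by the weights of the
    variables, so monomials of weight less than [wdeg p] do not contribute. *)
Lemma top_coef_mmap p :
  (mmap (@polyC E \o k) h p)`_(wdeg p) =
  \sum_(m <- msupp p | weight m == wdeg p) k p@_m * \prod_i (h i)`_(w i) ^+ m i.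
Proof.
rewrite /mmap coef_sum [RHS]big_mkcond /=; apply: eq_big_seq => m mp.
rewrite coefCM; case: eqP => [<-|/eqP ne]; first by rewrite (top_coef_monomial m).2.
rewrite nth_default ?mulr0 //; apply: leq_trans (top_coef_monomial m).1 _.
by rewrite ltn_neqAle ne weight_le_wdeg.
Qed.

Lemma constant_leading_form p e : (0 < wdeg p)%N ->
  mmap (@polyC E \o k) h p = e%:P ->
  \sum_(m <- msupp p | weight m == wdeg p) k p@_m * \prod_i (h i)`_(w i) ^+ m i
    = 0.
Proof. by move=> wp E1; rewrite -top_coef_mmap E1 coefC gtn_eqF. Qed.

End LeadingForm.

(** * Partial derivatives of rational functions *)

Section Partials.
Variables (n : nat) (K E : fieldType) (c : {rmorphism {mpoly K[n]} -> E}).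
Hypotheses (charK : char_zero K) (cI : injective c) (cF : fractions_of c).

Definition scal : K -> E := c \o @mpolyC n K.
HB.instance Definition _ := GRing.RMorphism.on scal.

Definition mpoly_der (i : 'I_n) : derivation {mpoly K[n]} :=
  Derivation (mderivD i) (mderivM i).

Definition pd (i : 'I_n) : derivation E := sval (frac_der cI cF (mpoly_der i)).

Lemma charE : char_zero E.
Proof. exact: (@char_zero_inj _ _ scal) (fmorph_inj _) charK. Qed.

Lemma pdE i a : pd i (c a) = c a^`M(i).
Proof. exact: (svalP (frac_der cI cF (mpoly_der i))). Qed.

Lemma pd_scal i k : pd i (scal k) = 0.
Proof. by rewrite pdE mderivC rmorph0. Qed.

Lemma pdX i j : pd i (c 'X_j) = (j == i)%:R.
Proof. by rewrite pdE mderivXU rmorph_nat. Qed.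

Lemma pdC i j e : pd i (pd j e) = pd j (pd i e).
Proof.
apply/eqP; rewrite -subr_eq0; apply/eqP.
apply: (der_eq0_fractions cI cF (d := der_bracket (pd i) (pd j))) => a.
by rewrite der_bracketE !pdE mderiv_comm subrr.
Qed.

Lemma pd_const e : (forall i, pd i e = 0) -> exists k, e = scal k.
Proof.
have [a [b [b0 ->]]] := fractionP cF e => dab.
have cb0 : c b != 0 by rewrite fraction_neq0.
have [i|k1 [k2 [k20 E1]]] := @mpoly_quotient_const n K a b charK b0.
  apply: cI; rewrite !rmorphM; apply/eqP; rewrite -subr_eq0 -!pdE.
  have /eqP := dab i; rewrite der_div // mulf_eq0 invr_eq0 expf_eq0 /=.
  by rewrite (negbTE cb0) orbF.
exists (k1 / k2); apply: (mulIf cb0); rewrite mulfVK //.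
by rewrite /scal /= -rmorphM mul_mpolyC mulrC -scalerA -E1 scalerA mulVf // scale1r.
Qed.

(** The derivation [f_i d_j - f_j d_i] kills [f], hence also [h], which is algebraic
    over K(f) unless [f] is constant. *)
Lemma dependent_minors (f h : {mpoly K[n]}) i j :
  alg_dependent f h -> f^`M(i) * h^`M(j) = f^`M(j) * h^`M(i).
Proof.
case=> Q Q0 Qfh.
have [/existsP[l fl0]|] := boolP [exists l, f^`M(l) != 0]; last first.
  rewrite negb_exists => /forallP df0.
  by rewrite !(eqP (negbNE (df0 _))) !mul0r.
pose D := der_comb (der_scale (c f^`M(i)) (pd j)) (- c f^`M(j)) (pd i).
suff Dh : D (c h) = 0.
  apply: cI; move/eqP: Dh; rewrite der_combE der_scaleE !pdE mulNr subr_eq0.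
  by rewrite -!rmorphM => /eqP.
have [m mQ] : exists m, m \in msupp Q.
  by have [m mQ _] := wdeg_attained (fun=> 0%N) Q0; exists m.
apply: (@relation_const K E scal charE D (c f) (c h) _ (msupp Q) (fun m => Q@_m)
  (fun m => m ord0) (fun m => m ord_max) m) => //.
- by move=> k; rewrite der_combE der_scaleE !pd_scal !mulr0 addr0.
- by rewrite der_combE der_scaleE !pdE; ring.
- move=> q; apply: (nonconst_transcendental charE (d := pd l)).
    exact: pd_scal.
  by rewrite pdE fraction_neq0.
- move=> m1 m2 _ _ [E0 E1]; apply/mnmP => -[[|[|//]] lt_l].
    by rewrite (_ : Ordinal lt_l = ord0) //; apply: val_inj.
  by rewrite (_ : Ordinal lt_l = ord_max) //; apply: val_inj.
- by rewrite -mcoeff_msupp.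
- have := congr1 c Qfh; rewrite rmorph0 comp_mpolyE rmorph_sum => E0; rewrite -[RHS]E0.
  apply: eq_bigr => t _; rewrite -mul_mpolyC rmorphM -mulrA; congr (_ * _).
  rewrite !big_ord_recl big_ord0 mulr1 rmorphM !rmorphXn.
  by congr (_ * _ ^+ t _); apply: val_inj.
Qed.

End Partials.

(** * Three variables *)

Local Notation ix := (inord 0 : 'I_3).
Local Notation iy := (inord 1 : 'I_3).
Local Notation iz := (inord 2 : 'I_3).

Lemma ixE : ix = ord0. Proof. by apply: val_inj; rewrite /= inordK. Qed.

Lemma iyE : iy = lift ord0 ord0. Proof. by apply: val_inj; rewrite /= inordK. Qed.

Lemma izE : iz = lift ord0 (lift ord0 ord0).
Proof. by apply: val_inj; rewrite /= inordK. Qed.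

Definition idx3E := (ixE, iyE, izE).

Lemma ord3P (P : 'I_3 -> Prop) : P ix -> P iy -> P iz -> forall i, P i.
Proof.
rewrite !idx3E => P0 P1 P2 [[|[|[|//]]] lt_i].
- by rewrite (_ : Ordinal lt_i = ord0) //; apply: val_inj.
- by rewrite (_ : Ordinal lt_i = lift ord0 ord0) //; apply: val_inj.
- by rewrite (_ : Ordinal lt_i = lift ord0 (lift ord0 ord0)) //; apply: val_inj.
Qed.

Definition tri T (a b d : T) (i : 'I_3) : T :=
  if i == ix then a else if i == iy then b else d.

Lemma triE T (a b d : T) :
  (tri a b d ix = a) * (tri a b d iy = b) * (tri a b d iz = d).
Proof. by rewrite /tri !idx3E. Qed.

Lemma idx3_eq : ((ix == iy) = false) * ((ix == iz) = false) * ((iy == ix) = false)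
  * ((iy == iz) = false) * ((iz == ix) = false) * ((iz == iy) = false).
Proof. by rewrite !idx3E. Qed.

Lemma big_ord3 (R : Type) (idx : R) (op : Monoid.law idx) (F : 'I_3 -> R) :
  \big[op/idx]_i F i = op (F ix) (op (F iy) (F iz)).
Proof. by rewrite !big_ord_recl big_ord0 Monoid.mulm1 !idx3E. Qed.

Lemma mnm3P (m1 m2 : 'X_{1..3}) :
  m1 ix = m2 ix -> m1 iy = m2 iy -> m1 iz = m2 iz -> m1 = m2.
Proof. by move=> Ex Ey Ez; apply/mnmP; apply: ord3P. Qed.

(** * Integral curves *)

Section Flow.
Variables (n : nat) (K E : fieldType) (c : {rmorphism {mpoly K[n]} -> E}).
Hypotheses (charK : char_zero K) (cI : injective c) (cF : fractions_of c).
Variables (d : derivation E) (x : E) (h : 'I_n -> {poly E}).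
Hypotheses (d_scal : forall k, d (scal c k) = 0) (dx : d x = 1).
Hypotheses (h_const : forall i, const_coefs d (h i)).
Hypothesis (h_at : forall i, (h i).[x] = c 'X_i).

(** Substitution of the curve [h] for the variables. As [h] has constant
    coefficients and passes through the generic point at parameter [x], it is the
    integral curve of [d] through that point. *)
Definition flow : {mpoly K[n]} -> {poly E} := mmap (@polyC E \o scal c) h.
HB.instance Definition _ := GRing.RMorphism.on flow.

Lemma flowC k : flow k%:MP = (scal c k)%:P.
Proof. by rewrite /flow mmapC. Qed.

Lemma flowX i : flow 'X_i = h i.
Proof. by rewrite /flow mmapX mmap1U. Qed.

Lemma flow_at a : (flow a).[x] = c a.
Proof.
move: a; apply: mpoly_ring_ind => [k|i|p q Hp Hq|p q Hp Hq].
- by rewrite flowC hornerC.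
- by rewrite flowX.
- by rewrite !rmorphD hornerD Hp Hq.
- by rewrite !rmorphM hornerM Hp Hq.
Qed.

Lemma flow_const_coefs a : const_coefs d (flow a).
Proof.
move: a; apply: mpoly_ring_ind => [k|i|p q Hp Hq|p q Hp Hq].
- by rewrite flowC; apply: const_coefsC.
- by rewrite flowX.
- by rewrite rmorphD; apply: const_coefsD.
- by rewrite rmorphM; apply: const_coefsM.
Qed.

(** The difference of the two sides has constant coefficients and vanishes at [x],
    which is transcendental over the constants. *)
Lemma flow_first_integral a : d (c a) = 0 -> flow a = (c a)%:P.
Proof.
move=> da; apply/eqP; rewrite -subr_eq0; apply/eqP.
apply: (const_coefs_root (charE c charK) dx).
  apply: const_coefsD; first exact: flow_const_coefs.
  by apply: const_coefsN; apply: const_coefsC.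
by rewrite hornerD hornerN hornerC flow_at subrr.
Qed.

(** Divisors of first integrals are first integrals: a factor of a nonzero
    constant polynomial is constant. *)
Lemma flow_factor a b : a * b != 0 -> d (c (a * b)) = 0 ->
  d (c a) = 0 /\ flow a = (c a)%:P.
Proof.
move=> ab0 dab.
have Eab : flow a * flow b = (c (a * b))%:P.
  by rewrite -flow_first_integral // rmorphM.
have cab0 : c (a * b) != 0 by rewrite fraction_neq0.
have /eqP := congr1 (fun p : {poly E} => size p) Eab.
have [fa0 fb0] : flow a != 0 /\ flow b != 0.
  by apply/andP; rewrite -negb_or -mulf_eq0 Eab polyC_eq0.
rewrite size_mul // size_polyC cab0 => size1.
have size_a : (size (flow a) <= 1)%N.
  move: size1; rewrite -!size_poly_gt0 in fa0 fb0.
  case: (size (flow a)) fa0 => // i _; case: (size (flow b)) fb0 => // j _.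
  by rewrite addSn addnS /= eqSS addn_eq0 => /andP[/eqP ->].
have fa := size1_polyC size_a.
have Efa : flow a = (c a)%:P by have := flow_at a; rewrite fa hornerC => ->.
split=> //; have := flow_const_coefs a 0%N.
by rewrite Efa coefC.
Qed.

End Flow.

(** If all partial derivatives of [rho] vanish then [rho] is a scalar and
    [h - rho f] is constant, contrary to independence. *)
Lemma slope_not_scalar n (K E : fieldType) (c : {rmorphism {mpoly K[n]} -> E})
    (charK : char_zero K) (cI : injective c) (cF : fractions_of c) f h rho :
  (forall i, c h^`M(i) = rho * c f^`M(i)) ->
  (forall a b k : K, a *: f + b *: h = k%:MP -> a = 0 /\ b = 0) ->
  exists i, pd cI cF i rho != 0.
Proof.
move=> hrho indep; apply/existsP; apply: contraT; rewrite negb_exists.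
move/forallP => drho.
have [k Ek] : exists k, rho = scal c k.
  by apply: (pd_const charK (cI := cI) (cF := cF)) => i; apply/eqP/negPn/drho.
have hk : (- k) *: f + 1 *: h = ((- k *: f + 1 *: h)@_0)%:MP.
  apply: (mderivs_eq0 charK) => i; rewrite mderivD !mderivZ scale1r.
  apply: (cI); rewrite rmorphD hrho Ek rmorph0 -mul_mpolyC rmorphM.
  by rewrite mpolyCN rmorphN mulNr addNr.
by have [_ /eqP] := indep _ _ _ hk; rewrite oner_eq0.
Qed.

(** * Nilpotent Jacobians in the plane *)

Section Planar.
Variables (K E : fieldType) (c : {rmorphism {mpoly K[3]} -> E}).
Hypotheses (charK : char_zero K) (cI : injective c) (cF : fractions_of c).
Variables (f h : {mpoly K[3]}).
Hypothesis minors : forall i j, f^`M(i) * h^`M(j) = f^`M(j) * h^`M(i).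
Hypothesis trace0 : f^`M(ix) + h^`M(iz) = 0.
Hypothesis indep : forall a b k : K, a *: f + b *: h = k%:MP -> a = 0 /\ b = 0.

(** If [f_z = 0] then the minors and the trace give [f_x = 0]. Otherwise let
    [rho] be the ratio of the gradients. The derivation [d/dx + rho d/dz] kills
    [f] and [rho], so its integral curves are straight lines, along which [f] is
    constant. The leading form of [f] in X and Z, with Y as a parameter,
    vanishes in their direction [(1, rho)], which makes [rho] algebraic over
    K(y). Hence [rho] does not depend on x and z; nor on y, as its gradient is
    proportional to that of [f]. This contradicts [slope_not_scalar]. *)
Lemma planar_nilpotent : f^`M(ix) = 0 /\ f^`M(iz) = 0.
Proof.
have hz : h^`M(iz) = - f^`M(ix) by apply/eqP; rewrite -addr_eq0 addrC trace0.
have [fz0|fz0] := eqVneq f^`M(iz) 0.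
  split=> //; have /eqP := minors ix iz.
  by rewrite hz fz0 mul0r mulrN oppr_eq0 mulf_eq0 orbb => /eqP.
pose rho := c h^`M(iz) / c f^`M(iz).
have cfz0 : c f^`M(iz) != 0 by rewrite fraction_neq0.
have hrho i : c h^`M(i) = rho * c f^`M(i).
  apply: (mulIf cfz0); rewrite [RHS]mulrAC mulfVK // -!rmorphM.
  by rewrite mulrC minors mulrC.
pose d := der_comb (pd cI cF ix) rho (pd cI cF iz).
have df : d (c f) = 0.
  by rewrite der_combE !pdE -hrho -rmorphD trace0 rmorph0.
have drho i j : pd cI cF i rho * c f^`M(j) = pd cI cF j rho * c f^`M(i).
  have := congr1 (pd cI cF i) (hrho j); rewrite derM pdE mderiv_comm.
  rewrite -pdE hrho derM pdE => /eqP; rewrite [in X in _ == X]pdE mderiv_comm.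
  by move/eqP/addIr => ->.
have d_rho : d rho = 0.
  apply: (mulIf cfz0); rewrite der_combE mulrDl -mulrA [pd _ _ ix _ * _]drho.
  by rewrite mulrCA -mulrDr -!pdE -der_combE df mulr0 mul0r.
pose crv := tri 'X (c 'X_iy)%:P ((c 'X_iz - rho * c 'X_ix)%:P + rho *: 'X).
have d_scal k : d (scal c k) = 0 by rewrite der_combE !pd_scal mulr0 addr0.
have dx : d (c 'X_ix) = 1 by rewrite der_combE !pdX eqxx idx3_eq mulr0 addr0.
have crv_const i : const_coefs d (crv i).
  move: i; apply: ord3P; rewrite /crv triE.
  - exact: const_coefsX.
  - by apply: const_coefsC; rewrite der_combE !pdX !idx3_eq mulr0 addr0.
  - apply: const_coefsD.
      apply: const_coefsC; rewrite derB derM d_rho dx mul0r add0r mulr1.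
      by rewrite der_combE !pdX !idx3_eq eqxx mulr1 add0r subrr.
    by rewrite -mul_polyC; apply: const_coefsM;
      [apply: const_coefsC | apply: const_coefsX].
have crv_at i : (crv i).[c 'X_ix] = c 'X_i.
  by move: i; apply: ord3P; rewrite /crv triE !hornerE // subrK.
have flow_f := flow_first_integral charK d_scal dx crv_const crv_at df.
(* Y is a parameter, of weight 0. *)
pose w := tri 1 0 1%N.
have f0 : f != 0 by apply: contraNneq fz0 => ->; rewrite mderiv0.
have wf : (0 < wdeg w f)%N by apply: wdeg_gt0 fz0; rewrite /w triE.
have size_crv i : (size (crv i) <= (w i).+1)%N.
  move: i; apply: ord3P; rewrite /crv /w !triE.
  - by rewrite size_polyX.
  - exact: size_polyC_leq1.
  - rewrite (leq_trans (size_polyD _ _)) // geq_max.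
    rewrite (leq_trans (size_polyC_leq1 _)) //.
    by rewrite (leq_trans (size_scale_leq _ _)) // size_polyX.
have rel := constant_leading_form size_crv wf flow_f.
have [m0 m0f wm0] := wdeg_attained w f0.
have pd_rho i : i != iy -> pd cI cF i rho = 0.
  move=> i_y.
  pose s := [seq m <- msupp f | weight w m == wdeg w f].
  apply: (@relation_const K E (scal c) (charE c charK) (pd cI cF i) (c 'X_iy) rho
    _ s (fun m => f@_m) (fun m => m iy) (fun m => m iz) m0).
  - exact: pd_scal.
  - by rewrite pdX eq_sym (negbTE i_y).
  - move=> q; apply: (nonconst_transcendental (charE c charK) (d := pd cI cF iy)).
      exact: pd_scal.
    by rewrite pdX eqxx oner_neq0.
  - by rewrite filter_uniq // msupp_uniq.
  - move=> m m'; rewrite !mem_filter /weight /w !big_ord3 !triE /= !muln1 !muln0.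
    move=> /andP[/eqP <- _] /andP[/eqP wm' _] [Ey Ez].
    apply: mnm3P => //; move: wm'; rewrite Ez.
    by move/eqP; rewrite /= !add0n eqn_add2r => /eqP.
  - by rewrite mem_filter wm0 eqxx m0f.
  - by rewrite -mcoeff_msupp.
  - rewrite big_filter -[RHS]rel; apply: eq_bigr => m _.
    rewrite big_ord3 /crv /w !triE coefX coefC coefD coefC coefZ coefX /=.
    by rewrite expr1n mul1r add0r mulr1 mulrA.
have pd_rho_y : pd cI cF iy rho = 0.
  by apply: (mulIf cfz0); rewrite drho pd_rho ?idx3_eq // !mul0r.
have [i] := slope_not_scalar charK cI cF hrho indep.
by move: i; apply: ord3P; rewrite ?pd_rho_y ?eqxx // pd_rho ?idx3_eq ?eqxx.
Qed.

End Planar.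

(** * The field of common constants of two derivations *)

Section ConstantField.
Variables (E : fieldType) (d1 d2 : derivation E).

Definition const_pred : {pred E} := [pred e | (d1 e == 0) && (d2 e == 0)].

Lemma const_predP e : reflect (d1 e = 0 /\ d2 e = 0) (e \in const_pred).
Proof.
by rewrite inE; apply: (iffP andP) => -[/eqP ? /eqP ?].
Qed.

Fact const_pred_divring : divring_closed const_pred.
Proof.
split=> [|a b /const_predP[a1 a2] /const_predP[b1 b2]
         |a b /const_predP[a1 a2] /const_predP[b1 b2]]; apply/const_predP.
- by rewrite !der1.
- by rewrite !derB a1 a2 b1 b2 subrr.
- by rewrite !derM !derV a1 a2 b1 b2 !mul0r oppr0 !mulr0 addr0.
Qed.

HB.instance Definition _ :=
  GRing.isDivringClosed.Build E const_pred const_pred_divring.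

(** A type of its own, with a field structure, so that polynomials over it have
    unique factorisation. *)
Record const_field := ConstField { const_val : E; _ : const_val \in const_pred }.

HB.instance Definition _ := [isSub for const_val].
HB.instance Definition _ := [Choice of const_field by <:].
HB.instance Definition _ := [SubChoice_isSubIntegralDomain of const_field by <:].
HB.instance Definition _ := [SubIntegralDomain_isSubField of const_field by <:].

HB.instance Definition _ :=
  GRing.RMorphism.copy const_val (\val : const_field -> E).

Lemma const_val_inj : injective const_val.
Proof. exact: val_inj. Qed.

Lemma const_valP (a : const_field) : d1 (const_val a) = 0 /\ d2 (const_val a) = 0.
Proof. by case: a => a aP; apply/const_predP. Qed.

Lemma const_fieldP e : d1 e = 0 -> d2 e = 0 -> {a : const_field | const_val a = e}.
Proof.
move=> e1 e2; have eP : e \in const_pred by apply/const_predP.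
by exists (ConstField eP).
Qed.

End ConstantField.

(** * Prime ideals of height one in two variables *)

Lemma exists_minimal T (P : T -> Prop) (f : T -> nat) :
  (exists t, P t) -> exists2 t, P t & forall t', P t' -> (f t <= f t')%N.
Proof.
case=> t; have [m] := ubnP (f t); elim: m t => // m IH t ft Pt.
have [[t' [Pt' ft']]|no_less] := Classical_Prop.classic
    (exists t', P t' /\ (f t' < f t)%N).
  by apply: (IH t') => //; apply: leq_trans ft' _.
exists t => // t' Pt'; rewrite leqNgt; apply/negP => ft'.
by apply: no_less; exists t'.
Qed.

Section Content.
Variable L : fieldType.
Implicit Types (e p : {poly L}) (q : {poly {poly L}}).

Lemma irreducible_factor e : (1 < size e)%N ->
  exists2 p, irreducible_poly p & p %| e.
Proof.
move=> size_e.
have [|p [size_p pe] p_min] := @exists_minimal {poly L}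
    (fun p => (1 < size p)%N /\ p %| e) (fun p => size p).
  by exists e; rewrite dvdpp.
exists p => //; split=> // r size_r rp.
have p0 : p != 0 by rewrite -size_poly_gt0 ltnW.
have r0 : r != 0 by apply: contraNneq p0 => r0; rewrite r0 dvd0p in rp.
rewrite -dvdp_size_eqp // eqn_leq dvdp_leq //= p_min //.
split; last exact: dvdp_trans pe.
by rewrite ltn_neqAle eq_sym size_r size_poly_gt0.
Qed.

Lemma irreducible_prime p a b : irreducible_poly p ->
  p %| a * b -> ~~ (p %| a) -> p %| b.
Proof.
move=> p_irr pab pa; rewrite -(@Gauss_dvdpr _ b a) //.
have [gcd1|gcdp'] := irredp_XsubCP p_irr (dvdp_gcdl p a).
  by rewrite -gcdp_eqp1.
case/negP: pa; rewrite -(eqp_dvdl _ gcdp'); exact: dvdp_gcdr.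
Qed.

Definition dvd_coefs e q := forall i, e %| q`_i.

Lemma dvd_coefsP e q : e != 0 -> dvd_coefs e q -> exists q', q = e *: q'.
Proof.
move=> e0 eq_; exists (map_poly (fun a => a %/ e) q).
apply/polyP => i; rewrite coefZ coef_map_id0 ?div0p //.
by rewrite mulrC divpK.
Qed.

(** Gauss's lemma: in a coefficient of a product, a prime element divides all
    terms but the one made of the first coefficients it does not divide. *)
Lemma dvd_coefs_prime p a b : irreducible_poly p ->
  dvd_coefs p (a * b) -> ~ dvd_coefs p a -> dvd_coefs p b.
Proof.
move=> p_irr pab pa; apply: Classical_Prop.NNPP => pb.
have first_bad q : ~ dvd_coefs p q ->
    exists2 i, ~~ (p %| q`_i) & forall j, (j < i)%N -> p %| q`_j.
  move=> pq; have [|i pi i_min] := @exists_minimal nat (fun i => ~~ (p %| q`_i)) id.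
    apply: Classical_Prop.NNPP => no; apply: pq => i.
    by apply/negPn/negP => pi; apply: no; exists i.
  exists i => // j ji; apply: contraLR ji => /i_min; by rewrite -leqNgt.
have [i pi i_min] := first_bad _ pa; have [j pj j_min] := first_bad _ pb.
case/negP: pj; apply: (irreducible_prime p_irr (a := a`_i)) => //.
have i_lt : (i < (i + j).+1)%N by rewrite ltnS leq_addr.
have := pab (i + j)%N; rewrite coefM (bigD1 (Ordinal i_lt)) //= addKn.
rewrite dvdp_addl //; apply: (big_ind (fun r => p %| r)) => [|u v|l].
- exact: dvdp0.
- exact: dvdp_add.
rewrite -val_eqE /= neq_ltn => /orP[l_lt|l_gt].
  by rewrite dvdp_mulr // i_min.
by rewrite dvdp_mull // j_min // ltn_subLR ?ltn_add2r // -ltnS.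
Qed.

Definition primitive q := forall p, irreducible_poly p -> ~ dvd_coefs p q.

(** The irreducible factors of [e] are cancelled one at a time: by Gauss's lemma
    each divides [a]. *)
Lemma primitive_cancel e a b q : e != 0 -> primitive b ->
  e *: q = a * b -> exists q', q = q' * b.
Proof.
move=> + b_prim; have [m] := ubnP (size e).
elim: m e a => // m IH e a size_e e0 Eq.
have [e1|size_gt1] := leqP (size e) 1.
  have eC := size1_polyC e1; have e00 : e`_0 != 0 by rewrite eC polyC_eq0 in e0.
  exists ((e`_0)^-1%:P *: a); rewrite -scalerAl -Eq eC scalerA -polyCM.
  by rewrite coefC /= mulVf // scale1r.
have [p p_irr /dvdpP[e' Ee]] := irreducible_factor size_gt1.
have p0 := irredp_neq0 p_irr.
have e'0 : e' != 0 by apply: contraNneq e0 => e'0; rewrite Ee e'0 mul0r.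
have [|a' Ea] := @dvd_coefsP p a p0.
  apply: (dvd_coefs_prime p_irr (a := b)); last exact: b_prim.
  by move=> i; rewrite mulrC -Eq coefZ Ee -mulrA mulrCA dvdp_mulr.
apply: (IH e' a') => //.
  rewrite -ltnS; apply: leq_trans size_e; rewrite ltnS Ee size_mul //.
  case: p_irr => + _; case: (size p) => // k k_gt0.
  by rewrite addnS /= -addn1 leq_add2l.
have p0' : p%:P != 0 by rewrite polyC_eq0.
by apply: (mulfI p0'); rewrite !mul_polyC scalerA mulrC -Ee Eq Ea -scalerAl.
Qed.

End Content.

(** The kernel is generated by an element of least degree in the second variable
    whose leading coefficient has least degree, since pseudo-division
    leaves no remainder and the multiplier cancels. *)
Lemma kernel_principal (L E : fieldType) (ev : {rmorphism {poly {poly L}} -> E}) :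
  (forall e, ev e%:P = 0 -> e = 0) ->
  exists2 g, ev g = 0 & forall q, ev q = 0 -> exists q', q = q' * g.
Proof.
move=> ev_inj.
have [[q0 [q00 evq0]]|ev_inj2] := Classical_Prop.classic
    (exists q, q != 0 /\ ev q = 0); last first.
  exists 0; rewrite ?rmorph0 // => q evq; exists 0; rewrite mul0r; apply/eqP.
  by apply/negPn/negP => q0; apply: ev_inj2; exists q.
have [|g1 [g10 evg1] g1_min] := @exists_minimal {poly {poly L}}
    (fun q => q != 0 /\ ev q = 0) (fun q => size q); first by exists q0.
have [|g [[g0 evg] size_g] g_min] := @exists_minimal {poly {poly L}}
    (fun q => (q != 0 /\ ev q = 0) /\ size q = size g1)
    (fun q => size (lead_coef q)); first by exists g1.
have g_prim : primitive g.
  move=> p p_irr /(dvd_coefsP (irredp_neq0 p_irr))[g' Eg].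
  have p0 := irredp_neq0 p_irr.
  have g'0 : g' != 0 by apply: contraNneq g0 => g'0; rewrite Eg g'0 scaler0.
  have evg' : ev g' = 0.
    have /eqP := evg; rewrite Eg -mul_polyC rmorphM mulf_eq0.
    by case/orP=> /eqP // /ev_inj /eqP; rewrite (negbTE p0).
  have := g_min g'; rewrite Eg lead_coefZ size_mul ?lead_coef_eq0 //.
  have -> : size g' = size g1 by rewrite -size_g Eg size_scale.
  move=> /(_ (conj (conj g'0 evg') erefl)); apply/negP; rewrite -ltnNge.
  case: p_irr => + _; case: (size p) => // k k_gt0.
  by rewrite addSn /= -add1n leq_add2r.
exists g => // q evq; pose r := Pdiv.IdomainDefs.modp q g.
have Eqr := Pdiv.WeakIdomain.divp_eq q g.
have evr : ev r = 0.
  move/(congr1 ev): Eqr; rewrite -mul_polyC rmorphM evq mulr0 rmorphD rmorphM evg.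
  by rewrite mulr0 add0r.
have r0 : r = 0.
  apply/eqP/negPn/negP => r0; have := g1_min r (conj r0 evr).
  by rewrite -size_g leqNgt /r Pdiv.CommonIdomain.ltn_modpN0.
rewrite -/r r0 addr0 in Eqr; apply: (primitive_cancel _ g_prim Eqr).
by rewrite expf_neq0 // lead_coef_eq0.
Qed.

(** * The kernel direction of the Jacobian *)

(** The derivations [d1], [d3], [d0] are the partial derivatives with respect to
    coordinates x, z and a third one, of which [rho] is a function; [D] is the
    vector field [d1 + rho d3]. *)
Section KernelDirection.
Variables (E : fieldType) (d1 d3 d0 : derivation E) (x y z g rho : E).
Hypothesis charE : char_zero E.
Hypotheses (d13 : forall e, d1 (d3 e) = d3 (d1 e)).
Hypotheses (d10 : forall e, d1 (d0 e) = d0 (d1 e)).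
Hypotheses (d30 : forall e, d3 (d0 e) = d0 (d3 e)).
Hypotheses (d1x : d1 x = 1) (d1z : d1 z = 0) (d3x : d3 x = 0) (d3z : d3 z = 1).
Hypotheses (d0x : d0 x = 0) (d0z : d0 z = 0).
Hypotheses (d1rho : d1 rho = 0) (d3rho : d3 rho = 0).
Let D := der_comb d1 rho d3.
Hypotheses (d0g : d0 g = D y) (Dg : D g = 0).
Let sigma := d3 g.
Let kappa := d0 rho.
Let phi := - (kappa * sigma) / 2%:R.

Lemma D_sigma : D sigma = 0.
Proof.
rewrite der_combE d13 /sigma.
have : d3 (D g) = 0 by rewrite Dg der0.
by rewrite der_combE derD derM d3rho mul0r add0r.
Qed.

Lemma d_kappa : d1 kappa = 0 /\ d3 kappa = 0.
Proof. by rewrite /kappa d10 d30 d1rho d3rho der0. Qed.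

Lemma D_rho : D rho = 0.
Proof. by rewrite der_combE d1rho d3rho mulr0 addr0. Qed.

(** Apply [d0] to [D g = 0]: since [d0] commutes with [d1] and [d3], this computes
    [D (d0 g) = D (D y)]. *)
Lemma DDy : D (D y) = 2%:R * phi.
Proof.
have two0 : 2%:R != 0 :> E by apply: charE.
rewrite /phi mulrC mulfVK //.
have E1 : d0 (d1 g) + (kappa * sigma + rho * d0 sigma) = 0.
  by rewrite -derM -derD -[_ + _]/(D g) Dg der0.
rewrite -d0g der_combE d10 d30 -/sigma -[LHS]subr0 -E1; ring.
Qed.

Lemma D_phi : D phi = 0.
Proof.
have [k1 k3] := d_kappa.
rewrite /phi derM derV der_nat mul0r oppr0 mulr0 addr0 derN derM D_sigma.
by rewrite der_combE k1 k3 !(mulr0, mul0r, addr0, oppr0).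
Qed.

Let s := D y - 2%:R * phi * x.
Let eta := y - D y * x + phi * x ^+ 2.
Let tau := z - rho * x.

Lemma D_xyz : D x = 1 /\ D z = rho.
Proof. by rewrite !der_combE d1x d1z d3x d3z mulr0 mulr1 addr0 add0r. Qed.

(** The integral curve of [D] is [(X, eta + s X + phi X^2, tau + rho X)]. *)
Lemma D_curve : [/\ D s = 0, D eta = 0 & D tau = 0].
Proof.
have [Dx Dz] := D_xyz; rewrite /s /eta /tau.
move: D_phi DDy; move: phi => p Dp DDy; split.
- by rewrite derB DDy !derM Dp Dx der_nat; ring.
- by rewrite derD derB !derM DDy Dp Dx; ring.
- by rewrite derB derM D_rho Dx Dz; ring.
Qed.

(** When [phi] is a common constant of [d1] and [d3], so are [sigma] and
    [g - sigma * tau]; hence [D y = d0 g] is affine in [x] and [z]. *)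
Lemma Dy_affine : kappa != 0 -> d1 phi = 0 -> d3 phi = 0 ->
  exists e0 e1 e2 : E, [/\ d1 e0 = 0 /\ d3 e0 = 0, d1 e1 = 0 /\ d3 e1 = 0,
    d1 e2 = 0 /\ d3 e2 = 0 & D y = e0 + e1 * x + e2 * z].
Proof.
move=> kappa0 d1phi d3phi; have [k1 k3] := d_kappa.
have two0 : 2%:R != 0 :> E by apply: charE.
have sigmaE : sigma = - (2%:R * phi) / kappa.
  by rewrite /phi; field; rewrite kappa0 two0.
have s1 : d1 sigma = 0.
  rewrite sigmaE derM derV derN derM der_nat k1 d1phi.
  by rewrite !(mulr0, mul0r, addr0, oppr0).
have s3 : d3 sigma = 0.
  rewrite sigmaE derM derV derN derM der_nat k3 d3phi.
  by rewrite !(mulr0, mul0r, addr0, oppr0).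
pose b := g - sigma * tau.
have d1g : d1 g = - (rho * sigma).
  by apply/eqP; rewrite -addr_eq0 -[_ + _]/(D g) Dg.
have b1 : d1 b = 0.
  rewrite /b derB derM s1 /tau derB derM d1rho d1x d1z d1g; ring.
have b3 : d3 b = 0.
  rewrite /b derB derM s3 /tau derB derM d3rho d3x d3z -/sigma; ring.
exists (d0 b), (- (d0 sigma * rho) - sigma * kappa), (d0 sigma).
split.
- by rewrite d10 d30 b1 b3 der0.
- by rewrite !derB !derN !derM d10 d30 s1 s3 k1 k3 d1rho d3rho !der0; split; ring.
- by rewrite d10 d30 s1 s3 der0.
- have -> : D y = d0 b + d0 (sigma * tau) by rewrite -d0g -derD /b subrK.
  by rewrite derM /tau [d0 (z - _)]derB [d0 (rho * x)]derM d0x d0z -/kappa; ring.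
Qed.

End KernelDirection.

Section LevelDerivations.
Variables (K E : fieldType) (c : {rmorphism {mpoly K[3]} -> E}).
Hypotheses (charK : char_zero K) (cI : injective c) (cF : fractions_of c).
Variable f : {mpoly K[3]}.
Hypothesis fy0 : f^`M(iy) != 0.
Local Notation pd := (pd cI cF).

(** In the coordinates x, f, z of the field of rational functions, the partial
    derivatives are [along ix], [across] and [along iz]. *)
Definition along (i : 'I_3) : derivation E :=
  der_comb (pd i) (- (c f^`M(i) / c f^`M(iy))) (pd iy).

Definition across : derivation E := der_scale (c f^`M(iy))^-1 (pd iy).

Let cfy0 : c f^`M(iy) != 0. Proof. by rewrite fraction_neq0. Qed.

Lemma along_f i : along i (c f) = 0.
Proof. by rewrite der_combE !pdE mulNr mulfVK // subrr. Qed.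

Lemma along_comm i j e : along i (along j e) = along j (along i e).
Proof.
rewrite !der_combE !derD !derM !derN !der_div // !pdE.
rewrite [pd j (pd i e)]pdC [pd j (pd iy e)]pdC [pd i (pd iy e)]pdC.
rewrite (mderiv_comm j i) (mderiv_comm i iy) (mderiv_comm j iy).
by field.
Qed.

Lemma along_across i e : along i (across e) = across (along i e).
Proof.
rewrite !der_scaleE !der_combE !derD !derM derV !derN !der_div // derV !pdE.
rewrite [pd i (pd iy e)]pdC (mderiv_comm i iy).
by field.
Qed.

Lemma along_X i j : along i (c 'X_j) =
  (j == i)%:R - c f^`M(i) / c f^`M(iy) * (j == iy)%:R.
Proof. by rewrite der_combE !pdX mulNr. Qed.

Lemma along_scal i k : along i (scal c k) = 0.
Proof. by rewrite der_combE !pd_scal mulr0 addr0. Qed.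

Lemma along_slope i h rho : (forall i, c h^`M(i) = rho * c f^`M(i)) ->
  along i rho = 0.
Proof.
move=> hrho.
suff drho : pd i rho * c f^`M(iy) = pd iy rho * c f^`M(i).
  by apply: (mulIf cfy0); rewrite der_combE mul0r mulrDl drho; field.
have := congr1 (pd i) (hrho iy); rewrite derM pdE mderiv_comm.
rewrite -pdE hrho derM pdE => /eqP; rewrite [in X in _ == X]pdE mderiv_comm.
by move/eqP/addIr => ->.
Qed.

End LevelDerivations.

Section KernelField.
Variables (K E : fieldType) (c : {rmorphism {mpoly K[3]} -> E}).
Hypotheses (charK : char_zero K) (cI : injective c) (cF : fractions_of c).
Variables f g h : {mpoly K[3]}.
Hypothesis fy0 : f^`M(iy) != 0.
Hypothesis minors : forall i j, f^`M(i) * h^`M(j) = f^`M(j) * h^`M(i).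
Hypothesis trace1 : f^`M(ix) + g^`M(iy) + h^`M(iz) = 0.
Hypothesis trace2 :
  g^`M(iy) * (f^`M(ix) + h^`M(iz)) = f^`M(iy) * g^`M(ix) + h^`M(iy) * g^`M(iz).
Hypothesis indep : forall a b k : K, a *: f + b *: h = k%:MP -> a = 0 /\ b = 0.

Local Notation d1 := (along cI cF f ix).
Local Notation d3 := (along cI cF f iz).
Local Notation d0 := (across cI cF f).
Local Notation x := (c 'X_ix).
Local Notation y := (c 'X_iy).
Local Notation z := (c 'X_iz).

Definition slope := c h^`M(iy) / c f^`M(iy).

(** The vector field in the kernel of the Jacobian matrix of [(f, g, h)] whose first
    component is 1. *)
Definition kernel_der : derivation E := der_comb d1 slope d3.

Let cfy0 : c f^`M(iy) != 0. Proof. by rewrite fraction_neq0. Qed.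

Lemma slopeE i : c h^`M(i) = slope * c f^`M(i).
Proof.
apply: (mulIf cfy0); rewrite [RHS]mulrAC /slope mulfVK // -!rmorphM.
by rewrite mulrC minors mulrC.
Qed.

Lemma slope_const : d1 slope = 0 /\ d3 slope = 0.
Proof. by split; apply: along_slope fy0 _ _ _ slopeE. Qed.

(** If [slope] were also constant across the levels of [f], it would be a
    scalar. *)
Lemma across_slope : d0 slope != 0.
Proof.
apply/eqP; rewrite der_scaleE => /eqP; rewrite mulf_eq0 invr_eq0 (negbTE cfy0).
move=> /eqP sy; have [i] := slope_not_scalar charK cI cF slopeE indep.
have [s1 s3] := slope_const; move: s1 s3; rewrite !der_combE sy !mulr0 !addr0.
by move=> sx sz; move: i; apply: ord3P; rewrite ?sx ?sy ?sz eqxx.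
Qed.

Lemma kernel_der_y : d0 (c g) = kernel_der y.
Proof.
rewrite !der_combE !der_scaleE !pdX !pdE eqxx !idx3_eq.
have -> : g^`M(iy) = - (f^`M(ix) + h^`M(iz)).
  by apply/eqP; rewrite -addr_eq0 addrCA addrA trace1.
by rewrite rmorphN rmorphD slopeE mulr1n mulr0n; field.
Qed.

Lemma kernel_der_g : kernel_der (c g) = 0.
Proof.
apply: (mulIf cfy0); rewrite mul0r !der_combE !pdE.
transitivity (c (f^`M(iy) * g^`M(ix) + h^`M(iy) * g^`M(iz)
   - g^`M(iy) * (f^`M(ix) + h^`M(iz)))); last by rewrite trace2 subrr rmorph0.
by rewrite rmorphB rmorphD !rmorphM rmorphD !slopeE; field.
Qed.

Lemma kernel_der_f : kernel_der (c f) = 0.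
Proof. by rewrite der_combE !along_f // mulr0 addr0. Qed.

Lemma kernel_der_scal k : kernel_der (scal c k) = 0.
Proof. by rewrite der_combE !along_scal mulr0 addr0. Qed.

Lemma kernel_der_x : kernel_der x = 1.
Proof. by rewrite der_combE !along_X eqxx !idx3_eq !mulr1n !mulr0n; ring. Qed.

Lemma across_scal k : d0 (scal c k) = 0.
Proof. by rewrite der_scaleE pd_scal mulr0. Qed.

Let d13 e := along_comm cI cF fy0 ix iz e.
Let d10 e := along_across cI cF fy0 ix e.
Let d30 e := along_across cI cF fy0 iz e.

Let axes : [/\ d1 x = 1, d1 z = 0, d3 x = 0 & d3 z = 1] /\ (d0 x = 0 /\ d0 z = 0).
Proof.
rewrite !along_X !der_scaleE !pdX !eqxx !idx3_eq !mulr1n !mulr0n.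
by split; split; ring.
Qed.

Definition curvature := - (d0 slope * d3 (c g)) / 2%:R.

(** Along the integral curve of [kernel_der], a parabola, the leading form of [f]
    for the weights 1, 2, 1 vanishes; it is a relation between [slope] and
    [curvature] with coefficients in [K]. *)
Lemma curvature_const : d1 curvature = 0 /\ d3 curvature = 0.
Proof.
have [[d1x d1z d3x d3z] [d0x d0z]] := axes; have [s1 s3] := slope_const.
have charE := charE c charK.
have Dx := kernel_der_x; have Dphi : kernel_der curvature = 0.
  exact: (D_phi d13 d10 d30 s1 s3 kernel_der_g).
pose s := kernel_der y - 2%:R * curvature * x.
pose eta := y - kernel_der y * x + curvature * x ^+ 2.
pose tau := z - slope * x.
have [Ds Deta Dtau] :
    [/\ kernel_der s = 0, kernel_der eta = 0 & kernel_der tau = 0].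
  exact: (D_curve charE d13 d10 d30 d1x d1z d3x d3z s1 s3 kernel_der_y
    kernel_der_g).
have Drho : kernel_der slope = 0 by rewrite der_combE s1 s3 mulr0 addr0.
pose crv := tri 'X (eta%:P + s *: 'X + curvature *: 'X^2) (tau%:P + slope *: 'X).
have crv_const i : const_coefs kernel_der (crv i).
  move: i; apply: ord3P; rewrite /crv triE.
  - exact: const_coefsX.
  - rewrite -!mul_polyC; do ?[apply: const_coefsD]; do ?[apply: const_coefsM];
      by [apply: const_coefsC | apply: const_coefsX].
  - by rewrite -mul_polyC; apply: const_coefsD;
      [|apply: const_coefsM]; do ?[apply: const_coefsC]; do ?[apply: const_coefsX].
have crv_at i : (crv i).[x] = c 'X_i.
  move: i; apply: ord3P; rewrite /crv triE
    !(hornerD, hornerC, hornerZ, hornerXn, hornerX) //.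
    by rewrite /eta /s; ring.
  by rewrite /tau; ring.
have flow_f := flow_first_integral charK kernel_der_scal Dx crv_const crv_at
  kernel_der_f.
pose w := tri 1 2 1%N.
have f0 : f != 0 by apply: contraNneq fy0 => ->; rewrite mderiv0.
have wf : (0 < wdeg w f)%N by apply: wdeg_gt0 fy0; rewrite /w triE.
have size_crv i : (size (crv i) <= (w i).+1)%N.
  move: i; apply: ord3P; rewrite /crv /w !triE.
  - by rewrite size_polyX.
  - rewrite (leq_trans (size_polyD _ _)) // geq_max; apply/andP; split.
      rewrite (leq_trans (size_polyD _ _)) // geq_max.
      rewrite (leq_trans (size_polyC_leq1 _)) //.
      by rewrite (leq_trans (size_scale_leq _ _)) // size_polyX.
    by rewrite (leq_trans (size_scale_leq _ _)) // size_polyXn.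
  - rewrite (leq_trans (size_polyD _ _)) // geq_max.
    rewrite (leq_trans (size_polyC_leq1 _)) //.
    by rewrite (leq_trans (size_scale_leq _ _)) // size_polyX.
have rel := constant_leading_form size_crv wf flow_f.
have [m0 m0f wm0] := wdeg_attained w f0.
suff main (d : derivation E) :
    (forall k, d (scal c k) = 0) -> d slope = 0 -> d curvature = 0.
  by split; apply: main => //; apply: along_scal.
move=> d_scal d_slope; pose ms := [seq m <- msupp f | weight w m == wdeg w f].
apply: (@relation_const K E (scal c) charE d slope curvature
  _ ms (fun m => f@_m) (fun m => m iz) (fun m => m iy) m0) => //.
- move=> q; apply: (nonconst_transcendental charE across_scal across_slope).
- by rewrite filter_uniq // msupp_uniq.
- move=> m m'; rewrite !mem_filter /weight /w !big_ord3 !triE /= !muln1.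
  move=> /andP[/eqP <- _] /andP[/eqP wm' _] [Ez Ey].
  apply: mnm3P => //; move: wm'; rewrite /= Ez Ey.
  by move/eqP; rewrite eqn_add2r => /eqP.
- by rewrite mem_filter wm0 eqxx m0f.
- by rewrite -mcoeff_msupp.
- rewrite big_filter -[RHS]rel; apply: eq_bigr => m _.
  rewrite big_ord3 /crv /w !triE !coefD !coefC !coefZ !coefX coefXn /=.
  by rewrite expr1n !mulr0 !mulr1 !add0r mul1r -mulrA; congr (_ * _); rewrite mulrC.
Qed.

Lemma kernel_affine : exists e0 e1 e2 : E,
  [/\ d1 e0 = 0 /\ d3 e0 = 0, d1 e1 = 0 /\ d3 e1 = 0,
    d1 e2 = 0 /\ d3 e2 = 0 & kernel_der y = e0 + e1 * x + e2 * z].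
Proof.
have [[d1x d1z d3x d3z] [d0x d0z]] := axes; have [s1 s3] := slope_const.
have [c1 c3] := curvature_const.
exact: (Dy_affine (charE c charK) d10 d30 d1x d1z d3x d3z d0x d0z s1 s3
  kernel_der_y kernel_der_g across_slope c1 c3).
Qed.

End KernelField.

(** * Weighted degree *)

Section WeightedDegree.
Variables (n : nat) (R : idomainType) (w : 'I_n -> nat).
Implicit Types (p q : {mpoly R[n]}) (m : 'X_{1..n}).

(** Unlike the inequality [wdeg w p < d], this holds for [p = 0] also when
    [d = 0]. *)
Definition wlt p d := forall m, p@_m != 0 -> (weight w m < d)%N.

Lemma wltD p q d : wlt p d -> wlt q d -> wlt (p + q) d.
Proof.
move=> pd qd m; rewrite mcoeffD; have [pm|pm _] := eqVneq p@_m 0.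
  by rewrite pm add0r => /qd.
exact: pd.
Qed.

Lemma wltZ a p d : wlt p d -> wlt (a *: p) d.
Proof. by move=> pd m; rewrite mcoeffZ mulf_eq0 => /norP[_ /pd]. Qed.

Lemma wltX i p d : wlt p d -> wlt (p * 'X_i) (w i + d).
Proof.
move=> pd m pXm; have mX : m \in msupp (p * 'X_i) by rewrite mcoeff_msupp.
move: mX; rewrite (perm_mem (msuppMX _ _)) => /mapP[k kp ->].
by rewrite weightD weight1 ltn_add2l pd // -mcoeff_msupp.
Qed.

Lemma wltW p d e : (d <= e)%N -> wlt p d -> wlt p e.
Proof. by move=> de pd m /pd /leq_trans; apply. Qed.

Lemma wdeg_lt p d : p != 0 -> wlt p d -> (wdeg w p < d)%N.
Proof.
move=> p0 pd; have [m mp <-] := wdeg_attained w p0.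
by apply: pd; rewrite -mcoeff_msupp.
Qed.

(** The size of [graded p] in the grading variable measures the weighted
    degree of [p], which is thus additive on products. *)
Definition graded : {mpoly R[n]} -> {poly {mpoly R[n]}} :=
  mmap (@polyC _ \o @mpolyC n R) (fun i => ('X_i)%:P * 'X^(w i)).
HB.instance Definition _ := GRing.RMorphism.on graded.

Lemma graded_coef p e m : (graded p)`_e@_m = p@_m *+ (weight w m == e).
Proof.
have mono k : mmap1 (fun i => ('X_i)%:P * 'X^(w i)) k =
    ('X_[k] : {mpoly R[n]})%:P * 'X^(weight w k).
  rewrite /mmap1 /weight mpolyXE_id rmorph_prod /=.
  have -> : 'X^(\sum_(i < n) k i * w i) =
      \prod_(i < n) 'X^(w i) ^+ k i :> {poly {mpoly R[n]}}.
    by rewrite expr_sum; apply: eq_bigr => i _; rewrite -exprM mulnC.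
  rewrite -big_split; apply: eq_bigr => i _ /=.
  by rewrite exprMn polyC_exp.
rewrite /graded /mmap coef_sum raddf_sum /=.
have term k : (((p@_k)%:MP_[n])%:P *
    mmap1 (fun i => ('X_i)%:P * 'X^(w i)) k)`_e@_m =
    p@_k *+ ((k == m) && (weight w k == e)).
  rewrite mono mulrA -polyCM coefMXn.
  rewrite ltnNge; case: leqP => [le|gt] /=; last first.
    by rewrite mcoeff0 (gtn_eqF gt) andbF mulr0n.
  rewrite coefC subn_eq0.
  case: leqP => [ge|lt]; last first.
    by rewrite mcoeff0 (ltn_eqF lt) andbF mulr0n.
  rewrite mcoeffCM mcoeffX.
  by rewrite eqn_leq le ge andbT; case: eqP; rewrite ?mulr1 ?mulr0.
rewrite (eq_bigr _ (fun k _ => term k)).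
have [mp|mp] := boolP (m \in msupp p); last first.
  rewrite memN_msupp_eq0 // mul0rn big1_seq // => k /= kp.
  by case: eqP => // km; rewrite km (negbTE mp) in kp.
rewrite (bigD1_seq m) //= eqxx big1 ?addr0 // => k km.
by rewrite (negbTE km).
Qed.

Lemma size_graded p : p != 0 -> size (graded p) = (wdeg w p).+1.
Proof.
move=> p0; apply/eqP; rewrite eqn_leq; apply/andP; split.
  apply/leq_sizeP => e we; apply/mpolyP => m; rewrite graded_coef mcoeff0.
  have [mp|/memN_msupp_eq0 ->] := boolP (m \in msupp p); last by rewrite mul0rn.
  by rewrite ltn_eqF // (leq_ltn_trans _ we) // weight_le_wdeg.
have [m mp wm] := wdeg_attained w p0.
rewrite ltnNge; apply/negP => /leq_sizeP /(_ (wdeg w p) (leqnn _)).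
move/(congr1 (mcoeff m)); rewrite graded_coef wm eqxx mcoeff0 => /eqP.
by rewrite mcoeff_eq0 mp.
Qed.

Lemma wdegM p q : p != 0 -> q != 0 -> wdeg w (p * q) = (wdeg w p + wdeg w q)%N.
Proof.
move=> p0 q0; have sp := size_graded p0; have sq := size_graded q0.
have [gp0 gq0] : graded p != 0 /\ graded q != 0.
  by split; rewrite -size_poly_gt0 size_graded.
have gM : graded (p * q) = (graded p * graded q)%R by exact: rmorphM.
have E1 := @size_mul {mpoly R[n]} _ _ gp0 gq0.
have E2 := etrans (congr1 (fun r : {poly {mpoly R[n]}} => size r) gM) E1.
have E3 := etrans (esym (size_graded (mulf_neq0 p0 q0))) E2.
have := etrans E3 (congr1 predn (congr2 addn sp sq)).
by rewrite addSn addnS => -[].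
Qed.

End WeightedDegree.

(** * Specialising divisors *)

Section Specialisation.
Variables (n : nat) (K E : fieldType) (c : {rmorphism {mpoly K[n]} -> E}).
Hypotheses (charK : char_zero K) (cI : injective c) (cF : fractions_of c).

Definition constx : {mpoly K[n]} -> {mpoly E[n]} := map_mpoly (scal c).
HB.instance Definition _ := GRing.RMorphism.on constx.

Lemma constxE p m : (constx p)@_m = scal c p@_m.
Proof. by rewrite mcoeff_map_mpoly. Qed.

Lemma constxD p q : constx (p + q) = constx p + constx q.
Proof. exact: rmorphD. Qed.

Lemma constxM p q : constx (p * q) = constx p * constx q.
Proof. exact: rmorphM. Qed.

Lemma constxC k : constx k%:MP = (scal c k)%:MP.
Proof. exact: map_mpolyC. Qed.

Lemma constxX m : constx 'X_[m] = 'X_[m].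
Proof. exact: map_mpolyX. Qed.

Lemma clear_denominators (G : {mpoly E[n]}) : exists (a : {mpoly K[n]})
  (G' : {mpoly {mpoly K[n]}[n]}), a != 0 /\ c a *: G = map_mpoly c G'.
Proof.
elim/mpolyind: G => [|e m G _ _ [a [G' [a0 IH]]]].
  by exists 1, 0; rewrite oner_neq0 scaler0 rmorph0.
have [r [s [s0 ->]]] := fractionP cF e.
have cs0 : c s != 0 by rewrite fraction_neq0.
exists (a * s), ((a * r) *: 'X_[m] + s *: G'); rewrite mulf_neq0 //.
split=> //; rewrite rmorphD /= !map_mpolyZ map_mpolyX -IH scalerDr !scalerA.
by rewrite !rmorphM; congr (_ *: _ + _ *: _); [field | rewrite mulrC].
Qed.

(** A factorisation of [f(X) - f] over the field of rational functions in a
    second set of variables specialises to a factorisation of [f - f(v)] for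
    almost all points [v]. Its divisor has no other monomials than [G], hence no
    larger weighted degree. *)
Lemma specialise_divisor f (G H : {mpoly E[n]}) m :
  constx f - (c f)%:MP = H * G -> G@_m != 0 ->
  exists (v q : {mpoly K[n]}) (k : K), [/\ f - k%:MP = q * v, v@_m != 0 &
    forall m', v@_m' != 0 -> G@_m' != 0].
Proof.
move=> fact Gm; have [a [G' [a0 EG]]] := clear_denominators G.
have [b [H' [b0 EH]]] := clear_denominators H.
have E1 : (b * a) *: (map_mpoly (@mpolyC n K) f - f%:MP) = H' * G'.
  have cinj : injective (map_mpoly c : {mpoly {mpoly K[n]}[n]} -> {mpoly E[n]}).
    move=> p q pq; apply/mpolyP => k; apply: cI.
    by rewrite -!mcoeff_map_mpoly pq.
  apply: cinj; rewrite rmorphM /= -EG -EH map_mpolyZ -scalerAl -scalerAr scalerA.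
  rewrite -fact -(rmorphM c) raddfB /= map_mpolyC; congr (_ *: (_ - _)).
  by apply/mpolyP => k; rewrite !mcoeff_map_mpoly.
have G'm k : c G'@_k = c a * G@_k.
  by have := congr1 (mcoeff k) EG; rewrite mcoeffZ mcoeff_map_mpoly.
have [u Hu] : exists u, (b * a * G'@_m).@[u] != 0.
  apply: mpoly_nonroot => //; rewrite !mulf_neq0 //.
  by rewrite -(fraction_neq0 cI) G'm mulf_neq0 // fraction_neq0.
move: Hu; rewrite !mevalM !mulf_eq0 !negb_or => /andP[/andP[bu au] Gu].
pose sp := map_mpoly (meval u) : {mpoly {mpoly K[n]}[n]} -> {mpoly K[n]}.
exists (sp G'), ((b.@[u] * a.@[u])^-1 *: sp H'), f.@[u]; split.
- rewrite -scalerAl; have := congr1 sp E1; rewrite /sp rmorphM => <-.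
  rewrite /= map_mpolyZ rmorphM scalerA mulVf ?mulf_neq0 // scale1r rmorphB /=.
  rewrite map_mpolyC; congr (_ - _).
  by apply/mpolyP => k; rewrite !mcoeff_map_mpoly /= mevalC.
- by rewrite mcoeff_map_mpoly.
- move=> k; rewrite mcoeff_map_mpoly; apply: contra => /eqP Gk.
  have /eqP := G'm k; rewrite Gk mulr0 -(rmorph0 c) (inj_eq cI) => /eqP ->.
  by apply/eqP; exact: raddf0.
Qed.

End Specialisation.

(** * Divisors of level surfaces are invariant *)

Lemma coefs_factor (R : idomainType) (p : {poly R}) g :
  (forall i, exists q, p`_i = q * g) -> exists q, p = q * g%:P.
Proof.
elim/poly_ind: p => [_|p a IH pg]; first by exists 0; rewrite mul0r.
have [|q ->] := IH.
  by move=> i; have [q] := pg i.+1; rewrite coefD coefMX coefC addr0; exists q.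
have [b] := pg 0%N; rewrite coefD coefMX coefC add0r => ->.
by exists (q * 'X + b%:P); rewrite mulrDl polyCM mulrAC.
Qed.

(** The next identities are stated over arbitrary rings, so that they are checked
    on variables rather than on large expressions. *)
Fact affine_add (S : comNzRingType) (r l a1 a2 a3 b1 b2 b3 : S) :
  (a1 + b1) + r * (a2 + b2) + l * (a3 + b3) =
  (a1 + r * a2 + l * a3) + (b1 + r * b2 + l * b3).
Proof. by ring. Qed.

Fact affine_leibniz (S : comNzRingType) (r l a a1 a2 a3 b b1 b2 b3 : S) :
  (a1 * b + a * b1) + r * (a2 * b + a * b2) + l * (a3 * b + a * b3) =
  (a1 + r * a2 + l * a3) * b + a * (b1 + r * b2 + l * b3).
Proof. by ring. Qed.

Fact deriv_quadratic (S : comNzRingType) (a b d : S) :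
  (a%:P + b%:P * 'X + d%:P * 'X^2)^`() = b%:P + d%:P * ('X + 'X).
Proof.
by rewrite expr2 !derivD !derivM !derivC derivX; ring.
Qed.

Fact deriv_linear (S : comNzRingType) (a b : S) :
  (a%:P + b%:P * 'X)^`() = b%:P.
Proof. by rewrite !derivD !derivM !derivC derivX; ring. Qed.

Fact map_linear_at (S T : comNzRingType) (u : {rmorphism S -> T}) (a b : S) t :
  (map_poly u (a%:P + b%:P * 'X)).[t] = u a + u b * t.
Proof.
by rewrite rmorphD rmorphM /= !map_polyC map_polyX !hornerE.
Qed.

Fact map_quadratic_at (S T : comNzRingType) (u : {rmorphism S -> T}) (a b d : S) t :
  (map_poly u (a%:P + b%:P * 'X + d%:P * 'X^2)).[t] = u a + u b * t + u d * t ^+ 2.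
Proof.
rewrite rmorphD rmorphM /= map_polyXn map_polyC hornerD map_linear_at.
by rewrite hornerM hornerC hornerXn.
Qed.

Fact half_identity (S : comNzRingType) (u a0 a1 a2 r X Z : S) :
  u * 2%:R = 1 -> 0 + r * 0 + (a0 + a1 * X + a2 * Z) * 1 =
  a0 + a2 * (Z - r * X) + u * (a1 + a2 * r) * (X + X).
Proof.
move=> u2.
have -> : a0 + a2 * (Z - r * X) + u * (a1 + a2 * r) * (X + X) =
  a0 + a2 * (Z - r * X) + u * 2%:R * ((a1 + a2 * r) * X) by ring.
by rewrite u2; ring.
Qed.

Section Invariance.
Local Opaque constx mpolyC mpolyX mderiv.
Variables (K E : fieldType) (c : {rmorphism {mpoly K[3]} -> E}).
Hypotheses (charK : char_zero K) (cI : injective c) (cF : fractions_of c).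
Variables (d1 d3 : derivation E).
Local Notation x := (c 'X_ix).
Local Notation y := (c 'X_iy).
Local Notation z := (c 'X_iz).
Local Notation L := (const_field d1 d3).
Local Notation val := (@const_val E d1 d3).
Hypotheses (d1_scal : forall k, d1 (scal c k) = 0).
Hypotheses (d3_scal : forall k, d3 (scal c k) = 0).
Hypotheses (d1x : d1 x = 1) (d1z : d1 z = 0) (d3x : d3 x = 0) (d3z : d3 z = 1).
Variables (rho e0 e1 e2 : L).
Local Notation D := (der_comb d1 (val rho) d3).
Hypothesis Dy : D y = val e0 + val e1 * x + val e2 * z.

Let d_val (a : L) : d1 (val a) = 0 /\ d3 (val a) = 0.
Proof. exact: const_valP. Qed.

Let D_val (a : L) : D (val a) = 0.
Proof. by have [a1 a3] := d_val a; rewrite der_combE a1 a3 mulr0 addr0. Qed.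

Let D_scal k : D (scal c k) = 0.
Proof. by rewrite der_combE d1_scal d3_scal mulr0 addr0. Qed.

Let Dx : D x = 1. Proof. by rewrite der_combE d1x d3x mulr0 addr0. Qed.

Let Dz : D z = val rho. Proof. by rewrite der_combE d1z d3z mulr1 add0r. Qed.

Definition const_scal (k : K) : L :=
  sval (const_fieldP (d1_scal k) (d3_scal k)).

Lemma const_scalE k : val (const_scal k) = scal c k.
Proof. exact: (svalP (const_fieldP (d1_scal k) (d3_scal k))). Qed.

Fact const_scal_zmod : zmod_morphism const_scal.
Proof.
by move=> a b; apply: const_val_inj; rewrite rmorphB /= !const_scalE rmorphB.
Qed.

Fact const_scal_monoid : monoid_morphism const_scal.
Proof.
split; first by apply: const_val_inj; rewrite const_scalE !rmorph1.
by move=> a b; apply: const_val_inj; rewrite rmorphM /= !const_scalE rmorphM.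
Qed.

HB.instance Definition _ :=
  GRing.isZmodMorphism.Build K L const_scal const_scal_zmod.
HB.instance Definition _ :=
  GRing.isMonoidMorphism.Build K L const_scal const_scal_monoid.

(** In the coordinates [tau] and [eta], constant along the integral parabolas of
    [D], and X, polynomials over [L] form {poly {poly {poly L}}}, the
    variables being [tau], [eta], X from the inside out. *)
Let half : L := 2%:R^-1.
Let curv : L := half * (e1 + e2 * rho).

Definition straighten_var : 'I_3 -> {poly {poly {poly L}}} :=
  tri 'X
    (('X : {poly {poly L}})%:P
      + ((e0%:P + e2 *: 'X)%:P)%:P * 'X + (curv%:P%:P)%:P * 'X^2)
    ((('X : {poly L})%:P)%:P + (rho%:P%:P)%:P * 'X).

Definition straighten : {mpoly K[3]} -> {poly {poly {poly L}}} :=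
  mmap (@polyC _ \o @polyC _ \o @polyC _ \o const_scal) straighten_var.
HB.instance Definition _ := GRing.RMorphism.on straighten.

Lemma straightenC k : straighten k%:MP = (const_scal k)%:P%:P%:P.
Proof. by rewrite /straighten mmapC. Qed.

Lemma straightenD a b : straighten (a + b) = straighten a + straighten b.
Proof. exact: rmorphD. Qed.

Lemma straightenM a b : straighten (a * b) = straighten a * straighten b.
Proof. exact: rmorphM. Qed.

Lemma straightenX i : straighten 'X_i = straighten_var i.
Proof. by rewrite /straighten mmapX mmap1U. Qed.

(** The values of the coordinates [tau] and [eta] at the generic point. *)
Let tau : E := z - val rho * x.
Let eta : E := y - (val e0 + val e2 * tau) * x - val curv * x ^+ 2.

Definition ev1 : {poly L} -> E := horner_eval tau \o map_poly val.
HB.instance Definition _ := GRing.RMorphism.on ev1.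

Definition ev2 : {poly {poly L}} -> E := horner_eval eta \o map_poly ev1.
HB.instance Definition _ := GRing.RMorphism.on ev2.

Lemma ev1C a : ev1 a%:P = val a.
Proof. by rewrite /ev1 /= map_polyC /horner_eval hornerC. Qed.

Lemma ev1X : ev1 'X = tau.
Proof. by rewrite /ev1 /= map_polyX /horner_eval hornerX. Qed.

Lemma ev2C a : ev2 a%:P = ev1 a.
Proof. by rewrite /ev2 /= map_polyC /horner_eval hornerC. Qed.

Lemma ev2X : ev2 'X = eta.
Proof. by rewrite /ev2 /= map_polyX /horner_eval hornerX. Qed.

Lemma ev1D a b : ev1 (a + b) = ev1 a + ev1 b. Proof. exact: rmorphD. Qed.

Lemma ev1M a b : ev1 (a * b) = ev1 a * ev1 b. Proof. exact: rmorphM. Qed.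

Lemma ev2D a b : ev2 (a + b) = ev2 a + ev2 b. Proof. exact: rmorphD. Qed.

Lemma ev2M a b : ev2 (a * b) = ev2 a * ev2 b. Proof. exact: rmorphM. Qed.

Definition evE := (ev2D, ev2M, ev2C, ev2X, ev1D, ev1M, ev1C, ev1X).

(** Since [d3 tau = 1], the element [tau] is transcendental over the constants. *)
Lemma ev1_inj p : ev1 p = 0 -> p = 0.
Proof.
move=> evp; apply/eqP; rewrite -(map_poly_eq0 val); apply/eqP.
apply: (const_coefs_root (d := d3) (charE c charK) _ _ evp).
  by rewrite /tau derB derM d3x d3z (d_val rho).2; ring.
by move=> i; rewrite coef_map; exact: (d_val _).2.
Qed.

(** Back to the variables X, Y, Z. *)
Local Notation EX := ('X_ix : {mpoly E[3]}).
Local Notation EY := ('X_iy : {mpoly E[3]}).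
Local Notation EZ := ('X_iz : {mpoly E[3]}).
Let tauX := EZ - (val rho)%:MP * EX.
Let etaX := EY - ((val e0)%:MP + (val e2)%:MP * tauX) * EX
  - (val curv)%:MP * EX ^+ 2.

Definition back1 : {poly L} -> {mpoly E[3]} :=
  horner_eval tauX \o map_poly (@mpolyC 3 E \o val).
HB.instance Definition _ := GRing.RMorphism.on back1.

Definition back2 : {poly {poly L}} -> {mpoly E[3]} :=
  horner_eval etaX \o map_poly back1.
HB.instance Definition _ := GRing.RMorphism.on back2.

Definition back : {poly {poly {poly L}}} -> {mpoly E[3]} :=
  horner_eval EX \o map_poly back2.
HB.instance Definition _ := GRing.RMorphism.on back.

Lemma back1C a : back1 a%:P = (val a)%:MP.
Proof. by rewrite /back1 /= map_polyC /horner_eval hornerC. Qed.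

Lemma back1X : back1 'X = tauX.
Proof. by rewrite /back1 /= map_polyX /horner_eval hornerX. Qed.

Lemma back2C a : back2 a%:P = back1 a.
Proof. by rewrite /back2 /= map_polyC /horner_eval hornerC. Qed.

Lemma back2X : back2 'X = etaX.
Proof. by rewrite /back2 /= map_polyX /horner_eval hornerX. Qed.

Lemma backC a : back a%:P = back2 a.
Proof. by rewrite /back /= map_polyC /horner_eval hornerC. Qed.

Lemma backX : back 'X = EX.
Proof. by rewrite /back /= map_polyX /horner_eval hornerX. Qed.

Lemma back1D a b : back1 (a + b) = back1 a + back1 b.
Proof. exact: rmorphD. Qed.

Lemma back1M a b : back1 (a * b) = back1 a * back1 b.
Proof. exact: rmorphM. Qed.

Lemma back2D a b : back2 (a + b) = back2 a + back2 b.
Proof. exact: rmorphD. Qed.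

Lemma back2M a b : back2 (a * b) = back2 a * back2 b.
Proof. exact: rmorphM. Qed.

Lemma backD a b : back (a + b) = back a + back b.
Proof. exact: rmorphD. Qed.

Lemma backM a b : back (a * b) = back a * back b.
Proof. exact: rmorphM. Qed.

Lemma back_one : back 1 = 1.
Proof. exact: rmorph1. Qed.

Definition backE := (backD, backM, back2D, back2M, back1D, back1M,
  backC, backX, back2C, back2X, back1C, back1X).

Lemma back_straighten a : back (straighten a) = constx c a.
Proof.
apply: (mpoly_rmorph_ext (f := back \o straighten) (g := constx c)) => [k|i] /=.
  by rewrite straightenC !backE const_scalE constxC.
rewrite straightenX constxX; move: i; apply: ord3P.
all: rewrite /straighten_var triE ?backX //.
  by rewrite expr2 -mul_polyC !backE /etaX; ring.
by rewrite !backE /tauX; ring.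
Qed.

Definition generic_point : 'I_3 -> E := fun i => c 'X_i.

Lemma back_generic p : (back2 p).@[generic_point] = ev2 p.
Proof.
have tauE : tauX.@[generic_point] = tau.
  by rewrite mevalB mevalM mevalC !mevalXU.
have back1E q : (back1 q).@[generic_point] = ev1 q.
  rewrite /back1 /ev1 /= /horner_eval -horner_map /= tauE -map_poly_comp.
  by congr _.[_]; apply: eq_map_poly => a /=; rewrite mevalC.
have etaE : etaX.@[generic_point] = eta.
  rewrite /etaX expr2 !mevalB !mevalM mevalD !mevalM !mevalC tauE !mevalXU.
  by rewrite -expr2.
rewrite /back2 /ev2 /= /horner_eval -horner_map /= etaE -map_poly_comp.
by congr _.[_]; apply: eq_map_poly => q /=; rewrite back1E.
Qed.

Local Opaque back back1 back2 straighten ev1 ev2.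

(** The vector field [D] in new variables X, Y, Z, its coefficients [rho], [e0],
    [e1], [e2] being kept as constants. *)
Definition nabla (v : {mpoly K[3]}) : {mpoly E[3]} :=
  constx c v^`M(ix) + (val rho)%:MP * constx c v^`M(iz)
  + ((val e0)%:MP + (val e1)%:MP * EX + (val e2)%:MP * EZ) * constx c v^`M(iy).

(** In the straight coordinates [nabla] is the derivative in X, since [tau] and
    [eta] do not vary along its integral curves. *)
Lemma nabla_straighten v : nabla v = back (straighten v)^`().
Proof.
have two0 : 2%:R != 0 :> L.
  rewrite -(inj_eq (@const_val_inj _ _ _)) rmorph0 rmorph_nat.
  exact: (charE c charK).
apply: (mpoly_der_ext (j := constx c) (D1 := nabla)
  (D2 := fun v => back (straighten v)^`())) => [p q|p q|p q|p q|k|i].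
- by rewrite /nabla !mderivD !constxD affine_add.
- by rewrite straightenD derivD backD.
- by rewrite /nabla !mderivM !constxD !constxM affine_leibniz.
- rewrite straightenM derivM backD backM [back (straighten p * _)]backM.
  by congr (_ * _ + _ * _); exact: back_straighten.
- by rewrite /nabla straightenC derivC !mderivC !rmorph0 !mulr0 !addr0.
rewrite straightenX /nabla !mderivXU !rmorph_nat.
move: i; apply: ord3P; rewrite /straighten_var triE ?eqxx ?idx3_eq.
- by rewrite derivX back_one !mulr0n !mulr0 !addr0.
- rewrite deriv_quadratic -mul_polyC !backE !mulr0n mulr1n /curv.
  have -> : val (half * (e1 + e2 * rho)) = 2%:R^-1 * (val e1 + val e2 * val rho).
    by rewrite rmorphM rmorphD rmorphM fmorphV rmorph_nat.
  rewrite /tauX !mpolyCM mpolyCD mpolyCM.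
  have two2 : (2%:R^-1 : E)%:MP_[3] * 2%:R = 1.
    have -> : 2%:R = (2%:R : E)%:MP_[3] by rewrite rmorph_nat.
    by rewrite -mpolyCM mulVf //; exact: (charE c charK 1).
  exact: half_identity two2.
- rewrite deriv_linear !backE.
  by rewrite !mulr0n !mulr0 mulr1n mulr1 add0r addr0.
Qed.

(** The coefficients of d/dX, d/dY and d/dZ in [nabla] have weights at most 0, 1
    and 0, less than the weights 1, 2 and 1 of X, Y and Z. *)
Lemma nabla_wlt v : nabla v != 0 -> (wdeg (tri 1 2 1%N) (nabla v)
   < wdeg (tri 1 2 1%N) v)%N.
Proof.
set w := tri _ _ _ => nv0; apply: wdeg_lt => //.
have liftw i : wlt w (constx c v^`M(i)) ((wdeg w v).+1 - w i).
  move=> m; rewrite constxE fmorph_eq0 => /wdeg_mderiv wm.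
  by rewrite ltn_subRL addnC ltnS.
have wE : (w ix = 1%N) * (w iy = 2%N) * (w iz = 1%N) by rewrite /w !triE.
have := liftw ix; have := liftw iy; have := liftw iz; rewrite !wE !subn1 /=.
move=> wz wy wx; do 2?[apply: wltD] => //; first by rewrite mul_mpolyC; apply: wltZ.
have wX i : w i = 1%N -> wlt w (constx c v^`M(iy) * 'X_i) (wdeg w v).
  move=> wi; have [|/negbTE] := boolP (constx c v^`M(iy) == 0).
    by move/eqP ->; rewrite mul0r => m; rewrite mcoeff0 eqxx.
  move=> v0; apply: wltW (wltX wy); rewrite wi.
  have := wdeg_lt (negbT v0) wy; case: (wdeg w v) => // -[|k] //=.
have wc : wlt w (constx c v^`M(iy)) (wdeg w v).
  by apply: wltW wy; rewrite leq_subLR; case: (wdeg w v).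
rewrite mulrC !mulrDr; do 2?[apply: wltD].
- by rewrite mulrC mul_mpolyC; apply: wltZ.
- by rewrite mulrCA mul_mpolyC; apply/wltZ/wX; rewrite wE.
- by rewrite mulrCA mul_mpolyC; apply/wltZ/wX; rewrite wE.
Qed.

Lemma D_tau : D tau = 0.
Proof. by rewrite /tau derB derM D_val Dx Dz; ring. Qed.

Lemma D_eta : D eta = 0.
Proof.
have two0 : 2%:R != 0 :> E by apply: (charE c charK).
have curvE : val curv = (val e1 + val e2 * val rho) / 2%:R.
  by rewrite /curv rmorphM rmorphD rmorphM fmorphV rmorph_nat mulrC.
have Dt := D_tau; rewrite /eta; move: D_val Dt; rewrite /tau => Dv Dt.
rewrite !derB !derM derD Dy ![D (val _ * _)]derM Dt !Dv Dx curvE; field.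
exact: two0.
Qed.

Definition parabola (i : 'I_3) : {poly E} := map_poly ev2 (straighten_var i).

Lemma flow_straighten a : map_poly ev2 (straighten a) = flow c parabola a.
Proof.
apply: (mpoly_rmorph_ext (f := map_poly ev2 \o straighten) (g := flow c parabola)).
  by move=> k /=; rewrite straightenC flowC map_polyC /= ev2C ev1C const_scalE.
by move=> i /=; rewrite straightenX flowX.
Qed.

Lemma const_coefs_parabola i : const_coefs D (parabola i).
Proof.
have De q : D (ev1 q) = 0.
  elim/poly_ind: q => [|q a IH]; first by rewrite rmorph0 der0.
  by rewrite ev1D ev1M ev1X ev1C derD derM IH D_tau D_val; ring.
have De2 q : D (ev2 q) = 0.
  elim/poly_ind: q => [|q a IH]; first by rewrite rmorph0 der0.
  by rewrite ev2D ev2M ev2X ev2C derD derM IH D_eta De; ring.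
by move=> j; rewrite coef_map De2.
Qed.

Lemma parabola_at i : (parabola i).[x] = c 'X_i.
Proof.
rewrite /parabola; move: i; apply: ord3P; rewrite /straighten_var triE.
- by rewrite map_polyX hornerX.
- by rewrite map_quadratic_at /= -mul_polyC !evE /eta; ring.
- by rewrite map_linear_at /= !evE /tau; ring.
Qed.

(** Take a divisor [v] of some [f - k] of least weighted degree. It is constant
    along the parabolas, so all coefficients of [nabla v] in the straight
    coordinates vanish at the generic point, and so do those of [f(X) - f]. Their
    common divisor would specialise to a divisor of some [f - k'] of smaller
    weighted degree, were [nabla v] not zero. *)
Lemma invariant_divisor f : d1 (c f) = 0 -> d3 (c f) = 0 ->
  (exists2 m, m != 0%MM & f@_m != 0) ->
  exists2 v, (exists2 m, m != 0%MM & v@_m != 0) & nabla v = 0.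
Proof.
move=> f1 f3 f_nonconst; pose w := tri 1 2 1%N.
have [|v [v_nonconst [q [k fact]]] v_min] := @exists_minimal {mpoly K[3]}
    (fun v => (exists2 m, m != 0%MM & v@_m != 0) /\
              exists q k, f - k%:MP = q * v) (wdeg w).
  by exists f; split=> //; exists 1, 0; rewrite mul1r subr0.
exists v => //; apply/eqP; case: eqVneq => // nv0; exfalso.
have [g g_gen g_dvd] := kernel_principal (ev := ev2)
  (fun e ee => ev1_inj (etrans (esym (ev2C e)) ee)).
have fk0 : v * q != 0.
  have [m m0 fm] := f_nonconst; apply: contraNneq fm => vq0.
  have := congr1 (mcoeff m) fact; rewrite mulrC vq0 mcoeffB mcoeffC mcoeff0.
  by rewrite (negbTE m0) mulr0 subr0 => ->.
have Df : D (c f) = 0 by rewrite der_combE f1 f3 mulr0 addr0.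
have Dvq : D (c (v * q)) = 0.
  rewrite mulrC -fact rmorphB derB Df sub0r.
  by rewrite [D _](D_scal k) oppr0.
have [Dv flow_v] := flow_factor charK cI D_scal Dx const_coefs_parabola
  parabola_at fk0 Dvq.
have flow_f := flow_first_integral charK D_scal Dx const_coefs_parabola
  parabola_at Df.
have [Q2 EQ2] : exists Q, (straighten v)^`() = Q * g%:P.
  apply: coefs_factor => i; apply: g_dvd; rewrite coef_deriv rmorphMn /=.
  rewrite -(coef_map ev2) /= flow_straighten flow_v.
  by rewrite coefC mul0rn.
have [fL EfL] := const_fieldP f1 f3.
have [Q1 EQ1] : exists Q, straighten f - fL%:P%:P%:P = Q * g%:P.
  apply: coefs_factor => i; apply: g_dvd.
  rewrite -(coef_map ev2) rmorphB /= flow_straighten flow_f map_polyC /=.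
  by rewrite ev2C ev1C EfL subrr coef0.
have Ev : nabla v = back Q2 * back2 g.
  by rewrite nabla_straighten EQ2 rmorphM /= backC.
have Ef : constx c f - (c f)%:MP = back Q1 * back2 g.
  rewrite -[back2 g]backC -rmorphM -EQ1 rmorphB /= back_straighten.
  by rewrite !backE EfL.
have G0 : back2 g != 0 by apply: contraNneq nv0 => G0; rewrite Ev G0 mulr0.
have Q0 : back Q2 != 0 by apply: contraNneq nv0 => Q0; rewrite Ev Q0 mul0r.
have [m m0 Gm] : exists2 m, m != 0%MM & (back2 g)@_m != 0.
  apply: Classical_Prop.NNPP => no_m; case/negP: G0.
  have GC : back2 g = ((back2 g)@_0)%:MP.
    apply/mpolyP => m; rewrite mcoeffC; have [->|m0] := eqVneq m 0%MM.
      by rewrite mulr1.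
    rewrite mulr0; apply/eqP/negPn/negP => Gm; apply: no_m; by exists m.
  have := back_generic g; rewrite g_gen GC mevalC => ->.
  by rewrite mpolyC0.
have [v' [q' [k' [fact' v'm v'G]]]] := specialise_divisor charK cI cF Ef Gm.
have P_v' : (exists2 m, m != 0%MM & v'@_m != 0) /\
    exists q k, f - k%:MP = q * v' by split; [exists m | exists q', k'].
have v'0 : v' != 0 by apply: contraNneq v'm => ->; rewrite mcoeff0.
have := v_min _ P_v'; apply/negP; rewrite -ltnNge.
apply: leq_ltn_trans (nabla_wlt nv0); rewrite Ev -/w wdegM //.
apply: leq_trans (leq_addl _ _); have [m' m'v <-] := wdeg_attained w v'0.
by apply: weight_le_wdeg; rewrite mcoeff_msupp v'G // -mcoeff_msupp.
Qed.

End Invariance.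

(** * Descent of affine coefficients to the base field *)

Local Notation X := 'X_ix.
Local Notation Y := 'X_iy.
Local Notation Z := 'X_iz.

Definition affine (R : nzRingType) (a0 a1 a2 : R) : {mpoly R[3]} :=
  a0%:MP + a1 *: X + a2 *: Z.

Lemma affine_mderiv (R : nzRingType) (k0 k1 k2 : R) :
  [/\ (affine k0 k1 k2)^`M(ix) = k1%:MP, (affine k0 k1 k2)^`M(iy) = 0
    & (affine k0 k1 k2)^`M(iz) = k2%:MP].
Proof.
rewrite /affine; split; rewrite !mderivD !mderivZ !mderivXU mderivC ?eqxx ?idx3_eq.
- by rewrite add0r scaler0 addr0 -mul_mpolyC mulr1.
- by rewrite !scaler0 !addr0.
- by rewrite add0r scaler0 add0r -mul_mpolyC mulr1.
Qed.

Section Descent.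
Variables (K E : fieldType) (c : {rmorphism {mpoly K[3]} -> E}).
Hypotheses (charK : char_zero K) (cI : injective c) (cF : fractions_of c).

Lemma constx_inj : injective (constx c : {mpoly K[3]} -> _).
Proof.
move=> p q /mpolyP pq; apply/mpolyP => m; have := pq m.
by rewrite !constxE => /fmorph_inj.
Qed.

(** [d] acting on coefficients; linear over polynomials with coefficients in
    [K] by [coef_derM]. *)
Definition coef_der (d : derivation E) (G : {mpoly E[3]}) : {mpoly E[3]} :=
  \sum_(m <- msupp G) d G@_m *: 'X_[m].

Lemma coef_derE d G m : (coef_der d G)@_m = d G@_m.
Proof.
rewrite /coef_der raddf_sum /=; have [mG|mG] := boolP (m \in msupp G).
  rewrite (bigD1_seq m) //= mcoeffZ mcoeffX eqxx mulr1 big1 ?addr0 // => k km.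
  by rewrite mcoeffZ mcoeffX (negbTE km) mulr0.
rewrite memN_msupp_eq0 // der0 big1_seq // => k /= kG.
rewrite mcoeffZ mcoeffX; case: eqP => [km|]; last by rewrite mulr0.
by rewrite -km kG in mG.
Qed.

Lemma coef_derM (d : derivation E) G p : (forall k, d (scal c k) = 0) ->
  coef_der d (G * constx c p) = coef_der d G * constx c p.
Proof.
move=> dk; apply/mpolyP => m; rewrite coef_derE !mcoeffM der_sum.
apply: eq_bigr => k _.
by rewrite derM coef_derE constxE dk mulr0 addr0.
Qed.

Lemma coef_derD d G H : coef_der d (G + H) = coef_der d G + coef_der d H.
Proof. by apply/mpolyP => m; rewrite mcoeffD !coef_derE mcoeffD derD. Qed.

Lemma coef_der_affine d a0 a1 a2 :
  coef_der d (affine a0 a1 a2) = affine (d a0) (d a1) (d a2).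
Proof.
apply/mpolyP => m; rewrite coef_derE !mcoeffD !mcoeffZ !mcoeffC !mcoeffX.
by rewrite !derD !derM !der_nat !mulr0 !addr0.
Qed.

Lemma affine_coef (R : nzRingType) (a0 a1 a2 : R) :
  [/\ (affine a0 a1 a2)@_0 = a0, (affine a0 a1 a2)@_U_(ix) = a1
    & (affine a0 a1 a2)@_U_(iz) = a2].
Proof.
have U0 i : (U_(i) == 0 :> 'X_{1..3})%MM = false.
  by apply/eqP => /mnmP /(_ i); rewrite mnm1E eqxx mnm0E.
rewrite /affine !mcoeffD !mcoeffZ !mcoeffC !mcoeffX !eqxx !U0 !eq_mnm1 !idx3_eq.
by split; rewrite !(mulr0, mulr1, addr0, add0r).
Qed.

Lemma constx_affine k0 k1 k2 :
  constx c (affine k0 k1 k2) = affine (scal c k0) (scal c k1) (scal c k2).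
Proof.
apply/mpolyP => m; rewrite constxE /affine !mcoeffD !mcoeffZ !mcoeffC !mcoeffX.
by rewrite !rmorphD !rmorphM !rmorph_nat.
Qed.

(** Differentiating its coefficients shows that a quotient of polynomials over
    [K] that is affine has coefficients in [K]. *)
Lemma affine_descent a0 a1 a2 (p q : {mpoly K[3]}) : p != 0 ->
  affine a0 a1 a2 * constx c p = constx c q ->
  exists k0 k1 k2 : K, [/\ a0 = scal c k0, a1 = scal c k1, a2 = scal c k2
    & q = affine k0 k1 k2 * p].
Proof.
move=> p0 Epq.
have cp0 : constx c p != 0.
  by apply: contra p0 => /eqP cp; apply/eqP; apply: constx_inj; rewrite cp rmorph0.
have d_aff i : affine (pd cI cF i a0) (pd cI cF i a1) (pd cI cF i a2) = 0.
  apply: (mulIf cp0); rewrite mul0r -coef_der_affine -coef_derM; last exact: pd_scal.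
  by rewrite Epq; apply/mpolyP => m; rewrite coef_derE constxE pd_scal mcoeff0.
have d_a i : [/\ pd cI cF i a0 = 0, pd cI cF i a1 = 0 & pd cI cF i a2 = 0].
  have [] := affine_coef (pd cI cF i a0) (pd cI cF i a1) (pd cI cF i a2).
  by rewrite d_aff !mcoeff0.
have desc := pd_const charK (cI := cI) (cF := cF).
have [k0 E0] : exists k, a0 = scal c k by apply: desc => i; case: (d_a i).
have [k1 E1] : exists k, a1 = scal c k by apply: desc => i; case: (d_a i).
have [k2 E2] : exists k, a2 = scal c k by apply: desc => i; case: (d_a i).
exists k0, k1, k2; split=> //; apply: constx_inj.
by rewrite constxM constx_affine -E0 -E1 -E2.
Qed.

(** A nonconstant polynomial over [K] killed by [nabla], whose slope [rho] is not
    in [K], is killed by two independent vector fields with coefficients in [K], as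
    differentiating the coefficients of the equation shows. The symmetry of the
    second derivatives of [v] makes the affine forms the partial derivatives of a
    quadratic polynomial. *)
Lemma affine_slopes v rho e0 e1 e2 :
  (exists i, pd cI cF i rho != 0) -> (exists2 m, m != 0%MM & v@_m != 0) ->
  constx c v^`M(ix) + rho%:MP * constx c v^`M(iz)
    + affine e0 e1 e2 * constx c v^`M(iy) = 0 ->
  exists A B C C1 C2 : K, affine e0 e1 e2 =
    - (constx c (affine C1 A B) + rho%:MP * constx c (affine C2 B C)).
Proof.
case=> i rho_i [m m0 vm] nabla0; pose d := pd cI cF i.
have d_scal k : d (scal c k) = 0 by apply: pd_scal.
have d_constx p : coef_der d (constx c p) = 0.
  by apply/mpolyP => k; rewrite coef_derE constxE d_scal mcoeff0.
have d_rho p : coef_der d (rho%:MP * constx c p) = (d rho)%:MP * constx c p.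
  by apply/mpolyP => k; rewrite coef_derE !mcoeffCM derM constxE d_scal mulr0 addr0.
have : coef_der d (constx c v^`M(ix) + rho%:MP * constx c v^`M(iz)
    + affine e0 e1 e2 * constx c v^`M(iy)) = 0.
  by rewrite nabla0; apply/mpolyP => k; rewrite coef_derE mcoeff0 der0.
rewrite !coef_derD d_constx add0r d_rho coef_derM // coef_der_affine => Ez.
have drho0 : (d rho)%:MP_[3] != 0 by rewrite mpolyC_eq0.
have vy0 : v^`M(iy) != 0.
  apply: contraNneq vm => vy0; move: Ez nabla0.
  rewrite vy0 rmorph0 !mulr0 !addr0 => /eqP.
  rewrite mulf_eq0 (negbTE drho0) => /eqP vz0; rewrite vz0 mulr0 addr0 => vx0.
  rewrite (mderivs_eq0 charK (p := v)); first by rewrite mcoeffC (negbTE m0) mulr0.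
  apply: ord3P => //; apply: constx_inj; by rewrite ?vx0 ?vz0 rmorph0.
have Ez' : affine (- d e0 / d rho) (- d e1 / d rho) (- d e2 / d rho)
    * constx c v^`M(iy) = constx c v^`M(iz).
  apply: (mulfI drho0); rewrite mulrA.
  have -> : (d rho)%:MP * affine (- d e0 / d rho) (- d e1 / d rho) (- d e2 / d rho)
      = - affine (d e0) (d e1) (d e2).
    apply/mpolyP => k; rewrite mcoeffCM /affine mcoeffN !mcoeffD !mcoeffZ !mcoeffC.
    by field.
  by apply/eqP; rewrite mulNr eq_sym -addr_eq0 Ez.
have [C2 [B' [C [_ _ _ Evz]]]] := affine_descent vy0 Ez'.
have Ex : affine (- e0 - rho * scal c C2) (- e1 - rho * scal c B')
    (- e2 - rho * scal c C) * constx c v^`M(iy) = constx c v^`M(ix).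
  have -> : affine (- e0 - rho * scal c C2) (- e1 - rho * scal c B')
      (- e2 - rho * scal c C)
      = - (affine e0 e1 e2 + rho%:MP * constx c (affine C2 B' C)).
    rewrite constx_affine; apply/mpolyP => k.
    by rewrite mcoeffN mcoeffD mcoeffCM /affine !mcoeffD !mcoeffZ !mcoeffC; ring.
  apply/eqP; rewrite mulNr eq_sym -addr_eq0 mulrDl -mulrA -constxM -Evz.
  by rewrite [X in _ + X]addrC addrA nabla0.
have [C1 [A [B [F0 F1 F2 Evx]]]] := affine_descent vy0 Ex.
exists A, B, C, C1, C2.
have BB : B = B'.
  have [_ Ay Az] := affine_mderiv C1 A B; have [Ax' Ay' _] := affine_mderiv C2 B' C.
  have vyz : v^`M(iy)^`M(iz) = affine C2 B' C * v^`M(iy)^`M(iy).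
    by rewrite mderiv_comm Evz mderivM Ay' mul0r add0r.
  have vyx : v^`M(iy)^`M(ix) = affine C1 A B * v^`M(iy)^`M(iy).
    by rewrite mderiv_comm Evx mderivM Ay mul0r add0r.
  have := mderiv_comm ix iz v; rewrite Evx Evz !mderivM Ax' Az vyz vyx.
  rewrite mulrCA => /addIr /(mulIf vy0) /eqP.
  by rewrite -subr_eq0 -mpolyCB mpolyC_eq0 subr_eq0 => /eqP.
subst B'; rewrite !constx_affine; apply/mpolyP => k.
rewrite mcoeffN mcoeffD mcoeffCM /affine !mcoeffD !mcoeffZ !mcoeffC.
by rewrite -F0 -F1 -F2; ring.
Qed.

End Descent.

(** * Polynomial substitutions *)

Section Substitution.
Variables (n k : nat) (K : comNzRingType) (lq : n.-tuple {mpoly K[k]}).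

Lemma comp_mpoly_chain p j :
  (p \mPo lq)^`M(j) = \sum_i (p^`M(i) \mPo lq) * (tnth lq i)^`M(j).
Proof.
apply: (mpoly_der_ext (j := comp_mpoly lq)
  (D1 := fun p => (p \mPo lq)^`M(j))
  (D2 := fun p => \sum_i (p^`M(i) \mPo lq) * (tnth lq i)^`M(j)))
  => [q r|q r|q r|q r|a|i].
- by rewrite rmorphD mderivD.
- rewrite -big_split; apply: eq_bigr => i _.
  by rewrite mderivD rmorphD mulrDl.
- by rewrite rmorphM mderivM.
- rewrite mulr_suml mulr_sumr -big_split; apply: eq_bigr => i _.
  by rewrite mderivM rmorphD !rmorphM /=; ring.
- rewrite comp_mpolyC mderivC big1 // => i _.
  by rewrite mderivC rmorph0 mul0r.
- rewrite (bigD1 i) //= mderivXU eqxx rmorph1 mul1r big1 => [|l li].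
    by rewrite addr0 comp_mpolyXU -tnth_nth.
  by rewrite mderivXU eq_sym (negbTE li) rmorph0 mul0r.
Qed.

End Substitution.

Lemma alg_dependent_rmorph n k (K : fieldType)
    (u : {rmorphism {mpoly K[n]} -> {mpoly K[k]}}) f h :
  (forall a, u a%:MP = a%:MP) -> alg_dependent f h -> alg_dependent (u f) (u h).
Proof.
move=> uC [Q Q0 Qfh]; exists Q => //.
have := congr1 u Qfh; rewrite rmorph0 => <-; apply/esym.
apply: (mpoly_rmorph_ext (f := u \o comp_mpoly [tuple f; h])
  (g := comp_mpoly [tuple u f; u h])) => [a|i] /=.
  by rewrite !comp_mpolyC uC.
by rewrite !comp_mpolyXU -!tnth_nth; case: i => -[|[|//]] lt_i; rewrite !(tnth_nth 0).
Qed.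

Section PolyAt.
Variables (n : nat) (K : fieldType) (u : {mpoly K[n]}).
Implicit Types p q : {poly K}.

Lemma poly_atD p q : poly_at (p + q) u = poly_at p u + poly_at q u.
Proof. by rewrite /poly_at rmorphD hornerD. Qed.

Lemma poly_atM p q : poly_at (p * q) u = poly_at p u * poly_at q u.
Proof. by rewrite /poly_at rmorphM hornerM. Qed.

Lemma poly_atZ k p : poly_at (k *: p) u = k *: poly_at p u.
Proof. by rewrite /poly_at map_polyZ /= hornerZ mul_mpolyC. Qed.

Lemma poly_at_meval p v : (poly_at p u).@[v] = p.[u.@[v]].
Proof.
rewrite /poly_at; elim/poly_ind: p => [|p k IH].
  by rewrite rmorph0 !horner0 meval0.
rewrite rmorphD rmorphM /= map_polyX map_polyC !hornerE mevalD mevalM IH.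
by rewrite mevalC.
Qed.

End PolyAt.

Lemma poly_at_comp n k (K : fieldType) (lq : n.-tuple {mpoly K[k]}) P u :
  poly_at P u \mPo lq = poly_at P (u \mPo lq).
Proof.
rewrite /poly_at -horner_map -map_poly_comp; congr _.[_].
by apply: eq_map_poly => a /=; rewrite comp_mpolyC.
Qed.

Lemma poly_at_mderiv n (K : fieldType) P (u : {mpoly K[n]}) i :
  (poly_at P u)^`M(i) = poly_at P^`() u * u^`M(i).
Proof.
rewrite /poly_at; elim/poly_ind: P => [|p a IH].
  by rewrite deriv0 !rmorph0 !horner0 mderiv0 mul0r.
rewrite derivD derivM derivC derivX addr0 mulr1 !rmorphD !rmorphM /=.
rewrite !map_polyC !map_polyX !hornerE mderivD mderivM mderivC IH; ring.
Qed.

(** * Shears *)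

Definition quad (K : fieldType) (A B C C1 C2 : K) : {mpoly K[3]} :=
  (A / 2%:R) *: X ^+ 2 + B *: (X * Z) + (C / 2%:R) *: Z ^+ 2
  + C1 *: X + C2 *: Z.

Section Quad.
Variables (K : fieldType) (charK : char_zero K) (A B C C1 C2 : K).
Local Notation a := (quad A B C C1 C2).

Lemma quad_mderiv : [/\ a^`M(ix) = affine C1 A B, a^`M(iy) = 0
  & a^`M(iz) = affine C2 B C].
Proof.
have two0 : 2%:R != 0 :> K by apply: charK.
have two_half (e : K) (p : {mpoly K[3]}) : (e / 2%:R) *: (p + p) = e *: p.
  by rewrite -mulr2n -scaler_nat scalerA mulfVK.
rewrite /quad /affine !mderivD !mderivZ !expr2 !mderivM !mderivXU !eqxx !idx3_eq.
rewrite !(mulr0n, mulr1n, mul1r, mulr1, mul0r, mulr0, addr0, add0r, scaler0).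
have one_scale (e : K) : e *: (1 : {mpoly K[3]}) = e%:MP.
  by rewrite -mul_mpolyC mulr1.
by rewrite !two_half !one_scale; split=> //; rewrite addrC addrA.
Qed.

Lemma quad_at0 : a.@[fun=> 0] = 0.
Proof.
by rewrite /quad !mevalD !mevalZ !mevalM !mevalXU !(mulr0, addr0).
Qed.

Fact shear_simplify (S : comNzRingType) (px py pz sx sz : S) :
  [/\ px * 1 + (py * (0 + sx) + pz * 0) = px + py * sx,
      px * 0 + (py * (1 + 0) + pz * 0) = py
    & px * 0 + (py * (0 + sz) + pz * 1) = pz + py * sz].
Proof. by split; ring. Qed.

Definition shear (s : {mpoly K[3]}) : 3.-tuple {mpoly K[3]} :=
  [tuple tri X (Y + s) Z i | i < 3].

Lemma shear_mderiv s p : s^`M(iy) = 0 ->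
  [/\ (p \mPo shear s)^`M(ix) = (p^`M(ix) \mPo shear s)
        + (p^`M(iy) \mPo shear s) * s^`M(ix),
      (p \mPo shear s)^`M(iy) = p^`M(iy) \mPo shear s
    & (p \mPo shear s)^`M(iz) = (p^`M(iz) \mPo shear s)
        + (p^`M(iy) \mPo shear s) * s^`M(iz)].
Proof.
move=> sy; rewrite !comp_mpoly_chain !big_ord3 !tnth_mktuple !triE.
rewrite !mderivD !mderivXU sy !eqxx !idx3_eq !mulr0n !mulr1n.
exact: shear_simplify.
Qed.

Lemma comp_mpoly_cancel (lq1 lq2 : 3.-tuple {mpoly K[3]}) :
  (forall i, tnth lq1 i \mPo lq2 = 'X_i) -> cancel (comp_mpoly lq1) (comp_mpoly lq2).
Proof.
move=> E1; apply: (mpoly_rmorph_ext (f := comp_mpoly lq2 \o comp_mpoly lq1)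
  (g := idfun)) => [e|i] /=; first by rewrite !comp_mpolyC.
by rewrite comp_mpolyXU -tnth_nth.
Qed.

Lemma quad_shear e : a \mPo shear (e *: a) = a.
Proof.
rewrite /quad !rmorphD /= !linearZ /= !rmorphXn !rmorphM /= !comp_mpolyXU.
by rewrite -!tnth_nth !tnth_mktuple !triE.
Qed.

Lemma shearK e : cancel (comp_mpoly (shear (e *: a))) (comp_mpoly (shear (- e *: a))).
Proof.
apply: comp_mpoly_cancel => i; rewrite tnth_mktuple.
move: i; apply: ord3P; rewrite triE.
- by rewrite comp_mpolyXU -tnth_nth tnth_mktuple triE.
- rewrite rmorphD /= linearZ /= quad_shear comp_mpolyXU -tnth_nth tnth_mktuple triE.
  by rewrite scaleNr subrK.
- by rewrite comp_mpolyXU -tnth_nth tnth_mktuple triE.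
Qed.

End Quad.

Lemma poly_in_Y (K : fieldType) (p : {mpoly K[3]}) : char_zero K ->
  p^`M(ix) = 0 -> p^`M(iz) = 0 -> exists P, p = poly_at P Y.
Proof.
move=> charK px pz; exists (\sum_(m <- msupp p) p@_m *: 'X^(m iy)).
rewrite /poly_at rmorph_sum horner_sum [LHS]mpolyE; apply: eq_big_seq => m mp.
rewrite /= map_polyZ /= map_polyXn hornerZ hornerXn mul_mpolyC; congr (_ *: _).
rewrite mpolyXE_id big_ord3 /=.
have m0 i : p^`M(i) = 0 -> m i = 0%N.
  move=> pi; apply/eqP; apply: contraLR mp => mi.
  by rewrite -mcoeff_eq0 (mderiv_eq0_coeff charK pi mi).
by rewrite (m0 _ px) (m0 _ pz) !expr0 mul1r mulr1.
Qed.

(** * The common coordinate of two dependent components *)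

Section LevelCoordinate.
Variables (K E : fieldType) (c : {rmorphism {mpoly K[3]} -> E}).
Hypotheses (charK : char_zero K) (cI : injective c) (cF : fractions_of c).
Variables f g h : {mpoly K[3]}.
Hypothesis fh_dep : alg_dependent f h.
Hypothesis trace1 : f^`M(ix) + g^`M(iy) + h^`M(iz) = 0.
Hypothesis trace2 :
  g^`M(iy) * (f^`M(ix) + h^`M(iz)) = f^`M(iy) * g^`M(ix) + h^`M(iy) * g^`M(iz).
Hypothesis indep : forall a b k : K, a *: f + b *: h = k%:MP -> a = 0 /\ b = 0.

Let minors i j : f^`M(i) * h^`M(j) = f^`M(j) * h^`M(i).
Proof. exact: (dependent_minors charK cI cF). Qed.

(** If [f_y = 0] then the traces force [g_y = 0], and the planar case makes [f]
    constant, contrary to independence. *)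
Lemma f_depends_on_y : f^`M(iy) != 0.
Proof.
apply/eqP => fy0.
have f_nonzero : ~ (f^`M(ix) = 0 /\ f^`M(iz) = 0).
  case=> fx0 fz0; have fC : 1 *: f + 0 *: h = (f@_0)%:MP.
    rewrite scale1r scale0r addr0; apply: (mderivs_eq0 charK).
    by apply: ord3P; rewrite ?fx0 ?fy0 ?fz0.
  by have [/eqP] := indep fC; rewrite oner_eq0.
have hy0 : h^`M(iy) = 0.
  apply/eqP/negPn/negP => hy; apply: f_nonzero; split; apply: (mulIf hy).
    by rewrite minors fy0 !mul0r.
  by rewrite minors fy0 !mul0r.
have gy0 : g^`M(iy) = 0.
  have fxhz : f^`M(ix) + h^`M(iz) = - g^`M(iy).
    by apply/eqP; rewrite -addr_eq0 addrAC trace1.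
  have := trace2; rewrite fxhz fy0 hy0 !mul0r addr0 mulrN => /eqP.
  by rewrite oppr_eq0 mulf_eq0 orbb => /eqP.
apply: f_nonzero; apply: (planar_nilpotent charK cI cF minors _ indep).
by move: trace1; rewrite gy0 addr0.
Qed.

Let fy0 := f_depends_on_y.

(** The equation [kernel_der (y + a) = 0], for a quadratic polynomial [a] in x and z
    with partial derivatives [affine C1 A B] and [affine C2 B C]: evaluate
    [affine_slopes] at the generic point. *)
Lemma kernel_slopes : exists A B C C1 C2 : K,
  f^`M(ix) + h^`M(iz) =
  f^`M(iy) * affine C1 A B + h^`M(iy) * affine C2 B C.
Proof.
pose d1 := along cI cF f ix; pose d3 := along cI cF f iz.
have [e0 [e1 [e2 [[e01 e03] [e11 e13] [e21 e23] Dy]]]] :=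
  kernel_affine charK cI cF fy0 minors trace1 trace2 indep.
have [s1 s3] := slope_const cI cF fy0 minors.
have [rhoL Erho] := const_fieldP s1 s3.
have [e0L E0] := const_fieldP e01 e03.
have [e1L E1] := const_fieldP e11 e13.
have [e2L E2] := const_fieldP e21 e23.
have [d1x d1z d3x d3z] : [/\ d1 (c X) = 1, d1 (c Z) = 0, d3 (c X) = 0 & d3 (c Z) = 1].
  by rewrite !along_X !eqxx !idx3_eq !mulr1n !mulr0n; split; ring.
have d1_scal k : d1 (scal c k) = 0 by apply: along_scal.
have d3_scal k : d3 (scal c k) = 0 by apply: along_scal.
have DyL : der_comb d1 (const_val rhoL) d3 (c Y) =
    const_val e0L + const_val e1L * c X + const_val e2L * c Z.
  by rewrite Erho E0 E1 E2.
have f_nonconst : exists2 m, m != 0%MM & f@_m != 0.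
  have : exists2 m, m \in msupp f^`M(iy) & True.
    by have [m m_in _] := wdeg_attained (fun=> 0%N) fy0; exists m.
  case=> m; rewrite mcoeff_msupp mcoeff_mderiv => fm _; exists (m + U_(iy))%MM.
    by apply/eqP => /mnmP /(_ iy); rewrite mnmDE mnm1E eqxx mnm0E addn1.
  by apply: contraNneq fm => ->; rewrite mul0rn.
have [v v_nonconst nabla_v] := invariant_divisor charK cI cF d1_scal d3_scal
  d1x d1z d3x d3z DyL (along_f cI cF fy0 ix) (along_f cI cF fy0 iz) f_nonconst.
have rho_nonconst := slope_not_scalar charK cI cF (slopeE cI fy0 minors) indep.
have [|A [B [C [C1 [C2 E3]]]]] :=
    affine_slopes (e0 := e0) (e1 := e1) (e2 := e2) charK rho_nonconst v_nonconst.
  move: nabla_v; rewrite /nabla Erho E0 E1 E2 => nabla_v.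
  by rewrite -[RHS]nabla_v /affine -!mul_mpolyC.
exists A, B, C, C1, C2; apply: cI.
have at_generic p : (constx c p).@[generic_point c] = c p.
  apply: (mpoly_rmorph_ext (f := meval (generic_point c) \o constx c) (g := c)).
    by move=> k /=; rewrite constxC mevalC.
  by move=> i /=; rewrite constxX mevalXU.
have := congr1 (meval (generic_point c)) E3.
rewrite /affine mevalN !mevalD !mevalZ !mevalXU mevalM !mevalC !at_generic -Dy.
rewrite der_combE !along_X eqxx !idx3_eq !mulr1n !mulr0n => E4.
have cfy0 : c f^`M(iy) != 0 by rewrite fraction_neq0.
rewrite !rmorphD !rmorphM !(slopeE cI fy0 minors).
move: E4 cfy0; move: (c f^`M(ix)) (c f^`M(iy)) (c f^`M(iz)) (slope c f h).
move: (c (affine C1 A B)) (c (affine C2 B C)) => a1 a2 fx fy fz rho E4 fy_neq0.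
transitivity (- fy * (0 - fx / fy * 1 + rho * (0 - fz / fy * 1))).
  by field.
by rewrite E4; ring.
Qed.

(** After the shear by [a], the equation of [kernel_slopes] is the trace
    condition of the planar case, so that the sheared [f] and [h] depend on Y
    only. *)
Lemma level_coordinate : exists (A B C C1 C2 : K) (p q : {poly K}),
  f = poly_at p (Y + quad A B C C1 C2) /\ h = poly_at q (Y + quad A B C C1 C2).
Proof.
have [A [B [C [C1 [C2 slopes]]]]] := kernel_slopes.
exists A, B, C, C1, C2; pose a := quad A B C C1 C2.
have [ax ay az] := quad_mderiv charK A B C C1 C2.
pose u := comp_mpoly (shear (- 1 *: a)).
have uK : cancel u (comp_mpoly (shear a)).
  have := shearK A B C C1 C2 (- 1); rewrite -/a -/u.
  by rewrite [- - 1](opprK 1) scale1r.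
have uB (p q : {mpoly K[3]}) : u (p - q) = u p - u q by exact: rmorphB.
have uM (p q : {mpoly K[3]}) : u (p * q) = u p * u q by exact: rmorphM.
have u_deriv (p : {mpoly K[3]}) :
  [/\ (u p)^`M(ix) = u (p^`M(ix) - p^`M(iy) * affine C1 A B),
      (u p)^`M(iy) = u p^`M(iy)
    & (u p)^`M(iz) = u (p^`M(iz) - p^`M(iy) * affine C2 B C)].
  have u_affine k0 k1 k2 : u (affine k0 k1 k2) = affine k0 k1 k2.
    rewrite /u /affine !rmorphD /= !linearZ /= comp_mpolyC !comp_mpolyXU.
    by rewrite -!tnth_nth !tnth_mktuple !triE.
  have say : (- 1 *: a)^`M(iy) = 0 by rewrite mderivZ ay scaler0.
  have sax : (- 1 *: a)^`M(ix) = - affine C1 A B by rewrite mderivZ ax scaleN1r.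
  have saz : (- 1 *: a)^`M(iz) = - affine C2 B C by rewrite mderivZ az scaleN1r.
  have [Ex Ey Ez] := shear_mderiv p say; split.
  - by rewrite [LHS]Ex sax uB uM u_affine mulrN.
  - exact: Ey.
  - by rewrite [LHS]Ez saz uB uM u_affine mulrN.
have dep : alg_dependent (u f) (u h).
  by apply: alg_dependent_rmorph fh_dep => k; exact: comp_mpolyC.
have minors_u := dependent_minors charK cI cF _ _ dep.
have u_indep k1 k2 k : k1 *: u f + k2 *: u h = k%:MP -> k1 = 0 /\ k2 = 0.
  move/(congr1 (comp_mpoly (shear a))); rewrite rmorphD /= !linearZ /= !uK.
  by rewrite comp_mpolyC; apply: indep.
have [fx fy fz] := u_deriv f; have [hx hy hz] := u_deriv h.
have u_trace : (u f)^`M(ix) + (u h)^`M(iz) = 0.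
  rewrite fx hz -rmorphD /=; apply/eqP; rewrite (_ : _ + _ = 0) ?rmorph0 //.
  by rewrite addrACA slopes -opprD subrr.
have [ufx ufz] := planar_nilpotent charK cI cF minors_u u_trace u_indep.
have ufy0 : (u f)^`M(iy) != 0.
  by rewrite fy; apply: contraNneq fy0 => E1; rewrite -[f^`M(iy)]uK E1 rmorph0.
have uh0 i : (u f)^`M(i) = 0 -> (u h)^`M(i) = 0.
  by move=> fi0; apply: (mulfI ufy0); rewrite minors_u fi0 mul0r mulr0.
have [p Ep] := poly_in_Y charK ufx ufz.
have [q Eq] := poly_in_Y charK (uh0 _ ufx) (uh0 _ ufz).
have Ya : (Y : {mpoly K[3]}) \mPo shear a = Y + a.
  by rewrite comp_mpolyXU -tnth_nth tnth_mktuple triE.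
by exists p, q; rewrite -[f]uK -[h]uK Ep Eq !poly_at_comp Ya.
Qed.

End LevelCoordinate.

(** * Polynomially parametrised conics *)

Fact conic_shift (S : comNzRingType) (a b k A B C u w p r : S) :
  a * p + b * (r + k * p) =
    A * u * p ^+ 2 + B * (p * (r + k * p)) + C * u * (r + k * p) ^+ 2 ->
  u * w = 1 -> w = 2%:R ->
  b * r + (a + b * k) * p = C * u * r ^+ 2 + (B + C * k) * (r * p)
    + (A + w * B * k + C * k ^+ 2) * u * p ^+ 2.
Proof.
move=> rel uw w2; have -> : b * r + (a + b * k) * p = a * p + b * (r + k * p) by ring.
have -> : C * u * r ^+ 2 + (B + C * k) * (r * p)
    + (A + w * B * k + C * k ^+ 2) * u * p ^+ 2 =
  C * u * r ^+ 2 + (B + C * k) * (r * p)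
    + (A * u + (u * w) * B * k + C * u * k ^+ 2) * p ^+ 2 by ring.
rewrite rel uw; have -> : A * u * p ^+ 2 + B * (p * (r + k * p))
    + C * u * (r + k * p) ^+ 2 =
  A * u * p ^+ 2 + B * (p * (r + k * p)) + C * u * (r ^+ 2 + (k * p) ^+ 2)
    + C * (u * 2%:R) * (r * (k * p)) by ring.
by rewrite -w2 uw; ring.
Qed.

Section Conic.
Variable K : fieldType.
Hypothesis charK : char_zero K.
Implicit Types p q : {poly K}.

Let two0 : 2%:R != 0 :> K. Proof. exact: charK. Qed.

Lemma size_gt1 p : p != 0 -> p.[0] = 0 -> (1 < size p)%N.
Proof.
move=> p0 p00; rewrite ltnNge; apply: contra p0 => /size1_polyC pC.
by rewrite pC hornerC in p00; rewrite pC p00.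
Qed.

(** Compare the coefficients in the degrees of [q ^+ 2], [p * q] and [p ^+ 2],
    successively. *)
Lemma conic_lt p q (a b A B C : K) : (1 < size p)%N -> (size p < size q)%N ->
  a *: p + b *: q = (A / 2%:R) *: p ^+ 2 + B *: (p * q) + (C / 2%:R) *: q ^+ 2 ->
  [/\ B = 0, C = 0 & A != 0 -> b != 0].
Proof.
move=> size_p size_q.
have [m Em] : exists m, size p = m.+2 by case: (size p) size_p => [|[|m]] //; exists m.
have [n En] : exists n, size q = n.+1 by case: (size q) size_q => // n; exists n.
rewrite En Em ltnS in size_q.
have pm : p`_m.+1 != 0 by rewrite -[m.+1]/(m.+2.-1) -Em lead_coef_eq0 -size_poly_gt0 Em.
have qn : q`_n != 0 by rewrite -[n]/(n.+1.-1) -En lead_coef_eq0 -size_poly_gt0 En.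
have sp : (size p <= m.+2)%N by rewrite Em.
have sq : (size q <= n.+1)%N by rewrite En.
have [spp pp] := top_coefM sp sp; have [spq pq] := top_coefM sp sq.
have [_ qq] := top_coefM sq sq.
have half_neq0 (D : K) : D != 0 -> D / 2%:R != 0.
  by move=> D0; rewrite mulf_neq0 // invr_neq0.
move=> rel.
have C0 : C = 0.
  apply/eqP; apply: contraNT qn => /half_neq0 C0.
  have := congr1 (fun s : {poly K} => s`_(n + n)) rel.
  rewrite !coefD !coefZ !expr2 qq (nth_default _ (leq_trans sp _)); last first.
    by rewrite (leq_trans size_q) // leq_addr.
  rewrite (nth_default _ (leq_trans sq _)); last first.
    by rewrite -[n.+1]add1n leq_add2r (leq_trans _ size_q).
  rewrite (nth_default _ (leq_trans spp _)); last first.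
    by rewrite -addnS leq_add // ltnW.
  rewrite (nth_default _ (leq_trans spq _)); last first.
    by rewrite -addSn leq_add2r.
  rewrite !mulr0 !add0r => /esym/eqP; rewrite mulf_eq0 (negbTE C0) /=.
  by rewrite mulf_eq0 orbb.
have B0 : B = 0.
  apply/eqP; apply: contraNT qn => B0.
  have := congr1 (fun s : {poly K} => s`_(m.+1 + n)) rel.
  rewrite C0 mul0r scale0r addr0.
  rewrite !coefD !coefZ !expr2 pq (nth_default _ (leq_trans sp _)); last first.
    by rewrite (leq_trans size_q) // leq_addl.
  rewrite (nth_default _ (leq_trans sq _)); last by rewrite addSn ltnS leq_addl.
  rewrite (nth_default _ (leq_trans spp _)); last by rewrite -addnS leq_add2l.
  rewrite !mulr0 !add0r => /esym/eqP.
  by rewrite !mulf_eq0 (negbTE B0) (negbTE pm).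
split=> // /half_neq0 A0; apply: contraNneq pm => b0.
move: rel; rewrite B0 C0 b0 mul0r !scale0r !addr0 => rel.
have := congr1 (fun s : {poly K} => s`_(m.+1 + m.+1)) rel.
rewrite !coefZ !expr2 pp nth_default; last by rewrite Em addSn ltnS leq_addl.
rewrite mulr0 => /esym/eqP; rewrite mulf_eq0 (negbTE A0) /=.
by rewrite mulf_eq0 orbb.
Qed.

(** The conic through the curve [(p, q)] meets the line at infinity in one point
    only, and is a parabola: the quadratic part of its equation is a multiple of
    the square of a linear form, not proportional to the linear part. By
    [conic_lt] this is so for polynomials of different degrees, and subtracting
    a multiple of [p] from [q] reduces to this case. *)
Lemma polynomial_conic p q (a b A B C : K) :
  p.[0] = 0 -> q.[0] = 0 ->
  (forall k1 k2 : K, k1 *: p + k2 *: q = 0 -> k1 = 0 /\ k2 = 0) ->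
  a *: p + b *: q = (A / 2%:R) *: p ^+ 2 + B *: (p * q) + (C / 2%:R) *: q ^+ 2 ->
  [|| A != 0, B != 0 | C != 0] ->
  exists e r s : K, [/\ e != 0, A = e * r ^+ 2, B = e * (r * s), C = e * s ^+ 2
    & r * b - s * a != 0].
Proof.
move=> p0 q0 indep rel ABC.
have p_neq0 : p != 0.
  apply/eqP => p_eq0; have [|/eqP] := indep 1 0; last by rewrite oner_eq0.
  by rewrite p_eq0 scaler0 scale0r addr0.
have [lt_pq|le_qp] := ltnP (size p) (size q).
  have [B0 C0 Ab] := conic_lt (size_gt1 p_neq0 p0) lt_pq rel.
  have A0 : A != 0 by move: ABC; rewrite B0 C0 eqxx !orbF.
  exists A, 1, 0; rewrite B0 C0 expr1n expr0n !mulr1 !mulr0 mul0r mul1r subr0.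
  by split=> //; apply: Ab.
pose k := q`_(size p).-1 / lead_coef p; pose r := q - k *: p.
have rE : q = r + k *: p by rewrite subrK.
have r_neq0 : r != 0.
  apply/eqP => r_eq0; have [|_ /eqP] := indep (- k) 1; last by rewrite oner_eq0.
  by rewrite scale1r scaleNr addrC.
have r0 : r.[0] = 0 by rewrite /r hornerD hornerN hornerZ p0 q0 mulr0 subrr.
have lt_rp : (size r < size p)%N.
  have sp : (0 < size p)%N by rewrite size_poly_gt0.
  rewrite -(prednK sp) ltnS; apply/leq_sizeP => j.
  rewrite leq_eqVlt => /orP[/eqP <-|lt_j].
    by rewrite coefB coefZ mulfVK ?lead_coef_eq0 // subrr.
  have le_j : (size p <= j)%N by rewrite -(prednK sp).
  rewrite coefB coefZ !nth_default ?mulr0 ?subrr //.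
  exact: leq_trans le_j.
have rel' : b *: r + (a + b * k) *: p = (C / 2%:R) *: r ^+ 2
    + (B + C * k) *: (r * p)
    + ((A + 2%:R * B * k + C * k ^+ 2) / 2%:R) *: p ^+ 2.
  move: rel; rewrite rE -!mul_polyC !(polyCM, polyCD) => rel.
  apply: conic_shift rel _ _; last by rewrite polyC1.
  by rewrite -polyCD -polyCM mulVf.
have [BCk ACk Cb] := conic_lt (size_gt1 r_neq0 r0) lt_rp rel'.
have BE : B = - (C * k) by apply/eqP; rewrite -addr_eq0 BCk.
have AE : A = C * k ^+ 2.
  move/eqP: ACk; rewrite BE => /eqP AE; apply/eqP; rewrite -subr_eq0 -AE.
  by apply/eqP; ring.
have C0 : C != 0.
  by apply: contraTneq ABC => C0; rewrite AE BE C0 !mul0r oppr0 eqxx.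
exists C, (- k), 1; split=> //; try by rewrite ?AE ?BE; ring.
rewrite mul1r mulNr -opprD oppr_eq0 addrC mulrC; exact: Cb.
Qed.

End Conic.

(** * The remaining component *)

Fact coef_relation (R : comNzRingType) (p q : {poly R}) s t j :
  p * s%:P + q * t%:P = 0 -> p`_j * s + q`_j * t = 0.
Proof. by move/(congr1 (coefp j)); rewrite /= coefD !coefMC coef0. Qed.

Section IsolateY.
Variable K : fieldType.
Hypothesis charK : char_zero K.

Definition isolate_y : {mpoly K[3]} -> {poly {mpoly K[3]}} :=
  mmap (@polyC _ \o @mpolyC 3 K) (tri (X)%:P 'X (Z)%:P).
HB.instance Definition _ := GRing.RMorphism.on isolate_y.

Lemma isolate_y_const s : s^`M(iy) = 0 -> isolate_y s = s%:P.
Proof.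
move=> sy; rewrite /isolate_y /mmap [in RHS](mpolyE s) rmorph_sum /=.
apply: eq_big_seq => m ms; rewrite -mul_mpolyC polyCM; congr (_ * _).
have my : m iy = 0%N.
  apply/eqP; apply: contraLR ms => mi.
  by rewrite -mcoeff_eq0 (mderiv_eq0_coeff charK sy mi).
have -> : 'X_[m] = X ^+ m ix * Z ^+ m iz :> {mpoly K[3]}.
  by rewrite mpolyXE_id big_ord3 /= my expr0 mul1r.
rewrite /mmap1 big_ord3 /= !triE my expr0 mul1r.
by rewrite rmorphM /= !rmorphXn.
Qed.

Lemma isolate_y_poly_at (P : {poly K}) :
  isolate_y (poly_at P Y) = map_poly (@mpolyC 3 K) P.
Proof.
have yX : isolate_y Y = 'X by rewrite /isolate_y mmapX mmap1U triE.
rewrite /poly_at -horner_map /= yX -map_poly_comp.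
elim/poly_ind: P => [|p a IH]; first by rewrite !rmorph0 horner0.
rewrite !rmorphD !rmorphM /= !map_polyX !map_polyC !hornerE /= IH.
by rewrite /isolate_y mmapC.
Qed.

Lemma poly_at_y_inj (P : {poly K}) : poly_at P Y = 0 -> P = 0.
Proof.
move=> P0; have := isolate_y_poly_at P; rewrite P0 rmorph0 => /esym P0'.
apply/polyP => i; apply/eqP; rewrite coef0 -(@mpolyC_eq0 3) -coef_map /=.
by rewrite P0' coef0.
Qed.

(** The coefficients of [s] and [t] at a given monomial form a linear relation
    between [p] and [q]. *)
Lemma y_relation (p q : {poly K}) s t :
  (forall k1 k2 : K, k1 *: p + k2 *: q = 0 -> k1 = 0 /\ k2 = 0) ->
  s^`M(iy) = 0 -> t^`M(iy) = 0 ->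
  poly_at p Y * s + poly_at q Y * t = 0 -> s = 0 /\ t = 0.
Proof.
move=> indep sy ty rel.
have st m : s@_m = 0 /\ t@_m = 0.
  apply: indep; apply/polyP => j; rewrite coef0.
  have E1 : map_poly (@mpolyC 3 K) p * s%:P + map_poly (@mpolyC 3 K) q * t%:P = 0.
    have := congr1 isolate_y rel; rewrite rmorphD !rmorphM /= !isolate_y_poly_at.
    by rewrite !isolate_y_const ?mderiv0 // polyC0.
  have := coef_relation j E1; rewrite !coef_map /=.
  move/(congr1 (mcoeff m)); rewrite mcoeffD !mcoeffCM mcoeff0 => E2.
  by rewrite coefD !coefZ -[RHS]E2; congr (_ + _); rewrite mulrC.
by split; apply/mpolyP => m; rewrite mcoeff0; case: (st m).
Qed.

End IsolateY.

Section ThirdComponent.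
Variables (K : fieldType) (g : {mpoly K[3]}) (p q : {poly K}) (A B C C1 C2 : K).
Hypothesis charK : char_zero K.
Local Notation a := (quad A B C C1 C2).
Local Notation ax := (affine C1 A B).
Local Notation az := (affine C2 B C).
Let u : {mpoly K[3]} := Y + a.
Let f := poly_at p u.
Let h := poly_at q u.
Hypothesis trace1 : f^`M(ix) + g^`M(iy) + h^`M(iz) = 0.
Hypothesis trace2 :
  g^`M(iy) * (f^`M(ix) + h^`M(iz)) = f^`M(iy) * g^`M(ix) + h^`M(iy) * g^`M(iz).
Hypothesis p00 : p.[0] = 0.
Hypothesis q00 : q.[0] = 0.
Hypothesis g00 : g.@[fun=> 0] = 0.
Hypothesis indep : forall k1 k2 : K, k1 *: p + k2 *: q = 0 -> k1 = 0 /\ k2 = 0.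

Let b := g + f * ax + h * az.

Let quad_der := quad_mderiv charK A B C C1 C2.

Let u_der : [/\ u^`M(ix) = ax, u^`M(iy) = 1 & u^`M(iz) = az].
Proof.
have [dx dy dz] := quad_der; rewrite /u !(mderivD _ Y) dx dy dz !mderivXU eqxx !idx3_eq.
by rewrite mulr0n mulr1n !add0r addr0.
Qed.

Lemma b_der_y : b^`M(iy) = 0.
Proof.
have [ux uy uz] := u_der; have [_ axy _] := affine_mderiv C1 A B.
have [_ azy _] := affine_mderiv C2 B C.
rewrite /b !mderivD !mderivM axy azy !poly_at_mderiv uy !mulr0 !addr0 !mulr1.
rewrite -[RHS]trace1 !poly_at_mderiv ux uz; ring.
Qed.

(** This is the second trace condition, after the first one is used to
    eliminate [g_y]. *)
Lemma b_relation : poly_at p^`() u * b^`M(ix) + poly_at q^`() u * b^`M(iz) =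
  poly_at (p^`() * (A *: p + B *: q) + q^`() * (B *: p + C *: q)) u.
Proof.
have [ux uy uz] := u_der; have [axx _ axz] := affine_mderiv C1 A B.
have [azx _ azz] := affine_mderiv C2 B C.
have poly_atE (k1 k2 : K) : poly_at (k1 *: p + k2 *: q) u = k1%:MP * f + k2%:MP * h.
  by rewrite poly_atD !poly_atZ -!mul_mpolyC.
have -> : poly_at (p^`() * (A *: p + B *: q) + q^`() * (B *: p + C *: q)) u =
    poly_at p^`() u * (A%:MP * f + B%:MP * h)
    + poly_at q^`() u * (B%:MP * f + C%:MP * h).
  by rewrite -!poly_atE poly_atD !poly_atM.
have fx : f^`M(ix) = poly_at p^`() u * ax by rewrite poly_at_mderiv ux.
have fy : f^`M(iy) = poly_at p^`() u by rewrite poly_at_mderiv uy mulr1.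
have fz : f^`M(iz) = poly_at p^`() u * az by rewrite poly_at_mderiv uz.
have hx : h^`M(ix) = poly_at q^`() u * ax by rewrite poly_at_mderiv ux.
have hy : h^`M(iy) = poly_at q^`() u by rewrite poly_at_mderiv uy mulr1.
have hz : h^`M(iz) = poly_at q^`() u * az by rewrite poly_at_mderiv uz.
have gy : g^`M(iy) = - (poly_at p^`() u * ax + poly_at q^`() u * az).
  apply/eqP; rewrite -addr_eq0 -fx -hz addrA [g^`M(iy) + _]addrC.
  by apply/eqP; exact: trace1.
rewrite /b !mderivD !mderivM axx axz azx azz fx fz hx hz.
have := trace2; rewrite gy fx hz fy hy.
move: (poly_at p^`() u) (poly_at q^`() u) (g^`M(ix)) (g^`M(iz)) f h ax az.
move: A%:MP B%:MP C%:MP => A' B' C' p' q' gx gz f' h' a1 a2 rel.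
transitivity (p' * gx + q' * gz + (p' * a1 + q' * a2) ^+ 2
  + p' * (A' * f' + B' * h') + q' * (B' * f' + C' * h')); first by ring.
by rewrite -rel; ring.
Qed.

Lemma deriv_indep (k1 k2 : K) : k1 *: p^`() + k2 *: q^`() = 0 -> k1 = 0 /\ k2 = 0.
Proof.
rewrite -!derivZ -derivD => /(deriv_eq0_const charK) E1; apply: indep.
by rewrite E1 -horner_coef0 hornerD !hornerZ p00 q00 !mulr0 addr0.
Qed.

(** After the shear that turns [u] into Y, the polynomial [b] depends on x and z
    only. By [b_relation] its gradient satisfies a relation whose coefficients
    depend on Y only; differentiating it in x and z shows that the second
    derivatives of [b] vanish, so [b] is linear. The relation is then the
    derivative of the equation of the conic. *)
Lemma third_component : exists k1 k2 : K,
  g = k1 *: X + k2 *: Z - f * ax - h * az /\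
  k1 *: p + k2 *: q = (A / 2%:R) *: p ^+ 2 + B *: (p * q) + (C / 2%:R) *: q ^+ 2.
Proof.
have two0 : 2%:R != 0 :> K by apply: charK.
have [dx dy dz] := quad_der.
pose T := comp_mpoly (shear (- 1 *: a)).
have TK : cancel T (comp_mpoly (shear a)).
  have := shearK A B C C1 C2 (- 1); rewrite -/T.
  by rewrite [- - 1](opprK 1) scale1r.
have Tu : T u = Y.
  rewrite /u /T rmorphD /= quad_shear comp_mpolyXU -tnth_nth tnth_mktuple triE.
  by rewrite scaleN1r subrK.
pose w := T b.
have Tb : [/\ w^`M(ix) = T b^`M(ix), w^`M(iy) = 0 & w^`M(iz) = T b^`M(iz)].
  have sy : (- 1 *: a)^`M(iy) = 0 by rewrite mderivZ dy scaler0.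
  have [Ex Ey Ez] := shear_mderiv b sy; split.
  - by rewrite [LHS]Ex b_der_y rmorph0 mul0r addr0.
  - by rewrite [LHS]Ey b_der_y rmorph0.
  - by rewrite [LHS]Ez b_der_y rmorph0 mul0r addr0.
have [wx wy wz] := Tb; pose S := p^`() * (A *: p + B *: q) + q^`() * (B *: p + C *: q).
have rel : poly_at p^`() Y * w^`M(ix) + poly_at q^`() Y * w^`M(iz) = poly_at S Y.
  have Tp P : T (poly_at P u) = poly_at P Y by rewrite -Tu; exact: poly_at_comp.
  have TD r s : T (r + s) = T r + T s by exact: rmorphD.
  have TM r s : T (r * s) = T r * T s by exact: rmorphM.
  by have := congr1 T b_relation; rewrite TD !TM !Tp wx wz.
have wy0 i : w^`M(i)^`M(iy) = 0 by rewrite mderiv_comm wy mderiv0.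
have w2 i : i != iy -> w^`M(ix)^`M(i) = 0 /\ w^`M(iz)^`M(i) = 0.
  move=> i_y; apply: (y_relation charK deriv_indep).
  - by rewrite mderiv_comm wy0 mderiv0.
  - by rewrite mderiv_comm wy0 mderiv0.
  have := congr1 (mderiv i) rel; rewrite mderivD !mderivM !poly_at_mderiv.
  by rewrite mderivXU eq_sym (negbTE i_y) mulr0n !mulr0 !mul0r !add0r.
have [x_y z_y] : ix != iy /\ iz != iy by rewrite !idx3_eq.
have [wxx wzx] := w2 _ x_y; have [wxz wzz] := w2 _ z_y.
have wxC : w^`M(ix) = (w^`M(ix)@_0)%:MP by apply: (mderivs_eq0 charK); apply: ord3P.
have wzC : w^`M(iz) = (w^`M(iz)@_0)%:MP by apply: (mderivs_eq0 charK); apply: ord3P.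
set k1 := w^`M(ix)@_0 in wxC; set k2 := w^`M(iz)@_0 in wzC.
exists k1, k2; split; last first.
  have ES : k1 *: p^`() + k2 *: q^`() = S.
    apply/eqP; rewrite -subr_eq0; apply/eqP; apply: poly_at_y_inj.
    rewrite -scaleN1r !poly_atD !poly_atZ -rel wxC wzC -!mul_mpolyC; ring.
  apply/eqP; rewrite -subr_eq0; apply/eqP; set D := _ - _.
  have D0 : D.[0] = 0.
    rewrite /D !(hornerD, hornerN, hornerZ, hornerM, horner_exp) p00 q00.
    by rewrite !(mulr0, addr0) subr0.
  have dD : D^`() = 0.
    rewrite /D derivB !derivD !derivZ !expr2 !derivM ES /S -!mul_polyC.
    have half2 (e : K) : e%:P = (e / 2%:R)%:P + (e / 2%:R)%:P :> {poly K}.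
      by rewrite -polyCD -mulr2n -[(e / _) *+ 2]mulr_natr mulfVK.
    by rewrite (half2 A) (half2 C); ring.
  by rewrite (deriv_eq0_const charK dD) -horner_coef0 D0.
have [k Ew] : exists k : K, w = k1 *: X + k2 *: Z + k%:MP.
  exists (w - (k1 *: X + k2 *: Z))@_0; apply/eqP; rewrite addrC -subr_eq; apply/eqP.
  apply: (mderivs_eq0 charK); apply: ord3P; rewrite mderivB mderivD !mderivZ
    !mderivXU ?eqxx ?idx3_eq ?wxC ?wy ?wzC ?mulr0n ?mulr1n -!mul_mpolyC; ring.
have Eb : b = k1 *: X + k2 *: Z + k%:MP.
  rewrite -[b]TK -/w Ew !rmorphD /= !linearZ /= comp_mpolyC !comp_mpolyXU.
  by rewrite -!tnth_nth !tnth_mktuple !triE.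
have k0 : k = 0.
  have := congr1 (meval (fun=> 0)) Eb.
  have u0 : u.@[fun=> 0] = 0 by rewrite mevalD mevalXU quad_at0 addr0.
  rewrite /b !mevalD !mevalM g00 /f /h !poly_at_meval u0 p00 q00 !mevalZ.
  by rewrite !mevalXU mevalC !(mul0r, mulr0, addr0, add0r).
have -> : g = b - f * ax - h * az by rewrite /b; ring.
by rewrite Eb k0 mpolyC0 addr0.
Qed.

End ThirdComponent.

(** * Nilpotent matrices *)

(** The characteristic polynomial divides a power of X, whence it is a power of
    X; its second coefficient is the opposite of the trace. *)
Lemma nilpotent_trace (F : fieldType) n (A : 'M[F]_n) : nilpotent_mx A -> \tr A = 0.
Proof.
case: n A => [|n] A; first by rewrite /mxtrace big_ord0.
case=> k Ak; pose N := map_mx (@polyC F) A; pose x := ('X : {poly F})%:M : 'M_n.+1.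
have Nk : N ^+ k = 0 by rewrite -rmorphXn /= Ak map_mx0.
have xN : GRing.comm x N by rewrite /GRing.comm -!mulmxE scalar_mxC.
have charA : char_poly A %| ('X - 0%:P) ^+ (n.+1 * k).
  have xk : x ^+ k = ('X ^+ k)%:M.
    elim: k {Ak Nk} => [|k IH]; first by rewrite !expr0.
    by rewrite !exprS IH -mulmxE -scalar_mxM.
  have := subrXX_comm k xN; rewrite Nk subr0 xk => /(congr1 determinant).
  rewrite det_scalar -mulmxE det_mulmx polyC0 subr0 mulnC exprM => ->.
  exact: dvdp_mulr.
have [j _ charA'] := dvdp_exp_XsubCP charA.
have charAE : char_poly A = ('X - 0%:P) ^+ j.
  by apply/eqP; rewrite -eqp_monic ?monic_exp ?monicXsubC ?char_poly_monic.
have := @char_poly_trace _ _ A isT; rewrite /= charAE polyC0 subr0 coefXn.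
have := size_char_poly A; rewrite charAE size_exp_XsubC => -[->].
by rewrite (ltn_eqF (ltnSn n)) => /esym/eqP; rewrite oppr_eq0 => /eqP.
Qed.

Lemma nilpotent_mxM (R : pzRingType) n (A : 'M[R]_n) :
  nilpotent_mx A -> nilpotent_mx (A * A).
Proof.
by case=> k Ak; exists k; rewrite exprMn_comm // Ak mulr0.
Qed.

Lemma nilpotent_trace_domain (R : idomainType) n (A : 'M[R]_n) :
  nilpotent_mx A -> \tr A = 0 /\ \tr (A *m A) = 0.
Proof.
pose c : {rmorphism R -> {fraction R}} := @FracField.tofrac R.
have cI : injective c by move=> a b /eqP; rewrite tofrac_eq => /eqP.
have key (B : 'M[R]_n) : nilpotent_mx B -> \tr B = 0.
  case=> k Bk; apply: cI; rewrite -trace_map_mx rmorph0.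
  apply: nilpotent_trace; exists k; case: n B Bk {A} => [|n] B Bk.
    by apply/matrixP => -[].
  by rewrite -rmorphXn /= Bk map_mx0.
by move=> nA; split; apply: key => //; exact: nilpotent_mxM.
Qed.

(** * Linear conjugation *)

Section LinearConjugation.
Variables (K : fieldType) (n : nat).
Implicit Types (T S : 'M[K]_n) (H : polymap K n n).

Lemma lin_subst_rmorph T :
  {u : {rmorphism {mpoly K[n]} -> {mpoly K[n]}} | u =1 lin_subst T}.
Proof. by exists (comp_mpoly [tuple \sum_j T i j *: 'X_j | i < n]). Qed.

Lemma lin_substC T a : lin_subst T a%:MP = a%:MP.
Proof. exact: comp_mpolyC. Qed.

Lemma lin_substX T i : lin_subst T 'X_i = \sum_j T i j *: 'X_j.
Proof. by rewrite /lin_subst comp_mpolyXU -tnth_nth tnth_mktuple. Qed.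

Lemma lin_subst_comp T S p : lin_subst T (lin_subst S p) = lin_subst (S *m T) p.
Proof.
have [u Eu] := lin_subst_rmorph T; have [v Ev] := lin_subst_rmorph S.
have [w Ew] := lin_subst_rmorph (S *m T).
rewrite -Eu -Ev -Ew; move: p.
apply: (mpoly_rmorph_ext (f := u \o v) (g := w)) => [a|i] /=.
  by rewrite Eu Ev Ew !lin_substC.
rewrite Ev Ew lin_substX lin_substX rmorph_sum /=.
transitivity (\sum_j \sum_l (S i j * T j l) *: ('X_l : {mpoly K[n]})).
  apply: eq_bigr => j _; rewrite -mul_mpolyC rmorphM /= !Eu lin_substC lin_substX.
  by rewrite mul_mpolyC scaler_sumr; apply: eq_bigr => l _; rewrite scalerA.
by rewrite exchange_big; apply: eq_bigr => l _; rewrite mxE -scaler_suml.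
Qed.

Lemma lin_subst1 (p : {mpoly K[n]}) : lin_subst 1%:M p = p.
Proof.
rewrite /lin_subst -[RHS]comp_mpoly_id; congr (_ \mPo _); apply: eq_from_tnth => i.
rewrite !tnth_mktuple (bigD1 i) //= mxE eqxx scale1r big1 ?addr0 // => j ji.
by rewrite mxE eq_sym (negbTE ji) scale0r.
Qed.

Lemma lin_substK T : T \in unitmx -> cancel (lin_subst T) (lin_subst (invmx T)).
Proof. by move=> uT p; rewrite lin_subst_comp mulmxV // lin_subst1. Qed.

Lemma map_lin_substM T m k l (A : 'M_(m, k)) (B : 'M_(k, l)) :
  map_mx (lin_subst T) (A *m B) = map_mx (lin_subst T) A *m map_mx (lin_subst T) B.
Proof.
have [u Eu] := lin_subst_rmorph T.
have Em m' n' (D : 'M_(m', n')) : map_mx (lin_subst T) D = map_mx u D.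
  by apply/matrixP => i j; rewrite !mxE Eu.
by rewrite !Em map_mxM.
Qed.

Lemma map_lin_substC T m k (A : 'M_(m, k)) :
  map_mx (lin_subst T) (map_mx (@mpolyC n K) A) = map_mx (@mpolyC n K) A.
Proof. by apply/matrixP => i j; rewrite !mxE lin_substC. Qed.

Lemma lin_conjM T S H : T \in unitmx -> S \in unitmx ->
  lin_conj (T *m S) H = lin_conj T (lin_conj S H).
Proof.
move=> uT uS; rewrite /lin_conj map_lin_substM map_lin_substC mulmxA -map_mxM.
congr (_ *m _); apply/matrixP => i j; rewrite !mxE lin_subst_comp.
congr (lin_subst _ _); have uTS : T *m S \in unitmx by rewrite unitmx_mul uT.
apply: (can_inj (mulKmx uTS)).
by rewrite mulmxV // -mulmxA mulKVmx // mulmxV.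
Qed.

Lemma lin_conj_eq T H N : T \in unitmx ->
  map_mx (@mpolyC n K) T *m H = map_mx (lin_subst T) N -> lin_conj T H = N.
Proof.
move=> uT TH; rewrite /lin_conj -(map_lin_substC (invmx T)) -map_lin_substM TH.
by apply/matrixP => i j; rewrite !mxE lin_substK.
Qed.

Lemma linformE m (l : 'rV[K]_m) (H : polymap K n m) :
  linform l H = (map_mx (@mpolyC n K) l *m H) 0 0.
Proof.
by rewrite mxE; apply: eq_bigr => j _; rewrite mxE mul_mpolyC.
Qed.

Lemma linform_lin_conj T H l :
  linform l (lin_conj T H) = lin_subst (invmx T) (linform (l *m T) H).
Proof.
rewrite !linformE /lin_conj mulmxA -map_mxM.
transitivity (map_mx (lin_subst (invmx T))
    (map_mx (@mpolyC n K) (l *m T) *m H) 0 0); last by rewrite mxE.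
by rewrite map_lin_substM map_lin_substC.
Qed.

Lemma lin_conj_indep T H : T \in unitmx ->
  components_lin_indep H -> components_lin_indep (lin_conj T H).
Proof.
move=> uT indep l; rewrite linform_lin_conj => /(congr1 (lin_subst T)).
have uT' : invmx T \in unitmx by rewrite unitmx_inv.
have := lin_substK uT' (linform (l *m T) H); rewrite invmxK => ->.
have -> : lin_subst T 0 = 0 by rewrite /lin_subst comp_mpoly0.
by move/indep/(congr1 (mulmx^~ (invmx T))); rewrite mulmxK // mul0mx.
Qed.

Lemma lin_conj_at0 T H : polymap_at H 0 = 0 -> polymap_at (lin_conj T H) 0 = 0.
Proof.
move=> H0; have subst0 (p : {mpoly K[n]}) :
    (lin_subst (invmx T) p).@[fun=> 0] = p.@[fun=> 0].
  rewrite /lin_subst comp_mpoly_meval; apply: meval_eq => i.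
  rewrite tnth_mktuple rmorph_sum big1 //= => j _.
  by rewrite mevalZ mevalXU mulr0.
have at0 (p : {mpoly K[n]}) : p.@[fun j => (0 : 'cV[K]_n) j 0] = p.@[fun=> 0].
  by apply: meval_eq => j; rewrite mxE.
apply/colP => i; rewrite !mxE at0 rmorph_sum big1 //= => j _.
rewrite !mxE mevalM subst0 -at0; move/colP: H0 => /(_ j); rewrite !mxE => ->.
by rewrite mulr0.
Qed.

Lemma jacobian_lin_conj T H : jacobian (lin_conj T H) =
  map_mx (@mpolyC n K) T *m map_mx (lin_subst (invmx T)) (jacobian H)
  *m map_mx (@mpolyC n K) (invmx T).
Proof.
apply/matrixP => i j; rewrite !mxE raddf_sum /=.
transitivity (\sum_l \sum_m (T i l)%:MP
    * (lin_subst (invmx T) (H l 0)^`M(m) * (invmx T m j)%:MP)).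
  apply: eq_bigr => l _; rewrite !mxE mderivM mderivC mul0r add0r -mulr_sumr.
  congr (_ * _); rewrite /lin_subst comp_mpoly_chain; apply: eq_bigr => m _.
  congr (_ * _); rewrite tnth_mktuple raddf_sum (bigD1 j) //= mderivZ mderivXU eqxx.
  rewrite -mul_mpolyC mulr1 big1 ?addr0 // => k kj.
  by rewrite mderivZ mderivXU (negbTE kj) scaler0.
rewrite exchange_big; apply: eq_bigr => m _; rewrite !mxE mulr_suml.
by apply: eq_bigr => l _; rewrite !mxE mulrA.
Qed.

Lemma lin_conj_traces T H : T \in unitmx -> nilpotent_mx (jacobian H) ->
  \tr (jacobian (lin_conj T H)) = 0 /\
  \tr (jacobian (lin_conj T H) *m jacobian (lin_conj T H)) = 0.
Proof.
move=> uT /nilpotent_trace_domain [tr1 tr2]; rewrite jacobian_lin_conj.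
set Tm := map_mx _ T; set Ti := map_mx _ (invmx T); set J := map_mx _ (jacobian H).
have TiT : Ti *m Tm = 1%:M by rewrite -map_mxM mulVmx // map_mx1.
have tr_conj M : \tr (Tm *m M *m Ti) = \tr M by rewrite mxtrace_mulC mulmxA TiT mul1mx.
have tr_subst M : \tr (map_mx (lin_subst (invmx T)) M) = lin_subst (invmx T) (\tr M).
  have [u Eu] := lin_subst_rmorph (invmx T).
  rewrite -Eu /mxtrace rmorph_sum; apply: eq_bigr => i _.
  by rewrite mxE Eu.
have subst0 : lin_subst (invmx T) 0 = 0 :> {mpoly K[n]} by apply: comp_mpoly0.
have -> : Tm *m J *m Ti *m (Tm *m J *m Ti) = Tm *m (J *m J) *m Ti.
  by rewrite !mulmxA -[_ *m Ti *m Tm]mulmxA TiT mulmx1.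
by rewrite !tr_conj /J -map_lin_substM !tr_subst tr1 tr2 subst0.
Qed.

End LinearConjugation.

(** * Normal form *)

Fact complete_square (S : comNzRingType) (e r s x z h : S) : h * 2%:R = 1 ->
  e * h * (r * x + s * z) ^+ 2 = e * (r * r) * h * x ^+ 2 + e * (r * s) * (x * z)
    + e * (s * s) * h * z ^+ 2.
Proof.
move=> h2; rewrite -[e * (r * s)]mulr1 -h2; ring.
Qed.

Fact conj_y_identity (S : comNzRingType) (t e r s b1 b2 C1 C2 x z F G : S) :
  t * e = 2%:R ->
  t * C1 * F + (t * (b1 * x + b2 * z - F * (C1 + e * (r * r) * x + e * (r * s) * z)
    - G * (C2 + e * (r * s) * x + e * (s * s) * z)) + t * C2 * G) =
  t * (b1 * x + b2 * z) - 2%:R * (r * x + s * z) * (r * F + s * G).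
Proof. by move=> <-; ring. Qed.

Lemma N_mapE (K : fieldType) (P : {poly K}) :
  [/\ N_map P ix 0 = poly_at P (Y + X ^+ 2),
      N_map P iy 0 = Z - 2%:R * X * poly_at P (Y + X ^+ 2)
    & N_map P iz 0 = poly_at P (Y + X ^+ 2) ^+ 2].
Proof. by rewrite /N_map !mxE !inordK. Qed.

Section NormalForm.
Variables (K : fieldType) (charK : char_zero K).
Variables (p q : {poly K}) (e r s b1 b2 C1 C2 : K).
Hypotheses (e0 : e != 0) (rs : r * b2 - s * b1 != 0).
Let A := e * r ^+ 2.
Let B := e * (r * s).
Let C := e * s ^+ 2.
Let u : {mpoly K[3]} := Y + quad A B C C1 C2.
Hypothesis conic :
  b1 *: p + b2 *: q = (A / 2%:R) *: p ^+ 2 + B *: (p * q) + (C / 2%:R) *: q ^+ 2.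

(** The coordinates x' = r x + s z, y' = (2/e) (y + C1 x + C2 z) and
    z' = (2/e) (b1 x + b2 z), in which [u] is (e/2) (y' + x'^2). *)
Definition straight_mx : 'M[K]_3 :=
  \matrix_(i, j) tri (tri r 0 s)
    (tri (2%:R / e * C1) (2%:R / e) (2%:R / e * C2))
    (tri (2%:R / e * b1) 0 (2%:R / e * b2)) i j.

Definition profile : {poly K} := (r *: p + s *: q) \Po ((e / 2%:R) *: 'X).

Let two0 : 2%:R != 0 :> K. Proof. exact: charK. Qed.

Lemma straight_mx_unit : straight_mx \in unitmx.
Proof.
rewrite -row_free_unit -kermx_eq0; apply/rowV0P => v /sub_kermxP vT.
have vE j : (v *m straight_mx) 0 j = 0 by rewrite vT mxE.
have := vE ix; have := vE iy; have := vE iz.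
rewrite ![(_ *m _) _ _]mxE !big_ord3 /= ![straight_mx _ _]mxE !triE.
have te : 2%:R / e != 0 by rewrite mulf_neq0 ?invr_neq0.
rewrite !mulr0 add0r addr0 => Ez /eqP; rewrite mulf_eq0 (negbTE te) orbF => /eqP vy.
move: Ez; rewrite vy !mul0r !add0r => Ez Ex.
have vx0 : v 0 ix * (r * b2 - s * b1) = 0.
  transitivity ((v 0 ix * r + v 0 iz * (2%:R / e * b1)) * b2
     - (v 0 ix * s + v 0 iz * (2%:R / e * b2)) * b1); first by ring.
  by rewrite Ex Ez !mul0r subrr.
have vz0 : v 0 iz * (2%:R / e) * (r * b2 - s * b1) = 0.
  transitivity ((v 0 ix * s + v 0 iz * (2%:R / e * b2)) * r
     - (v 0 ix * r + v 0 iz * (2%:R / e * b1)) * s); first by ring.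
  by rewrite Ex Ez !mul0r subrr.
apply/rowP; apply: ord3P; rewrite !mxE //; apply/eqP.
  by move/eqP: vx0; rewrite mulf_eq0 (negbTE rs) orbF.
by move/eqP: vz0; rewrite mulf_eq0 (negbTE rs) orbF mulf_eq0 (negbTE te) orbF.
Qed.

Lemma profile_at v : poly_at profile v =
  r *: poly_at p ((e / 2%:R) *: v) + s *: poly_at q ((e / 2%:R) *: v)
  :> {mpoly K[3]}.
Proof.
rewrite -!poly_atZ -poly_atD /profile /poly_at map_comp_poly horner_comp.
by rewrite map_polyZ /= map_polyX hornerZ hornerX mul_mpolyC.
Qed.

Let x' : {mpoly K[3]} := r *: X + s *: Z.
Let y' : {mpoly K[3]} := (2%:R / e) *: (Y + C1 *: X + C2 *: Z).
Let z' : {mpoly K[3]} := (2%:R / e) *: (b1 *: X + b2 *: Z).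

Lemma straight_u : (e / 2%:R) *: (y' + x' ^+ 2) = u.
Proof.
rewrite scalerDr scalerA (_ : e / 2%:R * (2%:R / e) = 1); last first.
  by field; rewrite two0 e0.
rewrite scale1r /u /quad /x' /A /B /C -!mul_mpolyC !mpolyCM.
have h2 : (2%:R^-1 : K)%:MP * 2%:R = 1 :> {mpoly K[3]}.
  by rewrite -(rmorph_nat (@mpolyC 3 K)) -mpolyCM mulVf.
by rewrite (complete_square _ _ _ _ _ h2) ?mpolyCM; ring.
Qed.

Lemma straight_conj (g : {mpoly K[3]}) (H : polymap K 3 3) :
  g = b1 *: X + b2 *: Z - poly_at p u * affine C1 A B - poly_at q u * affine C2 B C ->
  H ix 0 = poly_at p u -> H iy 0 = g -> H iz 0 = poly_at q u ->
  lin_conj straight_mx H = N_map profile.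
Proof.
move=> gE Hx Hy Hz; apply: (lin_conj_eq straight_mx_unit).
have subX i : lin_subst straight_mx 'X_i = tri x' y' z' i.
  rewrite lin_substX big_ord3 /= !mxE; move: i; apply: ord3P; rewrite !triE.
  - by rewrite scale0r add0r.
  - rewrite /y' !scalerDr !scalerA; ring.
  - by rewrite scale0r add0r /z' scalerDr !scalerA.
have sub_profile : lin_subst straight_mx (poly_at profile (Y + X ^+ 2)) =
    r *: poly_at p u + s *: poly_at q u.
  have [T ET] := lin_subst_rmorph straight_mx.
  have -> : lin_subst straight_mx (poly_at profile (Y + X ^+ 2)) =
      poly_at profile (lin_subst straight_mx (Y + X ^+ 2)) by apply: poly_at_comp.
  by rewrite -ET rmorphD rmorphXn /= !ET !subX !triE profile_at straight_u.
have poly_conic : b1%:MP * poly_at p u + b2%:MP * poly_at q u =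
    (e / 2%:R)%:MP * (r%:MP * poly_at p u + s%:MP * poly_at q u) ^+ 2.
  have := congr1 (fun P => poly_at P u) conic.
  rewrite /A /B /C !expr2 !poly_atD !poly_atZ !poly_atM -!mul_mpolyC !mpolyCM => ->.
  have h2 : (2%:R^-1 : K)%:MP * 2%:R = 1 :> {mpoly K[3]}.
    by rewrite -(rmorph_nat (@mpolyC 3 K)) -mpolyCM mulVf.
  by rewrite -expr2 (complete_square _ _ _ _ _ h2); ring.
have te : (2%:R / e)%:MP * e%:MP = 2%:R :> {mpoly K[3]}.
  by rewrite -mpolyCM mulfVK // rmorph_nat.
have teh : (2%:R / e)%:MP * (e / 2%:R)%:MP = 1 :> {mpoly K[3]}.
  rewrite -mpolyCM (_ : _ * _ = 1) //; field; by rewrite e0 two0.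
move: sub_profile poly_conic; rewrite -!mul_mpolyC.
move: (poly_at p u) (poly_at q u) gE Hx Hy Hz => F G gE Hx Hy Hz sub_profile conicFG.
have [T ET] := lin_subst_rmorph straight_mx.
have [Nx Ny Nz] := N_mapE profile; rewrite -!ET in sub_profile.
apply/colP; apply: ord3P; rewrite [RHS]mxE ?Nx ?Ny ?Nz -ET;
  rewrite mxE big_ord3 /= ![map_mx _ _ _ _]mxE ![straight_mx _ _]mxE !triE Hx Hy Hz.
- by rewrite sub_profile mpolyC0 mul0r add0r.
- rewrite rmorphB !rmorphM (rmorph_nat T) /= sub_profile !ET !subX !triE gE.
  rewrite /x' /z' /A /B /C /affine -!mul_mpolyC !mpolyCM.
  by apply: conj_y_identity; rewrite -mpolyCM.
- rewrite rmorphXn /= sub_profile mpolyC0 mul0r add0r.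
  rewrite [(_ * b1)%:MP]mpolyCM [(_ * b2)%:MP]mpolyCM -!mulrA -mulrDr conicFG.
  by rewrite mulrA teh mul1r.
Qed.

End NormalForm.

(** * Coordinates adapted to the dependent components *)

Section Adapted.
Variables (K : fieldType) (H : polymap K 3 3).
Hypothesis charK : char_zero K.
Hypothesis H0 : polymap_at H 0 = 0.
Hypothesis tr1 : \tr (jacobian H) = 0.
Hypothesis tr2 : \tr (jacobian H *m jacobian H) = 0.
Hypothesis H_indep : components_lin_indep H.
Hypothesis H_dep : alg_dependent (H ix 0) (H iz 0).

Let f := H ix 0.
Let g := H iy 0.
Let h := H iz 0.
Let c : {rmorphism {mpoly K[3]} -> {fraction {mpoly K[3]}}} :=
  @FracField.tofrac {mpoly K[3]}.

Let cI : injective c.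
Proof. by move=> a b /eqP; rewrite tofrac_eq => /eqP. Qed.

Let cF : fractions_of c. Proof. exact: tofrac_fractions. Qed.

Lemma H_at0 i : (H i 0).@[fun=> 0] = 0.
Proof.
move/colP: H0 => /(_ i); rewrite !mxE => E1; rewrite -[RHS]E1.
by apply: meval_eq => j; rewrite mxE.
Qed.

Lemma H_relation (k0 k1 k2 k : K) :
  k0 *: f + k1 *: g + k2 *: h = k%:MP -> [/\ k0 = 0, k1 = 0 & k2 = 0].
Proof.
move=> E1.
have k_eq0 : k = 0.
  have := congr1 (meval (fun=> 0)) E1.
  by rewrite !mevalD !mevalZ !H_at0 mevalC !mulr0 !addr0.
have /H_indep /rowP l0 : linform (\row_j tri k0 k1 k2 j) H = 0.
  by rewrite /linform big_ord3 /= !mxE !triE addrA E1 k_eq0 mpolyC0.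
by split; [have := l0 ix | have := l0 iy | have := l0 iz]; rewrite !mxE triE.
Qed.

Lemma fh_relation (k1 k2 k : K) : k1 *: f + k2 *: h = k%:MP -> k1 = 0 /\ k2 = 0.
Proof.
move=> E1; have [] := @H_relation k1 0 k2 k; first by rewrite scale0r addr0.
by [].
Qed.

Lemma trace1 : f^`M(ix) + g^`M(iy) + h^`M(iz) = 0.
Proof. by rewrite -addrA; have := tr1; rewrite /mxtrace big_ord3 /= !mxE. Qed.

(** The trace of the square is the square of the trace minus twice the sum of the
    principal 2 x 2 minors, one of which vanishes by dependence. *)
Lemma trace2 :
  g^`M(iy) * (f^`M(ix) + h^`M(iz)) = f^`M(iy) * g^`M(ix) + h^`M(iy) * g^`M(iz).
Proof.
have two0 : 2%:R != 0 :> {mpoly K[3]}.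
  by rewrite -(rmorph_nat (@mpolyC 3 K)) mpolyC_eq0; apply: charK.
have minor : f^`M(ix) * h^`M(iz) = f^`M(iz) * h^`M(ix).
  exact: (dependent_minors charK cI cF).
have := tr2; rewrite /mxtrace big_ord3 /= ![(_ *m _) _ _]mxE !big_ord3 /= !mxE.
rewrite -/f -/g -/h => tr2'; apply: (mulfI two0).
apply/eqP; rewrite -subr_eq0; apply/eqP.
transitivity ((f^`M(ix) + g^`M(iy) + h^`M(iz)) ^+ 2
  - 2%:R * (f^`M(ix) * h^`M(iz) - f^`M(iz) * h^`M(ix)) - 0); last first.
  by rewrite trace1 minor subrr mulr0 expr0n /= !subr0.
rewrite -tr2'; ring.
Qed.

Lemma adapted_normal_form : exists (T : 'M[K]_3) (P : {poly K}),
  [/\ T \in unitmx, (1 < size P)%N, P.[0] = 0 & lin_conj T H = N_map P].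
Proof.
have [A [B [C [C1 [C2 [p [q [fE hE]]]]]]]] :=
  level_coordinate charK cI cF H_dep trace1 trace2 fh_relation.
rewrite -/f -/h in fE hE; pose u : {mpoly K[3]} := Y + quad A B C C1 C2.
have u0 : u.@[fun=> 0] = 0 by rewrite mevalD mevalXU quad_at0 addr0.
have p0 : p.[0] = 0 by have := H_at0 ix; rewrite -/f fE poly_at_meval -/u u0.
have q0 : q.[0] = 0 by have := H_at0 iz; rewrite -/h hE poly_at_meval -/u u0.
have pq_indep k1 k2 : k1 *: p + k2 *: q = 0 -> k1 = 0 /\ k2 = 0.
  move=> E1; apply: (@fh_relation _ _ 0).
  by rewrite fE hE -!poly_atZ -poly_atD E1 /poly_at rmorph0 horner0 mpolyC0.
have tr1' := trace1; have tr2' := trace2; rewrite fE hE in tr1' tr2'.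
have [b1 [b2 [gE conic]]] :=
  third_component charK tr1' tr2' p0 q0 (H_at0 iy) pq_indep.
(* Without quadratic part, [g] would be a linear combination of [f] and [h]. *)
have ABC : [|| A != 0, B != 0 | C != 0].
  apply: contraT; rewrite !negb_or !negbK => /and3P[/eqP A0 /eqP B0 /eqP C0].
  have [b10 b20] : b1 = 0 /\ b2 = 0.
    by apply: pq_indep; rewrite conic A0 B0 C0 !mul0r !scale0r !addr0.
  have [|_ /eqP] := @H_relation C1 1 C2 0; last by rewrite oner_eq0.
  rewrite mpolyC0 -/g gE -/(poly_at p u) -/(poly_at q u) fE hE b10 b20 A0 B0 C0.
  by rewrite /affine !scale0r !addr0 -!mul_mpolyC; ring.
have [e [r [s [e0 AE BE CE rs]]]] := polynomial_conic charK p0 q0 pq_indep conic ABC.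
have hp : (r *: p + s *: q).[0] = 0 by rewrite hornerD !hornerZ p0 q0 !mulr0 addr0.
have P0 : (profile p q e r s).[0] = 0.
  by rewrite /profile horner_comp hornerZ hornerX mulr0.
exists (straight_mx e r s b1 b2 C1 C2), (profile p q e r s); split=> //.
- exact: straight_mx_unit.
- apply: size_gt1 => //; apply: contraNneq rs => prof0.
  have : r *: p + s *: q = 0.
    have := congr1 (fun P => P \Po ((2%:R / e) *: 'X)) prof0.
    rewrite /profile -comp_polyA comp_polyZ comp_polyX scalerA.
    rewrite (_ : e / 2%:R * (2%:R / e) = 1) ?scale1r ?comp_polyXr ?comp_poly0 //.
    by field; rewrite e0; exact: (charK 1).
  by move/pq_indep => [-> ->]; rewrite !mul0r subrr.
- rewrite AE BE CE in conic gE fE hE.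
  exact: (@straight_conj K charK p q e r s b1 b2 C1 C2 e0 rs conic g H gE fE erefl hE).
Qed.

End Adapted.

(** The middle row is a unit vector outside the span of [l1] and [l2]. *)
Lemma extend_free_pair (K : fieldType) (l1 l2 : 'rV[K]_3) : free [:: l1; l2] ->
  exists2 T : 'M[K]_3, T \in unitmx & row ix T = l1 /\ row iz T = l2.
Proof.
move=> l_free; pose L := col_mx l1 l2.
have [i Li] : exists i, ~~ (row i (1%:M : 'M[K]_3) <= L)%MS.
  apply/existsP; rewrite -negb_forall; apply/negP => /forallP all_L.
  have : (1%:M <= L)%MS by apply/row_subP.
  by move/mxrankS; rewrite mxrank1 => /leq_trans/(_ (rank_leq_row _)).
pose m := row i (1%:M : 'M[K]_3).
pose T := \matrix_j tri l1 m l2 j : 'M[K]_3.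
have rowT j : row j T = tri l1 m l2 j by rewrite rowK.
exists T; last by rewrite !rowT !triE.
rewrite -row_free_unit -kermx_eq0; apply/rowV0P => v /sub_kermxP vT.
have vE : v 0 ix *: l1 + (v 0 iy *: m + v 0 iz *: l2) = 0.
  by rewrite -[RHS]vT mulmx_sum_row big_ord3 /= !rowT !triE.
have vy : v 0 iy = 0.
  apply: contraNeq Li => vy; rewrite -/m -(eqmx_scale m vy).
  have -> : v 0 iy *: m = - (v 0 ix *: l1 + v 0 iz *: l2).
    by apply/eqP; rewrite -addr_eq0 addrCA vE.
  rewrite eqmx_opp addmx_sub // scalemx_sub //.
    by rewrite -addsmxE addsmxSl.
  by rewrite -addsmxE addsmxSr.
move: vE; rewrite vy scale0r add0r => vE.
have /freeP/(_ (fun k : 'I_2 => if k == ord0 then v 0 ix else v 0 iz)) := l_free.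
rewrite !big_ord_recl big_ord0 /= addr0 => /(_ vE) v0.
have vx : v 0 ix = 0 by have := v0 ord0.
have vz : v 0 iz = 0 by have := v0 (lift ord0 ord0).
by apply/rowP; apply: ord3P; rewrite mxE.
Qed.

Theorem proposition4p2 (K : fieldType) (H : polymap K 3 3) :
  [pchar K] =i pred0 ->
  polymap_at H 0 = 0 ->
  nilpotent_mx (jacobian H) ->
  components_lin_indep H ->
  (exists l1 l2 : 'rV[K]_3,
     free [:: l1; l2] /\ alg_dependent (linform l1 H) (linform l2 H)) ->
  exists (T : 'M[K]_3) (P : {poly K}),
    [/\ T \in unitmx, (1 < size P)%N, P.[0] = 0 & lin_conj T H = N_map P].
Proof.
move=> /char_zero_field charK H0 nilJ indep [l1 [l2 [l_free dep]]].
have [S uS [S1 S2]] := extend_free_pair l_free.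
have [tr1 tr2] := lin_conj_traces uS nilJ.
have [u Eu] := lin_subst_rmorph (invmx S).
have compE i : lin_conj S H i 0 = u (linform (row i S) H).
  rewrite /lin_conj mxE Eu /linform.
  transitivity (u (linform (row i S) H)); last by rewrite Eu.
  rewrite /linform rmorph_sum /=; apply: eq_bigr => j _.
  by rewrite !mxE -mul_mpolyC rmorphM /= !Eu lin_substC.
have dep' : alg_dependent (lin_conj S H ix 0) (lin_conj S H iz 0).
  rewrite !compE S1 S2; apply: alg_dependent_rmorph dep => a.
  by rewrite Eu lin_substC.
have [T [P [uT sizeP P0 TE]]] := adapted_normal_form charK (lin_conj_at0 S H0) tr1 tr2
  (lin_conj_indep uS indep) dep'.
exists (T *m S), P; split=> //; first by rewrite unitmx_mul uT.
by rewrite lin_conjM.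
Qed.
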